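(* For any constants $\epsilon,\delta,C_1>0$ there exists a constant $C_2>0$ such that the following holds. Let $p=p(n)\le n$ be integers with $\lim_{n\to\infty}p/n=y$ for some $0<y\le1$. Let $M=M_{p,n}=(\zeta_{ij})_{1\le i\le p,1\le j\le n}$ be a $p\times n$ random matrix whose entries are independent $K$-bounded random variables with mean $0$ and variance $1$ (where $K$ may depend on $n$), and consider the covariance matrix $W=\frac1nM^*M$. Then, for all sufficiently large $n$, with probability at least $1-n^{-C_1}$ one has $$\left|N_I(W)-p\int_I\rho_{MP,y}(x)\,dx\right|\le\delta p\int_I\rho_{MP,y}(x)\,dx$$ for any interval $I\subset(a+\epsilon,b-\epsilon)$ of length at least $C_2K^2\log n/n$, where $a=(1-\sqrt y)^2$ and $b=(1+\sqrt y)^2$.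
   Context: A (complex) random variable $\xi$ is $K$-bounded if $|\xi|\le K$ with probability $1$; its variance is $\mathbf{E}|\xi-\mathbf{E}\xi|^2$. The $n\times n$ matrix $W$ has at most $p$ nonzero eigenvalues, ordered $0\le\lambda_1(W)\le\dots\le\lambda_p(W)$ (equivalently, these are the eigenvalues of $\frac1nMM^*$); $N_I(W)$ is the number of these in the interval $I$. The Marchenko–Pastur density is $$\rho_{MP,y}(x)=\frac{1}{2\pi xy}\sqrt{(b-x)(x-a)}\,\mathbf{1}_{[a,b]}(x).$$ *)

(* Defs.v *)
From HB Require Import structures.
From mathcomp Require Import all_boot all_order all_algebra.
From mathcomp Require Import all_classical all_reals all_analysis.
From mathcomp Require Import complex.

Set Implicit Arguments.
Unset Strict Implicit.
Unset Printing Implicit Defensive.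

Import Order.TTheory GRing.Theory Num.Theory.
Import numFieldNormedType.Exports.

Local Open Scope classical_set_scope.
Local Open Scope ring_scope.

(* [R[i]] with its Borel sigma-algebra; the topology is the one of the
   normed space [R[i]^o], i.e. that of the complex modulus. *)
Definition borelC (R : realType) := g_sigma_algebraType (@open R[i]^o).

Section complex_random_variables.
Context (d : measure_display) (T : measurableType d) (R : realType).
Variable P : probability T R.

Definition complex_rv (X : T -> R[i]) :=
  measurable_fun setT (X : T -> borelC R).

Definition K_bounded (K : R) (X : T -> R[i]) :=
  P [set t | Normc.normc (X t) <= K] = 1%E.

(* The library expectation is extended-real valued; [fine] loses nothing for
   integrable variables, in particular for [K]-bounded ones. *)
Definition cexpectation (X : T -> R[i]) : R[i] :=
  Complex (fine ('E_P[fun t => complex.Re (X t)])%E)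
          (fine ('E_P[fun t => complex.Im (X t)])%E).

Definition cvariance (X : T -> R[i]) : \bar R :=
  ('E_P[fun t => (Normc.normc (X t - cexpectation X) ^+ 2)%R])%E.

(* For a finite family the product rule over the whole index set covers the
   subfamilies: take [B i = setT] outside of the subfamily. *)
Definition independent_rvs (I : finType) (X : I -> T -> R[i]) :=
  forall B : I -> set (borelC R), (forall i, measurable (B i)) ->
    P (\bigcap_(i in [set: I]) X i @^-1` B i) =
    (\prod_(i : I) P (X i @^-1` B i))%E.

(* [E] holds with probability at least [q]; [E] is not required to be
   measurable, only to contain an event of probability at least [q]. *)
Definition with_probability_ge (q : R) (E : set T) :=
  exists2 A : set T, measurable A & A `<=` E /\ (q%:E <= P A)%E.

End complex_random_variables.

Section covariance_matrices.
Variable R : realType.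

(* All eigenvalues, repeated according to algebraic multiplicity. *)
Definition eigenvalues (n : nat) (A : 'M[R[i]]_n) : seq R[i] :=
  sval (closed_field_poly_normal (char_poly A)).

Definition sample_covariance (p n : nat) (M : 'M[R[i]]_(p, n)) : 'M[R[i]]_n :=
  n%:R^-1 *: ((M ^t*)%sesqui *m M).

(* [:: lambda_1; ..; lambda_p], in increasing order: the [p] largest of the
   [n] eigenvalues of the Hermitian matrix [W]; when [W] is the covariance
   matrix of a [p] x [n] matrix, [p <= n], the [n - p] dropped ones are [0]. *)
Definition top_eigenvalues (p n : nat) (W : 'M[R[i]]_n) : seq R :=
  drop (n - p)
    (sort <=%R [seq complex.Re z | z <- eigenvalues W]).

Definition eigenvalue_count (p n : nat) (W : 'M[R[i]]_n) (I : interval R)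
  : nat := count (fun x => x \in I) (top_eigenvalues p W).

Definition MP_a (y : R) : R := (1 - Num.sqrt y) ^+ 2.
Definition MP_b (y : R) : R := (1 + Num.sqrt y) ^+ 2.

Definition MP_density (y x : R) : R :=
  (2 * pi * x * y)^-1 * Num.sqrt ((MP_b y - x) * (x - MP_a y))
  * \1_(`[MP_a y, MP_b y]%classic) x.

Definition MP_mass (y : R) (I : interval R) : R :=
  (\int[lebesgue_measure]_(x in [set` I]) MP_density y x)%R.

End covariance_matrices.

(* Main.v *)
Require Import Defs.
From HB Require Import structures.
From mathcomp Require Import all_boot all_order all_algebra.
From mathcomp Require Import all_classical all_reals all_analysis.
From mathcomp Require Import measurable_realfun complex ring lra.

(** Let [m (z)] be the normalized trace of the resolvent [(W - z)^-1]. Its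
    imaginary part at [E + i * eta] is an average of Poisson kernels of width
    [eta] centred at the eigenvalues, so eigenvalues in an interval are counted
    by integrating it, as soon as [eta] is a small fraction of the length. The
    theorem is therefore a local law: down to [eta] of order
    [K ^+ 2 * ln n / n], the function [v = z * m (z)] almost solves the equation
    [v ^+ 2 + (z + 1 - y) * v + z = 0], whose solution in the upper half-plane
    has, on the real axis, the Marchenko-Pastur density as imaginary part of
    [v / z], up to the factor [pi * y].

    The equation comes from removing one row at a time. Let [q k] be [n^-1] times
    the quadratic form in row [k] of the resolvent of [W] without that row. The
    rank-one formula gives the exact identity
    [1 + z * m = n^-1 * \sum_k q k / (1 + q k)] ([tr_resolvent_loo]), and
    replacing every [q k] by [m] gives the equation with [p / n] for [y]
    ([residual_step]). The row is independent of the matrix of the form, so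
    [q k] concentrates around the normalized trace of that matrix, which is
    within [(n * eta)^-1] of [m] ([tr_rank_one_le]). The concentration is a
    Hanson-Wright inequality ([quadratic_form_mgf_le]), proved by decoupling the
    form with a random bipartition of the indices. Ward's identity
    ([ward_right]) evaluates the squared Frobenius norm of its matrix as
    [Im m / (n * eta)], and a relative deviation [tau] has probability at most
    [expR (- c * tau ^+ 2 * n * eta / K ^+ 2)] ([loo_deviation_le]). This is
    where the scale [K ^+ 2 * ln n / n] comes from: there the bound beats any
    fixed power of [n], hence a union bound over a grid of polynomial size.

    Turning the equation into an estimate requires a bound on [m] and a lower
    bound on [1 + m] beforehand. Both are trivial at height [4], a small
    residual reproduces them with room to spare ([residual_apriori]), and [m]
    varies little between neighbouring points of the grid, so they propagate
    downwards ([grid_local_law]). In the bulk the two roots of the equation are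
    separated, which gives the closeness of [Im m] to its limit
    ([mp_stability]).

    Independence is used only on finite product spaces: the entries are rounded
    to finitely many values and corrected to have exactly mean [0] and variance
    [1] ([discretization]), at a negligible cost for the resolvents
    ([local_law_everywhere]).

    To count the eigenvalues in [I], the Poisson sums are integrated over [I]
    enlarged or shrunk by [r], with [eta] much smaller than [r] and [r] much
    smaller than the length. Kernels centred in [I] have almost all their mass
    in the enlarged interval ([count_upper]); kernels centred outside [I] are,
    on the shrunk interval, dominated by those of width [r] ([count_lower]),
    for which the a priori bound is sufficient. *)

Set Implicit Arguments.
Unset Strict Implicit.
Unset Printing Implicit Defensive.

Import Order.TTheory GRing.Theory Num.Theory.
Import numFieldNormedType.Exports.

Local Open Scope classical_set_scope.
Local Open Scope ring_scope.

(** * Expectations over finite product spaces *)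
Section finite_product_expectation.
Variables (R : realType) (I V : finType) (w : I -> V -> R).

Definition prob_weights := forall i, (forall v, 0 <= w i v) /\ \sum_v w i v = 1.

(** Expectation under the product of the coordinate laws [w i]. *)
Definition fexp (f : {ffun I -> V} -> R) : R :=
  \sum_(o : {ffun I -> V}) (\prod_i w i (o i)) * f o.

Definition resample (A : {set I}) (o o' : {ffun I -> V}) : {ffun I -> V} :=
  [ffun i => if i \in A then o' i else o i].

Hypothesis w_prob : prob_weights.

Lemma fexp_weight_ge0 (o : {ffun I -> V}) : 0 <= \prod_i w i (o i).
Proof. by apply: prodr_ge0 => i _; case: (w_prob i). Qed.

Lemma fexp_prod (g : I -> V -> R) :
  fexp (fun o => \prod_i g i (o i)) = \prod_i \sum_v w i v * g i v.
Proof.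
rewrite bigA_distr_bigA /=; apply: eq_bigr => o _.
by rewrite -big_split.
Qed.

Lemma eq_fexp (f g : {ffun I -> V} -> R) : f =1 g -> fexp f = fexp g.
Proof. by move=> fg; apply: eq_bigr => o _; rewrite fg. Qed.

Lemma fexp_weight_sum : \sum_(o : {ffun I -> V}) \prod_i w i (o i) = 1.
Proof.
have := fexp_prod (fun _ _ => 1); rewrite /fexp => H.
transitivity (\sum_(o : {ffun I -> V}) \prod_i w i (o i) * \prod_(i : I) (1 : R)).
  by apply: eq_bigr => o _; rewrite [X in _ * X]big1 ?mulr1.
rewrite H big1// => i _; under eq_bigr do rewrite mulr1.
by case: (w_prob i).
Qed.

Lemma fexp_cst (c : R) : fexp (fun=> c) = c.
Proof. by rewrite /fexp -big_distrl /= fexp_weight_sum mul1r. Qed.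

Lemma ler_fexp (f g : {ffun I -> V} -> R) : (forall o, f o <= g o) -> fexp f <= fexp g.
Proof. by move=> fg; apply: ler_sum => o _; rewrite ler_wpM2l ?fexp_weight_ge0. Qed.

Lemma fexp_ge0 (f : {ffun I -> V} -> R) : (forall o, 0 <= f o) -> 0 <= fexp f.
Proof. by move=> f0; apply: sumr_ge0 => o _; rewrite mulr_ge0 ?fexp_weight_ge0. Qed.

Lemma fexpZ (c : R) f : fexp (fun o => c * f o) = c * fexp f.
Proof. by rewrite /fexp big_distrr /=; apply: eq_bigr => o _; rewrite mulrCA. Qed.

Lemma fexpD f g : fexp (fun o => f o + g o) = fexp f + fexp g.
Proof. by rewrite /fexp -big_split /=; apply: eq_bigr => o _; rewrite mulrDr. Qed.

Lemma fexp_sum (J : Type) (r : seq J) (P : pred J) (F : J -> {ffun I -> V} -> R) :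
  fexp (fun o => \sum_(j <- r | P j) F j o) = \sum_(j <- r | P j) fexp (F j).
Proof.
by rewrite /fexp exchange_big /=; apply: eq_bigr => o _; rewrite big_distrr.
Qed.

Lemma resampleK (A : {set I}) o o' :
  resample A (resample A o o') (resample A o' o) = o.
Proof. by apply/ffunP => i; rewrite !ffunE; case: (i \in A). Qed.

(** Exchanging the coordinates in [A] of two independent samples is an
    involution which preserves their joint weight. *)
Lemma fexp_resample (A : {set I}) f :
  fexp f = fexp (fun o => fexp (fun o' => f (resample A o o'))).
Proof.
pose wt (o : {ffun I -> V}) := \prod_i w i (o i).
have -> : fexp f = \sum_(u : {ffun I -> V} * {ffun I -> V}) wt u.1 * wt u.2 * f u.1.
  rewrite -(pair_bigA _ (fun o o' => wt o * wt o' * f o)) /=.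
  apply: eq_bigr => o _; rewrite -big_distrl -big_distrr /=.
  by rewrite fexp_weight_sum mulr1.
have -> : fexp (fun o => fexp (fun o' => f (resample A o o'))) =
    \sum_(u : {ffun I -> V} * {ffun I -> V}) wt u.1 * wt u.2 * f (resample A u.1 u.2).
  rewrite -(pair_bigA _ (fun o o' => wt o * wt o' * f (resample A o o'))) /=.
  by apply: eq_bigr => o _; rewrite big_distrr /=; apply: eq_bigr => o' _; rewrite mulrA.
pose s (u : {ffun I -> V} * {ffun I -> V}) := (resample A u.1 u.2, resample A u.2 u.1).
have sK : involutive s by case=> o o1; rewrite /s /= !resampleK.
rewrite (reindex_inj (inv_inj sK)) /=; apply: eq_bigr => u _ /=; case: u => o o1 /=.
congr (_ * _); rewrite /wt -!big_split /=; apply: eq_bigr => i _.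
by rewrite !ffunE; case: ifP => // _; rewrite mulrC.
Qed.

Lemma fexp_marginal (i : I) (g : V -> R) : fexp (fun o => g (o i)) = \sum_v w i v * g v.
Proof.
have H := fexp_prod (fun j v => if j == i then g v else 1).
rewrite (bigD1 i) //= eqxx in H.
transitivity (fexp (fun o : {ffun I -> V} => \prod_j (if j == i then g (o j) else 1))).
  apply: eq_fexp => o; rewrite (bigD1 i) //= eqxx big1 ?mulr1// => j /negbTE ->//.
rewrite H [X in _ * X]big1 ?mulr1// => j /negbTE ->.
by under eq_bigr do rewrite mulr1; case: (w_prob j).
Qed.

End finite_product_expectation.

Lemma fexp_exchange (R : realType) (I V I' V' : finType) (w : I -> V -> R) (w' : I' -> V' -> R)
    (f : {ffun I -> V} -> {ffun I' -> V'} -> R) :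
  fexp w (fun o => fexp w' (f o)) = fexp w' (fun a => fexp w (f^~ a)).
Proof.
rewrite /fexp (eq_bigr _ (fun o _ => mulr_sumr _ _ _ _)) exchange_big /=.
apply: eq_bigr => a _; rewrite mulr_sumr.
by apply: eq_bigr => o _; rewrite mulrCA.
Qed.

(** * Squared modulus and exponential moments *)
Section complex_squared_modulus.
Variable R : realType.
Local Notation C := R[i].
Implicit Types (u v t : C) (r : R).

Lemma ReD u v : complex.Re (u + v) = complex.Re u + complex.Re v.
Proof. by case: u v => [a b] [c d]. Qed.
Lemma ImD u v : complex.Im (u + v) = complex.Im u + complex.Im v.
Proof. by case: u v => [a b] [c d]. Qed.
Lemma ReN u : complex.Re (- u) = - complex.Re u.
Proof. by case: u. Qed.
Lemma ImN u : complex.Im (- u) = - complex.Im u.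
Proof. by case: u. Qed.
Lemma ReM u v : complex.Re (u * v) =
  complex.Re u * complex.Re v - complex.Im u * complex.Im v.
Proof. by case: u v => [a b] [c d]. Qed.
Lemma ImM u v : complex.Im (u * v) =
  complex.Re u * complex.Im v + complex.Im u * complex.Re v.
Proof. by case: u v => [a b] [c d] /=. Qed.
Lemma ReJ u : complex.Re (u^*) = complex.Re u.
Proof. by case: u. Qed.
Lemma ImJ u : complex.Im (u^*) = - complex.Im u.
Proof. by case: u. Qed.
Lemma Re_real r : complex.Re (r%:C)%C = r. Proof. by []. Qed.
Lemma Im_real r : complex.Im (r%:C)%C = 0. Proof. by []. Qed.

Lemma Re_sum (J : Type) (s : seq J) (P : pred J) (F : J -> C) :
  complex.Re (\sum_(j <- s | P j) F j) = \sum_(j <- s | P j) complex.Re (F j).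
Proof. exact: (big_morph (@complex.Re R) ReD (erefl : complex.Re (0 : C) = 0)). Qed.
Lemma Im_sum (J : Type) (s : seq J) (P : pred J) (F : J -> C) :
  complex.Im (\sum_(j <- s | P j) F j) = \sum_(j <- s | P j) complex.Im (F j).
Proof. exact: (big_morph (@complex.Im R) ImD (erefl : complex.Im (0 : C) = 0)). Qed.

Lemma Re_scaleM r u v t : complex.Re (u * ((r%:C)%C * v) * t) = r * complex.Re (u * v * t).
Proof. by rewrite !(ReM, ImM) /=; ring. Qed.
Lemma conjCM u v : (u * v)^* = u^* * v^*. Proof. exact: rmorphM. Qed.
Lemma conjC_sum (J : Type) (s : seq J) (P : pred J) (F : J -> C) :
  (\sum_(j <- s | P j) F j)^* = \sum_(j <- s | P j) (F j)^*.
Proof. exact: rmorph_sum. Qed.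

Definition sqn u : R := complex.Re u ^+ 2 + complex.Im u ^+ 2.

Lemma sqn_ge0 u : 0 <= sqn u.
Proof. by rewrite addr_ge0 ?sqr_ge0. Qed.
Lemma sqnM u v : sqn (u * v) = sqn u * sqn v.
Proof. by rewrite /sqn ReM ImM; ring. Qed.
Lemma sqnJ u : sqn (u^*) = sqn u.
Proof. by rewrite /sqn ReJ ImJ sqrrN. Qed.
Lemma sqnN u : sqn (- u) = sqn u.
Proof. by rewrite /sqn ReN ImN !sqrrN. Qed.
Lemma sqn0 : sqn 0 = 0.
Proof. by rewrite /sqn /= expr0n addr0. Qed.
Lemma sqr_Re_le u : complex.Re u ^+ 2 <= sqn u.
Proof. by rewrite lerDl sqr_ge0. Qed.
Lemma sqr_Im_le u : complex.Im u ^+ 2 <= sqn u.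
Proof. by rewrite lerDr sqr_ge0. Qed.
Lemma mulJ_sqn u : u * u^* = (sqn u)%:C%C.
Proof.
apply/eqP; rewrite eq_complex; apply/andP; split; apply/eqP.
  by rewrite ReM ReJ ImJ Re_real /sqn; ring.
by rewrite ImM ReJ ImJ Im_real; ring.
Qed.
Lemma sqn_real r : sqn (r%:C)%C = r ^+ 2.
Proof. by rewrite /sqn Re_real Im_real expr0n addr0. Qed.
Lemma Re_mulJ u v : complex.Re (u * v^*) = complex.Re u * complex.Re v + complex.Im u * complex.Im v.
Proof. by rewrite ReM ReJ ImJ; ring. Qed.

End complex_squared_modulus.

Section exponential_bounds.
Variable R : realType.
Implicit Types x : R.

(** The bound for [0 < x] comes from [expR (x / 2) <= (1 - x / 2)^-1]. *)
Lemma expR_le_quadratic x : x <= 1 -> expR x <= 1 + x + 2 * x ^+ 2.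
Proof.
move=> x1; have d : 0 < 1 - x / 2 by lra.
have H : (1 - x / 2) ^+ 2 * expR x <= 1.
  have -> : expR x = (expR (- (x / 2)))^-1 ^+ 2.
    by rewrite -expRN opprK -expRM_natl; congr expR; lra.
  have e0 := expR_gt0 (- (x / 2)); have e1 := expR_ge1Dx (- (x / 2)).
  have e2 : (1 - x / 2) * (expR (- (x / 2)))^-1 <= 1 by rewrite ler_pdivrMr // mul1r.
  rewrite -exprMn; apply: exprn_ile1 => //; apply: mulr_ge0; first exact: ltW.
  by rewrite invr_ge0 ltW.
have P : 1 <= (1 - x / 2) ^+ 2 * (1 + x + 2 * x ^+ 2).
  have -> : (1 - x / 2) ^+ 2 * (1 + x + 2 * x ^+ 2) =
    1 + x ^+ 2 * ((1 - x) * (1 - x / 2) + (1 - x) / 4) by field.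
  by rewrite lerDl mulr_ge0 ?sqr_ge0//; nra.
by rewrite -(ler_pM2l (exprn_gt0 2 d)) (le_trans H).
Qed.

Lemma expR_sum (J : Type) (s : seq J) (P : pred J) (F : J -> R) :
  expR (\sum_(j <- s | P j) F j) = \prod_(j <- s | P j) expR (F j).
Proof. exact: (big_morph (@expR R) (@expRD R) (expR0 R)). Qed.

Lemma expR_midpoint x (y : R) : expR (x + y) <= (expR (2 * x) + expR (2 * y)) / 2.
Proof.
have -> : expR (2 * x) = expR x ^+ 2 by rewrite -expRM_natl.
have -> : expR (2 * y) = expR y ^+ 2 by rewrite -expRM_natl.
by rewrite expRD; have := sqr_ge0 (expR x - expR y); nra.
Qed.

Variable V : finType.
Variable w : V -> R.
Hypotheses (w_ge0 : forall v, 0 <= w v) (w_sum : \sum_v w v = 1).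

(** For [1 < c] the crude bound [X <= c] is enough; otherwise [`|X| <= 1]
    and the second-order bound applies. *)
Lemma centered_mgf_le (X : V -> R) (c : R) :
  \sum_v w v * X v = 0 -> (forall v, X v ^+ 2 <= c) ->
  \sum_v w v * expR (X v) <= expR (2 * c).
Proof.
move=> X0 Xc; have [c1|c1] := lerP c 1.
  apply: (@le_trans _ _ (\sum_v (w v * 1 + w v * X v + w v * (2 * c)))).
    apply: ler_sum => v _; rewrite -!mulrDr ler_wpM2l//.
    apply: le_trans (expR_le_quadratic _) _; first by have := Xc v; nra.
    by have := Xc v; lra.
  rewrite !big_split /= X0 -!big_distrl /= w_sum !mul1r addr0.
  exact: expR_ge1Dx.
apply: (@le_trans _ _ (\sum_v w v * expR (2 * c))).
  apply: ler_sum => v _; rewrite ler_wpM2l// ler_expR.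
  by have := Xc v; nra.
by rewrite -big_distrl /= w_sum mul1r.
Qed.

End exponential_bounds.

(** * Exponential moments of quadratic forms *)
Section decoupling.
Variables (R : realType) (I V : finType) (w : I -> V -> R) (x : I -> V -> R[i]) (B : R).
Hypothesis w_prob : prob_weights w.
Hypothesis x_Re0 : forall i, \sum_v w i v * complex.Re (x i v) = 0.
Hypothesis x_Im0 : forall i, \sum_v w i v * complex.Im (x i v) = 0.
Hypothesis x_var : forall i, \sum_v w i v * sqn (x i v) = 1.
Hypothesis x_bound : forall i v, sqn (x i v) <= B.

Local Notation sample := {ffun I -> V}.
Local Notation E := (fexp w).
Local Notation fairs := (fun (_ : I) (_ : bool) => (2^-1 : R)).

Lemma fairs_prob : prob_weights fairs.
Proof. by move=> i; split=> [b|]; rewrite ?invr_ge0// big_bool /=; lra. Qed.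

(** Jensen's inequality, from the tangent line of the exponential at the mean. *)
Lemma expR_fexp_le (f : {ffun I -> bool} -> R) :
  expR (fexp fairs f) <= fexp fairs (fun a => expR (f a)).
Proof.
set m := fexp fairs f.
apply: (@le_trans _ _ (fexp fairs (fun a => expR m * (1 + (f a - m))))).
  rewrite (fexpZ fairs) !(fexpD fairs) !(fexp_cst fairs_prob) -/m.
  by rewrite subrr addr0 mulr1.
apply: (ler_fexp fairs_prob) => a.
have := expR_ge1Dx (f a - m).
rewrite -(ler_pM2l (expR_gt0 m)) -expRD.
by rewrite (_ : m + (f a - m) = f a)//; ring.
Qed.

Lemma bound_ge1 : I -> 1 <= B.
Proof.
move=> i; rewrite -(x_var i) -[B]mul1r -(proj2 (w_prob i)) mulr_suml.
by apply: ler_sum => v _; rewrite ler_wpM2l ?x_bound//; case: (w_prob i).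
Qed.

Definition offdiag (c : I -> I -> R[i]) (J : {set I}) (o : sample) : R :=
  \sum_(i in J) \sum_(j in J | j != i) complex.Re (x i (o i) * c i j * (x j (o j))^*).

(** The terms of the off-diagonal form whose first index is in the half [a] and
    whose second index is outside; given the coordinates outside, they are
    linear in those inside. *)
Definition decoupled (c : I -> I -> R[i]) (J : {set I}) (a : {ffun I -> bool})
    (o : sample) : R :=
  \sum_(i in J | a i) \sum_(j in J | ~~ a j)
     complex.Re (x i (o i) * c i j * (x j (o j))^*).

Definition half_image (c : I -> I -> R[i]) (J : {set I}) (a : {ffun I -> bool})
    (o : sample) (i : I) : R[i] := \sum_(j in J | ~~ a j) c i j * (x j (o j))^*.

Lemma fexp_separates (i j : I) : i != j ->
  fexp fairs (fun a => (a i && ~~ a j)%:R) = 4^-1.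
Proof.
move=> ij.
pose g (k : I) (b : bool) : R := if k == i then b%:R else if k == j then (~~ b)%:R else 1.
transitivity (fexp fairs (fun a => \prod_k g k (a k))).
  apply: eq_fexp => a; rewrite (bigD1 i)//= (bigD1 j) /=; last by rewrite eq_sym.
  rewrite big1 => [|k /andP[/negbTE ki /negbTE kj]]; last by rewrite /g ki kj.
  by rewrite /g !eqxx eq_sym (negbTE ij) mulr1 -natrM mulnb.
rewrite fexp_prod (bigD1 i)//= (bigD1 j) /=; last by rewrite eq_sym.
rewrite [X in _ * (_ * X)]big1 => [|k /andP[/negbTE ki /negbTE kj]]; last first.
  by rewrite !big_bool /g ki kj /=; lra.
by rewrite !big_bool /g !eqxx eq_sym (negbTE ij) /=; lra.
Qed.

(** An off-diagonal pair is separated by a uniformly random subset with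
    probability one quarter. *)
Lemma offdiag_average c J o :
  offdiag c J o = fexp fairs (fun a => 4 * decoupled c J a o).
Proof.
rewrite fexpZ /offdiag /decoupled.
transitivity (4 * fexp fairs (fun a : {ffun I -> bool} =>
  \sum_(i in J) \sum_(j in J | j != i)
    (complex.Re (x i (o i) * c i j * (x j (o j))^*) * (a i && ~~ a j)%:R))).
  rewrite fexp_sum mulr_sumr; apply: eq_bigr => i iJ.
  rewrite fexp_sum mulr_sumr; apply: eq_bigr => j /andP[jJ ji].
  by rewrite fexpZ fexp_separates 1?eq_sym// mulrCA divff ?mulr1// pnatr_eq0.
congr (_ * _); apply: eq_fexp => a.
rewrite big_mkcondr /=; apply: eq_bigr => i iJ.
case: ifP => ai; last by rewrite big1// => j _; rewrite andFb mulr0.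
rewrite big_mkcondr [RHS]big_mkcondr /=; apply: eq_bigr => j jJ.
have [->|ji] := eqVneq j i; first by rewrite ai.
by case: (a j); rewrite /= ?mulr0 ?mulr1.
Qed.

(** Given the coordinates outside [a], the exponent is a sum of independent
    centered variables indexed by [a]. *)
Lemma decoupled_mgf_le c J a :
  E (fun o => expR (4 * decoupled c J a o)) <=
  E (fun o => expR (32 * B * \sum_(i in J | a i) sqn (half_image c J a o i))).
Proof.
(* The coordinates in [a] come from an independent copy, so that [half_image]
   is constant in the inner expectation. *)
rewrite (fexp_resample w_prob [set i | a i]); apply: (ler_fexp w_prob) => o.
pose f i v := if (i \in J) && a i then
  4 * complex.Re (x i v * half_image c J a o i) else 0.
rewrite (@eq_fexp _ _ _ w _ (fun o' : sample => \prod_i expR (f i (o' i)))); last first.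
  move=> o'; rewrite -expR_sum; congr expR; rewrite /f -big_mkcond mulr_sumr /=.
  apply: eq_bigr => i /andP[iJ ai]; congr (_ * _).
  rewrite ffunE inE ai /half_image mulr_sumr Re_sum.
  apply: eq_bigr => j /andP[jJ aj]; rewrite ffunE inE (negbTE aj).
  by rewrite mulrA.
rewrite (fexp_prod w (fun i v => expR (f i v))) mulr_sumr [X in expR X]big_mkcond expR_sum /=.
apply: ler_prod => i _; have [wi0 wi1] := w_prob i; apply/andP; split.
  by apply: sumr_ge0 => v _; rewrite mulr_ge0 ?expR_ge0.
rewrite /f; case: ifP => _; last first.
  by rewrite expR0 -big_distrl /= wi1 mulr1.
set u := half_image _ _ _ _ _.
have -> : 32 * B * sqn u = 2 * (16 * (B * sqn u)) by ring.
apply: centered_mgf_le => // [|v].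
  transitivity (4 * ((\sum_v w i v * complex.Re (x i v)) * complex.Re u -
                     (\sum_v w i v * complex.Im (x i v)) * complex.Im u)).
    rewrite !mulr_suml -sumrB mulr_sumr; apply: eq_bigr => v _; rewrite ReM; ring.
  by rewrite x_Re0 x_Im0 !mul0r subrr mulr0.
have -> : (4 * complex.Re (x i v * u)) ^+ 2 = 16 * complex.Re (x i v * u) ^+ 2 by ring.
rewrite ler_pM2l//; apply: le_trans (sqr_Re_le _) _.
by rewrite sqnM ler_wpM2r ?sqn_ge0.
Qed.

(** Averaging over random bipartitions reduces the off-diagonal form, by
    convexity of the exponential, to its decoupled versions. *)
Lemma offdiag_mgf_le c J :
  E (fun o => expR (offdiag c J o)) <=
  fexp fairs (fun a =>
    E (fun o => expR (32 * B * \sum_(i in J | a i) sqn (half_image c J a o i)))).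
Proof.
apply: (@le_trans _ _ (E (fun o => fexp fairs (fun a => expR (4 * decoupled c J a o))))).
  by apply: (ler_fexp w_prob) => o; rewrite offdiag_average; exact: expR_fexp_le.
rewrite [leLHS](_ : _ = fexp fairs (fun a => E (fun o => expR (4 * decoupled c J a o)))).
  by apply: (ler_fexp fairs_prob) => a; exact: decoupled_mgf_le.
exact: fexp_exchange.
Qed.

Definition image_sq (b : I -> I -> R[i]) (J : {set I}) (o : sample) : R :=
  \sum_i sqn (\sum_(j in J) b i j * (x j (o j))^*).

Definition frob_sq (b : I -> I -> R[i]) : R := \sum_i \sum_j sqn (b i j).

Definition opnorm_sq_le (b : I -> I -> R[i]) (L : R) :=
  forall u : I -> R[i], \sum_i sqn (\sum_j b i j * u j) <= L * \sum_j sqn (u j).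

Definition adjoint (b : I -> I -> R[i]) (i j : I) : R[i] := (b j i)^*.

Definition gram (b : I -> I -> R[i]) (l j : I) : R[i] := \sum_i adjoint b l i * b i j.

Lemma image_sq_split b J o :
  image_sq b J o = \sum_(j in J) complex.Re (gram b j j) * sqn (x j (o j)) +
                   offdiag (gram b) J o.
Proof.
transitivity (\sum_(l in J) \sum_(j in J) complex.Re (x l (o l) * gram b l j * (x j (o j))^*)).
  rewrite /image_sq /gram.
  transitivity (\sum_i \sum_(l in J) \sum_(j in J)
     complex.Re (x l (o l) * (adjoint b l i * b i j) * (x j (o j))^*)); last first.
    rewrite exchange_big /=; apply: eq_bigr => l _; rewrite exchange_big /=.
    apply: eq_bigr => j _; rewrite -Re_sum; congr complex.Re.
    by rewrite mulr_sumr mulr_suml.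
  apply: eq_bigr => i _; rewrite -[LHS]Re_real -mulJ_sqn mulrC conjC_sum mulr_suml Re_sum.
  apply: eq_bigr => l _; rewrite mulr_sumr Re_sum; apply: eq_bigr => j _.
  by rewrite conjCM conjCK /adjoint; congr complex.Re; ring.
rewrite /offdiag -big_split /=; apply: eq_bigr => l lJ.
rewrite (bigD1 l) //=; congr (_ + _).
by rewrite mulrAC mulJ_sqn mulrC ReM Re_real Im_real mulr0 subr0.
Qed.

Lemma Re_gram_diag b j : complex.Re (gram b j j) = \sum_i sqn (b i j).
Proof.
by rewrite Re_sum; apply: eq_bigr => i _; rewrite /adjoint mulrC mulJ_sqn.
Qed.

Lemma sum_Re_gram_diag b : \sum_j complex.Re (gram b j j) = frob_sq b.
Proof.
by rewrite /frob_sq exchange_big /=; apply: eq_bigr => j _; rewrite Re_gram_diag.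
Qed.

Lemma col_sq_le b L j : opnorm_sq_le b L -> \sum_i sqn (b i j) <= L.
Proof.
move=> /(_ (fun k => (k == j)%:R)).
rewrite [X in _ <= _ * X](bigD1 j) //= eqxx [X in _ + X]big1 => [|k /negbTE ->]; last exact: sqn0.
rewrite addr0 (_ : sqn 1 = 1) ?mulr1; last by rewrite (sqn_real 1) expr1n.
apply: le_trans; apply: ler_sum => i _.
rewrite (bigD1 j) //= eqxx mulr1 big1 ?addr0// => k /negbTE ->.
by rewrite mulr0.
Qed.

Lemma half_image_gram b J a o i :
  half_image (gram b) J a o i =
  \sum_k adjoint b i k * (\sum_(j in J | ~~ a j) b k j * (x j (o j))^*).
Proof.
rewrite /half_image /gram.
under eq_bigr do rewrite mulr_suml.
rewrite exchange_big /=; apply: eq_bigr => k _; rewrite mulr_sumr.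
by apply: eq_bigr => j _; rewrite mulrA.
Qed.

Lemma sum_pred_le (P : pred I) (F : I -> R) :
  (forall i, 0 <= F i) -> \sum_(i | P i) F i <= \sum_i F i.
Proof. by move=> F0; rewrite [leRHS](bigID P) /= lerDl sumr_ge0. Qed.

(** [t i * B <= 1] keeps [q = t i * sqn (x i)] in the range of the second-order
    bound, where [q ^+ 2 <= q] leaves only first moments. *)
Lemma diag_mgf_le (t : I -> R) (J : {set I}) :
  (forall i, 0 <= t i) -> (forall i, t i * B <= 1) ->
  E (fun o => expR (\sum_(j in J) t j * sqn (x j (o j)))) <= expR (3 * \sum_j t j).
Proof.
move=> t0 tB.
pose f i v := if i \in J then t i * sqn (x i v) else 0.
rewrite (@eq_fexp _ _ _ w _ (fun o : sample => \prod_i expR (f i (o i)))); last first.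
  by move=> o; rewrite -expR_sum /f -big_mkcond.
rewrite (fexp_prod w (fun i v => expR (f i v))) mulr_sumr expR_sum.
apply: ler_prod => i _; have [wi0 wi1] := w_prob i; apply/andP; split.
  by apply: sumr_ge0 => v _; rewrite mulr_ge0 ?expR_ge0.
rewrite /f; case: (i \in J); last first.
  under eq_bigr do rewrite expR0 mulr1.
  rewrite wi1 -[X in X <= _]expR0 ler_expR.
  by rewrite mulr_ge0.
apply: (@le_trans _ _ (\sum_v (w i v * 1 + (3 * t i) * (w i v * sqn (x i v))))); last first.
  by rewrite big_split /= -mulr_suml wi1 -mulr_sumr x_var !mulr1 expR_ge1Dx.
apply: ler_sum => v _.
rewrite (_ : _ + _ = w i v * (1 + 3 * t i * sqn (x i v))); last by ring.
rewrite ler_wpM2l//.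
have s0 := sqn_ge0 (x i v).
have s1 : t i * sqn (x i v) <= 1 by apply: le_trans (tB i); rewrite ler_wpM2l.
apply: le_trans (expR_le_quadratic s1) _.
have := mulr_ge0 (t0 i) s0; move: s1; set q := t i * _ => s1 q0.
by rewrite -mulrA -/q; nra.
Qed.

(** Decoupling the Gram form of [b] gives back [image_sq b] on a smaller index
    set; hence the largest exponential moment [F] over all index sets satisfies
    [F <= (c + F) / 2], where [c] is the claimed bound. *)
Lemma image_sq_mgf_le (b : I -> I -> R[i]) (L mu : R) (J : {set I}) :
  0 <= L -> opnorm_sq_le b L -> opnorm_sq_le (adjoint b) L ->
  0 <= mu -> 128 * mu * B * L <= 1 ->
  E (fun o => expR (mu * image_sq b J o)) <= expR (6 * mu * frob_sq b).
Proof.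
move=> L0 bL bL' mu0 muL.
pose F (S : {set I}) := E (fun o => expR (mu * image_sq b S o)).
have [S _ Smax] := @Order.TotalTheory.arg_maxP _ R {set I} J xpredT F isT.
apply: (@le_trans _ _ (F S)); first exact: Smax.
have F0 T : 0 <= F T by apply: (fexp_ge0 w_prob) => o; exact: expR_ge0.
suff : F S <= (expR (6 * mu * frob_sq b) + F S) / 2 by lra.
pose t j := 2 * mu * complex.Re (gram b j j).
have B0 (i : I) : 0 <= B by rewrite (le_trans ler01)// bound_ge1.
have gb j : 0 <= complex.Re (gram b j j) <= L.
  by rewrite Re_gram_diag col_sq_le// sumr_ge0// => i _; exact: sqn_ge0.
have step1 : F S <= E (fun o => (expR (\sum_(j in S) t j * sqn (x j (o j))) +
      expR (offdiag (fun i j => ((2 * mu)%:C)%C * gram b i j) S o)) / 2).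
  apply: (ler_fexp w_prob) => o; rewrite image_sq_split mulrDr.
  apply: le_trans (expR_midpoint _ _) _.
  rewrite le_eqVlt; apply/orP; left; apply/eqP; congr ((expR _ + expR _) / 2).
    rewrite mulrA mulr_sumr; apply: eq_bigr => j _; by rewrite /t !mulrA.
  rewrite mulrA mulr_sumr; apply: eq_bigr => i _; rewrite mulr_sumr.
  by apply: eq_bigr => j _; rewrite Re_scaleM.
apply: (le_trans step1); rewrite [leLHS](_ : _ = 2^-1 *
   (E (fun o => expR (\sum_(j in S) t j * sqn (x j (o j)))) +
    E (fun o => expR (offdiag (fun i j => ((2 * mu)%:C)%C * gram b i j) S o)))); last first.
  by rewrite -fexpD -fexpZ; apply: eq_fexp => o; rewrite mulrC.
rewrite mulrC ler_pM2r ?invr_gt0//; apply: lerD.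
  apply: le_trans (diag_mgf_le _ _ _) _ => [i|i|].
  - by rewrite /t !mulr_ge0//; case/andP: (gb i).
  - rewrite /t; have /andP[g0 gL] := gb i; have Bi := B0 i.
    have h1 : mu * complex.Re (gram b i i) * B <= mu * L * B.
      by rewrite ler_wpM2r// ler_wpM2l.
    have h2 : 0 <= mu * L * B by rewrite !mulr_ge0.
    by move: h1 h2 muL; clear B0 => h1 h2 muL; lra.
  - by rewrite -mulr_sumr sum_Re_gram_diag le_eqVlt; apply/orP; left; apply/eqP; congr expR; ring.
apply: le_trans (offdiag_mgf_le _ _) _.
rewrite -[leRHS](fexp_cst fairs_prob).
apply: (ler_fexp fairs_prob) => a.
apply: le_trans (Smax (S :\: [set j | a j]) isT).
apply: (ler_fexp w_prob) => o; rewrite ler_expR.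
have [i0 _|noI] := pickP (@predT I); last first.
  rewrite [X in _ * X]big1 ?mulr0; last by move=> i; have := noI i.
  by rewrite mulr_ge0// sumr_ge0// => i; have := noI i.
have Bge := B0 i0.
set v := fun k => \sum_(j in S | ~~ a j) b k j * (x j (o j))^*.
have -> : image_sq b (S :\: [set j | a j]) o = \sum_k sqn (v k).
  apply: eq_bigr => k _; congr sqn; apply: eq_bigl => j.
  by rewrite !inE andbC.
have hb : \sum_(i in S | a i) sqn (half_image (fun i j => ((2 * mu)%:C)%C * gram b i j) S a o i)
    <= (2 * mu) ^+ 2 * (L * \sum_k sqn (v k)).
  apply: le_trans (sum_pred_le _ _) _ => [i|]; first exact: sqn_ge0.
  rewrite (eq_bigr (fun i => (2 * mu) ^+ 2 * sqn (\sum_k adjoint b i k * v k))).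
    by rewrite -mulr_sumr ler_wpM2l ?sqr_ge0// bL'.
  move=> i _; rewrite -half_image_gram -sqn_real -sqnM /half_image mulr_sumr.
  by congr sqn; apply: eq_bigr => j _; rewrite mulrA.
have s0 : 0 <= \sum_k sqn (v k) by apply: sumr_ge0 => k _; exact: sqn_ge0.
apply: (@le_trans _ _ (32 * B * ((2 * mu) ^+ 2 * (L * \sum_k sqn (v k))))).
  by rewrite ler_wpM2l// mulr_ge0.
have -> : 32 * B * ((2 * mu) ^+ 2 * (L * \sum_k sqn (v k))) =
   (128 * mu * B * L) * (mu * \sum_k sqn (v k)) by ring.
by rewrite ler_piMl// mulr_ge0.
Qed.

(** For [0 <= q <= B] one has [(q - 1) ^+ 2 <= (B - 1) * q + 1], so that the
    variance of [sqn (x i)] costs a single factor [B]. *)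
Lemma diag_centered_mgf_le (t T : I -> R) :
  (forall i, t i ^+ 2 <= T i) -> (forall i, T i * B ^+ 2 <= 1) ->
  E (fun o => expR (\sum_i t i * (sqn (x i (o i)) - 1))) <= expR (2 * B * \sum_i T i).
Proof.
move=> tT TB.
pose f i v := t i * (sqn (x i v) - 1).
rewrite (@eq_fexp _ _ _ w _ (fun o : sample => \prod_i expR (f i (o i)))); last first.
  by move=> o; rewrite -expR_sum.
rewrite (fexp_prod w (fun i v => expR (f i v))) mulr_sumr expR_sum.
apply: ler_prod => i _; have [wi0 wi1] := w_prob i; apply/andP; split.
  by apply: sumr_ge0 => v _; rewrite mulr_ge0 ?expR_ge0.
have B1 := bound_ge1 i.
apply: (@le_trans _ _ (\sum_v (w i v * (1 - t i - 2 * T i * (B - 1)) +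
   w i v * sqn (x i v) * (t i + 2 * T i * (B - 1)) + w i v * (2 * T i * B)))); last first.
  rewrite !big_split /= -!mulr_suml wi1 x_var.
  by apply: le_trans (expR_ge1Dx _); rewrite le_eqVlt; apply/orP; left; apply/eqP; ring.
apply: ler_sum => v _; rewrite /f.
have s0 := sqn_ge0 (x i v); have sB := x_bound i v.
rewrite [leRHS](_ : _ = w i v * (1 - t i - 2 * T i * (B - 1) +
   sqn (x i v) * (t i + 2 * T i * (B - 1)) + 2 * T i * B)); last by ring.
rewrite ler_wpM2l//; move: s0 sB; set q := sqn _ => q0 qB.
have T0 : 0 <= T i by apply: le_trans (tT i); exact: sqr_ge0.
have q1 : (q - 1) ^+ 2 <= B ^+ 2.
  rewrite -subr_ge0 (_ : _ - _ = (B - (q - 1)) * (B + (q - 1))); last by ring.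
  by rewrite mulr_ge0//; lra.
have Xs : (t i * (q - 1)) ^+ 2 <= 1.
  apply: le_trans (TB i); rewrite exprMn; apply: ler_pM; rewrite ?sqr_ge0//.
have X1 : t i * (q - 1) <= 1 by move: Xs; set X := t i * _; nra.
apply: le_trans (expR_le_quadratic X1) _.
have : (t i * (q - 1)) ^+ 2 <= T i * ((B - 1) * q + 1).
  rewrite exprMn; apply: (@le_trans _ _ (T i * (q - 1) ^+ 2)); first by rewrite ler_wpM2r ?sqr_ge0.
  by rewrite ler_wpM2l//; move: q0 qB B1; nra.
move: T0 B1; nra.
Qed.

(** A Hanson-Wright inequality in which the bound [B] on the squared moduli
    enters to the first power next to the Frobenius norm; this power decides the
    scale [K ^+ 2 * ln n / n]. The diagonal and the off-diagonal part are
    separated by convexity, and the off-diagonal part is decoupled once more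
    before [image_sq_mgf_le] applies. *)
Lemma quadratic_form_mgf_le (a : I -> I -> R[i]) (L lam : R) :
  0 <= L -> opnorm_sq_le a L -> opnorm_sq_le (adjoint a) L ->
  (128 * lam * B) ^+ 2 * L <= 1 ->
  E (fun o => expR (lam * complex.Re (\sum_i \sum_j x i (o i) * a i j * (x j (o j))^*
                                 - \sum_i a i i))) <= expR (768 * lam ^+ 2 * B * frob_sq a).
Proof.
move=> L0 aL aL' lamL.
have [i0 _|noI] := pickP (@predT I); last first.
  have h (F : I -> R[i]) : \sum_i F i = 0 by rewrite big1// => i; have := noI i.
  have h' (F : I -> R) : \sum_i F i = 0 by rewrite big1// => i; have := noI i.
  under [X in fexp _ X]boolp.funext do rewrite !h subrr mulr0 expR0.
  by rewrite (fexp_cst w_prob) /frob_sq h' mulr0 expR0.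
have B1 := bound_ge1 i0; have B0 : 0 <= B by rewrite (le_trans ler01).
have aii i : complex.Re (a i i) ^+ 2 <= sqn (a i i) <= L.
  rewrite sqr_Re_le; apply: le_trans (col_sq_le i aL).
  by rewrite (bigD1 i)//= lerDl sumr_ge0// => j _; exact: sqn_ge0.
have frob0 : 0 <= frob_sq a.
  by apply: sumr_ge0 => i _; apply: sumr_ge0 => j _; exact: sqn_ge0.
pose D o := \sum_i (2 * lam * complex.Re (a i i)) * (sqn (x i (o i)) - 1).
pose c i j := ((2 * lam)%:C)%C * a i j.
apply: (@le_trans _ _ (E (fun o => 2^-1 * (expR (D o) + expR (offdiag c [set: I]%SET o))))).
  apply: (ler_fexp w_prob) => o; rewrite [leRHS]mulrC.
  have -> : lam * complex.Re (\sum_i \sum_j x i (o i) * a i j * (x j (o j))^* - \sum_i a i i)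
     = 2^-1 * D o + 2^-1 * offdiag c [set: I]%SET o.
    have -> : offdiag c [set: I]%SET o = \sum_i 2 * lam *
        \sum_(j | j != i) complex.Re (x i (o i) * a i j * (x j (o j))^*).
      rewrite /offdiag (eq_bigl _ _ (@finset.in_setT I)); apply: eq_bigr => i _.
      rewrite mulr_sumr; apply: eq_big => j; first by rewrite !inE.
      by rewrite Re_scaleM.
    rewrite /D ReD ReN !Re_sum -sumrB !mulr_sumr -big_split /=.
    apply: eq_bigr => i _; rewrite Re_sum (bigD1 i) //=.
    have -> : complex.Re (x i (o i) * a i i * (x i (o i))^*) = sqn (x i (o i)) * complex.Re (a i i).
      by rewrite mulrAC mulJ_sqn ReM Re_real Im_real mul0r subr0.
    by field.
  apply: le_trans (expR_midpoint _ _) _.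
  by rewrite !mulrA !divff ?pnatr_eq0// !mul1r.
rewrite fexpZ fexpD.
suff [h1 h2] : E (fun o => expR (D o)) <= expR (768 * lam ^+ 2 * B * frob_sq a) /\
   E (fun o => expR (offdiag c [set: I]%SET o)) <= expR (768 * lam ^+ 2 * B * frob_sq a).
  by move: h1 h2; lra.
split.
  apply: le_trans (@diag_centered_mgf_le _ (fun i => 4 * lam ^+ 2 * sqn (a i i)) _ _) _.
  - move=> i; have /andP[h _] := aii i.
    rewrite !exprMn (_ : 2 ^+ 2 = 4); last by ring.
    by rewrite ler_wpM2l// mulr_ge0// sqr_ge0.
  - move=> i; have /andP[_ h] := aii i; apply: le_trans lamL.
    have -> : 4 * lam ^+ 2 * sqn (a i i) * B ^+ 2 = (2 * lam * B) ^+ 2 * sqn (a i i) by ring.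
    apply: ler_pM => //; rewrite ?sqr_ge0 ?sqn_ge0//.
    by rewrite !exprMn ler_wpM2r ?sqr_ge0// ler_wpM2r ?sqr_ge0//; lra.
  rewrite ler_expR -mulr_sumr.
  have h : \sum_i sqn (a i i) <= frob_sq a.
    apply: ler_sum => i _; rewrite (bigD1 i)//= lerDl sumr_ge0// => j _; exact: sqn_ge0.
  have -> : 2 * B * (4 * lam ^+ 2 * \sum_i sqn (a i i)) = 8 * (lam ^+ 2 * B * \sum_i sqn (a i i)) by ring.
  have -> : 768 * lam ^+ 2 * B * frob_sq a = 768 * (lam ^+ 2 * B * frob_sq a) by ring.
  have s0 : 0 <= \sum_i sqn (a i i) by apply: sumr_ge0 => i _; exact: sqn_ge0.
  have p0 : 0 <= lam ^+ 2 * B by rewrite mulr_ge0 ?sqr_ge0.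
  apply: ler_pM => //; rewrite ?ler_nat//; first exact: mulr_ge0.
  exact: ler_wpM2l.
apply: le_trans (offdiag_mgf_le _ _) _.
rewrite -[leRHS](fexp_cst fairs_prob).
apply: (ler_fexp fairs_prob) => e.
have mu0 : 0 <= 128 * lam ^+ 2 * B by exact: mulr_ge0 (mulr_ge0 (ler0n _ 128) (sqr_ge0 _)) B0.
apply: (@le_trans _ _ (E (fun o => expR (128 * lam ^+ 2 * B * image_sq a [set j | ~~ e j] o)))).
  apply: (ler_fexp w_prob) => o; rewrite ler_expR.
  have -> : 128 * lam ^+ 2 * B * image_sq a [set j | ~~ e j] o =
    32 * B * ((2 * lam) ^+ 2 * image_sq a [set j | ~~ e j] o) by ring.
  rewrite ler_wpM2l ?mulr_ge0//.
  apply: le_trans (sum_pred_le _ _) _ => [i|]; first exact: sqn_ge0.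
  rewrite /image_sq mulr_sumr; apply: ler_sum => i _.
  rewrite -sqn_real -sqnM /half_image mulr_sumr.
  rewrite le_eqVlt; apply/orP; left; apply/eqP; congr sqn.
  apply: eq_big => j; first by rewrite !inE.
  by rewrite mulrA.
apply: le_trans (image_sq_mgf_le _ L0 aL aL' mu0 _) _.
  by apply: le_trans lamL; rewrite le_eqVlt; apply/orP; left; apply/eqP; ring.
by rewrite ler_expR le_eqVlt; apply/orP; left; apply/eqP; ring.
Qed.

End decoupling.

(** * Resolvents of Hermitian matrices *)
Section resolvent.
Variable R : realType.
Local Notation C := R[i].
Local Open Scope sesquilinear_scope.
Implicit Types (z : C).

Definition vnorm_sq n (r : 'rV[C]_n) : R := \sum_j sqn (r 0 j).
Definition qform n (r : 'rV[C]_n) (G : 'M[C]_n) : C := (r *m G *m r^t*) 0 0.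
Definition resolvent n (W : 'M[C]_n) z : 'M[C]_n := invmx (W - z%:M).

Lemma trmxC_mul m n p (A : 'M[C]_(m, n)) (B : 'M[C]_(n, p)) : (A *m B)^t* = B^t* *m A^t*.
Proof. by rewrite trmx_mul map_mxM. Qed.

Lemma trmxC_inv n (A : 'M[C]_n) : (invmx A)^t* = invmx (A^t*).
Proof. by rewrite trmx_inv map_invmx. Qed.

Lemma mul_row_trmxC n (r : 'rV[C]_n) : (r *m r^t*) 0 0 = (vnorm_sq r)%:C%C.
Proof.
rewrite mxE /vnorm_sq rmorph_sum /=; apply: eq_bigr => j _.
by rewrite !mxE mulJ_sqn.
Qed.

Lemma vnorm_sq_ge0 n (r : 'rV[C]_n) : 0 <= vnorm_sq r.
Proof. by apply: sumr_ge0 => j _; exact: sqn_ge0. Qed.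

Lemma qform_herm n (r : 'rV[C]_n) G : (qform r G)^* = qform r (G^t*).
Proof.
rewrite /qform; transitivity ((r *m G *m r^t*)^t* 0 0); first by rewrite !mxE.
by rewrite !trmxC_mul trmxCK mulmxA.
Qed.

Lemma qformB n (r : 'rV[C]_n) A B : qform r (A - B) = qform r A - qform r B.
Proof. by rewrite /qform mulmxBr mulmxBl !mxE. Qed.

Lemma qformZ n (r : 'rV[C]_n) (c : C) A : qform r (c *: A) = c * qform r A.
Proof. by rewrite /qform -scalemxAr -scalemxAl mxE. Qed.

Lemma shift_unitmx n (W : 'M[C]_n) z :
  W^t* = W -> complex.Im z != 0 -> W - z%:M \in unitmx.
Proof.
move=> hW z0; rewrite -row_free_unit -kermx_eq0; apply/eqP/row_matrixP => i.
rewrite row0; set v := row i _.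
have /(congr1 (fun A => (A *m v^t*) 0 0)) : v *m (W - z%:M) = 0.
  by rewrite /v -row_mul mulmx_ker row0.
rewrite mul0mx [RHS]mxE -/(qform v _) qformB -[z%:M]scalemx1 qformZ.
rewrite [qform v 1%:M]/qform mulmx1 mul_row_trmxC.
move=> /(congr1 (@complex.Im R)); rewrite ImD ImN ImM Re_real Im_real mulr0 add0r.
have /(congr1 (@complex.Im R)) := qform_herm v W; rewrite hW ImJ => hI.
have -> : complex.Im (qform v W) = 0 by move: hI; set q := complex.Im _; lra.
rewrite add0r /= => /eqP; rewrite oppr_eq0 mulf_eq0 (negbTE z0) /= /vnorm_sq.
move=> h; have {}h : \sum_j sqn (v 0 j) == 0 by [].
rewrite psumr_eq0 in h; last by move=> j _; exact: sqn_ge0.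
apply/rowP => j; rewrite [RHS]mxE; have /allP/(_ j) := h.
rewrite mem_index_enum => /(_ isT) /=.
rewrite /sqn paddr_eq0 ?sqr_ge0// !sqrf_eq0 => H.
by apply/eqP; rewrite eq_complex.
Qed.

Section ward.
Variables (n : nat) (W : 'M[C]_n) (z : C).
Hypotheses (hW : W^t* = W) (z0 : complex.Im z != 0).
Local Notation G := (resolvent W z).

Lemma mul_resolvent : (W - z%:M) *m G = 1%:M.
Proof. by rewrite mulmxV ?shift_unitmx. Qed.
Lemma resolvent_mul : G *m (W - z%:M) = 1%:M.
Proof. by rewrite mulVmx ?shift_unitmx. Qed.

Lemma trmxC_resolvent : G^t* = resolvent W (z^*).
Proof.
rewrite /resolvent trmxC_inv; congr invmx.
by rewrite linearB /= map_mxB hW tr_scalar_mx map_scalar_mx.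
Qed.

Lemma subJ_Im : z - z^* = (2 * complex.Im z)%:C%C * 'i%C.
Proof.
by apply/eqP; rewrite eq_complex; case: (z) => a b /=; apply/andP; split; apply/eqP; ring.
Qed.

Lemma shift_sub : (W - (z^*)%:M) - (W - z%:M) = (z - z^*)%:M.
Proof. by rewrite opprB addrC subrKA raddfB. Qed.

Lemma z0J : complex.Im (z^*) != 0. Proof. by rewrite ImJ oppr_eq0. Qed.

(** Ward's identity: both products of the resolvent with its adjoint are
    proportional to its anti-Hermitian part. *)
Lemma ward_left : G - G^t* = ((2 * complex.Im z)%:C%C * 'i%C) *: (G^t* *m G).
Proof.
rewrite trmxC_resolvent -subJ_Im.
have uJ := shift_unitmx hW z0J.
transitivity (resolvent W (z^*) *m ((W - (z^*)%:M) - (W - z%:M)) *m G).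
  by rewrite mulmxBr mulmxBl /resolvent mulVmx// mul1mx -mulmxA mul_resolvent mulmx1.
by rewrite shift_sub -mulmxA mul_scalar_mx -scalemxAr.
Qed.

Lemma ward_right : G - G^t* = ((2 * complex.Im z)%:C%C * 'i%C) *: (G *m G^t*).
Proof.
rewrite trmxC_resolvent -subJ_Im.
have uJ := shift_unitmx hW z0J.
transitivity (G *m ((W - (z^*)%:M) - (W - z%:M)) *m resolvent W (z^*)).
  rewrite mulmxBr mulmxBl resolvent_mul mul1mx -mulmxA /resolvent mulmxV//.
  by rewrite mulmx1.
by rewrite shift_sub -mulmxA mul_scalar_mx -scalemxAr.
Qed.

Lemma Im_qform_resolvent (r : 'rV[C]_n) :
  complex.Im (qform r G) = complex.Im z * vnorm_sq (r *m G).
Proof.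
have /(congr1 (qform r)) := ward_right; rewrite qformB -qform_herm qformZ.
have -> : qform r (G *m G^t*) = (vnorm_sq (r *m G))%:C%C.
  by rewrite -mul_row_trmxC /qform trmxC_mul !mulmxA.
move/(congr1 (@complex.Im R)); rewrite ImD ImN ImJ opprK.
rewrite ImM Re_real Im_real mulr0 add0r [complex.Im (_ * 'i%C)]ImM /=.
by move: (complex.Im (qform _ _)) => q; lra.
Qed.

Lemma Im_qform_resolventV (r : 'rV[C]_n) :
  complex.Im (qform r G) = complex.Im z * vnorm_sq (r *m G^t*).
Proof.
have /(congr1 (qform r)) := ward_left; rewrite qformB -qform_herm qformZ.
have -> : qform r (G^t* *m G) = (vnorm_sq (r *m G^t*))%:C%C.
  by rewrite -mul_row_trmxC /qform trmxC_mul trmxCK !mulmxA.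
move/(congr1 (@complex.Im R)); rewrite ImD ImN ImJ opprK.
rewrite ImM Re_real Im_real mulr0 add0r [complex.Im (_ * 'i%C)]ImM /=.
by move: (complex.Im (qform _ _)) => q; lra.
Qed.

(** The squared Frobenius norm of the resolvent is thus expressed by its trace;
    it is the variance scale of the quadratic forms below. *)
Lemma Im_tr_resolvent :
  complex.Im (\tr G) = complex.Im z * \sum_i \sum_j sqn (G i j).
Proof.
have trJ : \tr (G^t*) = (\tr G)^*.
  by rewrite /mxtrace conjC_sum; apply: eq_bigr => i _; rewrite !mxE.
have /(congr1 (@mxtrace _ n)) := ward_right; rewrite linearB linearZ /= trJ.
have -> : \tr (G *m G^t*) = (\sum_i \sum_j sqn (G i j))%:C%C.
  rewrite rmorph_sum; apply: eq_bigr => i _; rewrite mxE rmorph_sum /=.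
  by apply: eq_bigr => j _; rewrite !mxE mulJ_sqn.
move/(congr1 (@complex.Im R)); rewrite ImD ImN ImJ opprK.
rewrite ImM Re_real Im_real mulr0 add0r [complex.Im (_ * 'i%C)]ImM /=.
by move: (complex.Im (\tr _)) => q; lra.
Qed.

(** By Ward's identity the left-hand side is [Im z] times the imaginary part of
    an inner product of [r *m G] with [r]; the inequality of arithmetic and
    geometric means absorbs half of it. *)
Lemma vnorm_resolvent_le (r : 'rV[C]_n) :
  complex.Im z ^+ 2 * vnorm_sq (r *m G) <= vnorm_sq r.
Proof.
set e := complex.Im z; set S := vnorm_sq (r *m G).
have h : e ^+ 2 * S = \sum_j e * complex.Im ((r *m G) 0 j * (r 0 j)^*).
  rewrite expr2 -mulrA -Im_qform_resolvent /qform mxE Im_sum mulr_sumr.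
  by apply: eq_bigr => j _; rewrite !mxE.
have : e ^+ 2 * S <= \sum_j (sqn (r 0 j) + e ^+ 2 * sqn ((r *m G) 0 j)) / 2.
  rewrite h; apply: ler_sum => j _; move: ((r *m G) 0 j) (r 0 j) => u v.
  rewrite ImM ReJ ImJ /sqn.
  have h1 := sqr_ge0 (complex.Re v - e * complex.Im u).
  have h2 := sqr_ge0 (complex.Im v + e * complex.Re u).
  nra.
rewrite -mulr_suml big_split /= -mulr_sumr -/(vnorm_sq r) -/(vnorm_sq (r *m G)) -/S.
lra.
Qed.

End ward.

Lemma resolvent_opnorm n (W : 'M[C]_n) z (c : C) : W^t* = W -> complex.Im z != 0 ->
  opnorm_sq_le (fun i j => c * resolvent W z i j) (sqn c / complex.Im z ^+ 2).
Proof.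
move=> hW z0 u.
pose r : 'rV[C]_n := \row_j (u j)^*.
have zJ : complex.Im (z^*) != 0 by rewrite ImJ oppr_eq0.
have /= := vnorm_resolvent_le hW zJ r.
rewrite ImJ sqrrN => h.
have -> : \sum_i sqn (\sum_j c * resolvent W z i j * u j) =
    sqn c * vnorm_sq (r *m resolvent W (z^*)).
  rewrite /vnorm_sq mulr_sumr; apply: eq_bigr => i _.
  rewrite -(sqnJ c) -sqnM -trmxC_resolvent// -[LHS]sqnJ; congr sqn.
  rewrite mxE conjC_sum mulr_sumr; apply: eq_bigr => j _; rewrite !mxE.
  by rewrite !conjCM -mulrA; congr (_ * _); rewrite mulrC.
have -> : \sum_j sqn (u j) = vnorm_sq r.
  by apply: eq_bigr => j _; rewrite mxE sqnJ.
rewrite -mulrA ler_wpM2l ?sqn_ge0// mulrC ler_pdivlMr ?exprn_even_gt0//.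
by rewrite mulrC.
Qed.

Lemma adjoint_resolvent n (W : 'M[C]_n) z (c : C) : W^t* = W -> complex.Im z != 0 ->
  adjoint (fun i j => c * resolvent W z i j) =
  (fun i j => c^* * resolvent W (z^*) i j).
Proof.
move=> hW z0; apply/funext => i; apply/funext => j; rewrite /adjoint.
by rewrite conjCM -trmxC_resolvent// !mxE.
Qed.

Lemma resolvent_entry_le n (W : 'M[C]_n) z i j : W^t* = W -> complex.Im z != 0 ->
  sqn (resolvent W z i j) <= (complex.Im z ^+ 2)^-1.
Proof.
move=> hW z0; have := resolvent_opnorm 1 hW z0 => /(col_sq_le j).
rewrite (sqn_real 1) expr1n mul1r; apply: le_trans; rewrite (bigD1 i)//= mul1r.
by rewrite lerDl sumr_ge0// => k _; exact: sqn_ge0.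
Qed.

Section rank_one.
Variables (n : nat) (W' : 'M[C]_n) (r : 'rV[C]_n) (c : R) (z : C).
Hypotheses (hW' : W'^t* = W') (z0 : complex.Im z != 0).
Let W := W' + (c%:C)%C *: (r^t* *m r).
Local Notation G' := (resolvent W' z).
Local Notation G := (resolvent W z).
Local Notation q := ((c%:C)%C * qform r G').

Lemma rank_one_herm : W^t* = W.
Proof.
rewrite /W linearD /= map_mxD hW' linearZ /= map_mxZ; congr (_ + _ *: _).
  exact: conjc_real.
by rewrite -[LHS]/((r^t* *m r)^t*) trmxC_mul trmxCK.
Qed.

Lemma resolvent_rank_one :
  G' = G + (c%:C)%C *: (G' *m r^t* *m (r *m G)).
Proof.
have : (W' - z%:M + (c%:C)%C *: (r^t* *m r)) *m G = 1%:M.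
  by rewrite addrAC mul_resolvent// rank_one_herm.
move/(congr1 (mulmx G')); rewrite mulmx1 => H.
rewrite -[LHS]H mulmxDl mulmxDr mulmxA resolvent_mul// mul1mx.
by rewrite -scalemxAl -scalemxAr !mulmxA.
Qed.

Lemma row_mul_rank_one : r *m G' = (1 + q) *: (r *m G).
Proof.
rewrite [in LHS]resolvent_rank_one mulmxDr scalerDl scale1r; congr (_ + _).
rewrite -scalemxAr !mulmxA -mulmxA [X in X *m _](mx11_scalar _) mul_scalar_mx scalerA.
by rewrite /qform.
Qed.

Lemma qform_rank_one : (1 + q) * ((c%:C)%C * qform r G) = q.
Proof.
have /(congr1 (fun v => (v *m r^t*) 0 0)) := row_mul_rank_one.
rewrite -scalemxAl [RHS]mxE -/(qform r G') -/(qform r G) => H.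
by rewrite mulrCA -H.
Qed.

Lemma rank_one_denom_neq0 : 1 + q != 0.
Proof.
apply/eqP => h; have := qform_rank_one; rewrite h mul0r => h2.
by move/eqP: h; rewrite -h2 addr0 oner_eq0.
Qed.

Lemma qform_rank_oneE : (c%:C)%C * qform r G = q / (1 + q).
Proof. by rewrite -[X in X / _]qform_rank_one mulrAC divff ?mul1r ?rank_one_denom_neq0. Qed.

(** The difference of the traces is [c * (r G' G' r^t) / (1 + q)], with the
    conjugate transpose of [r]. By Cauchy-Schwarz and Ward's identity its
    numerator is at most [Im q / Im z]. *)
Lemma tr_rank_one_le : 0 < complex.Im z -> 0 <= c ->
  sqn (\tr G' - \tr G) <= (complex.Im z ^+ 2)^-1.
Proof.
move=> zp c0.
have hd : (1 + q) * (\tr G' - \tr G) = (c%:C)%C * (r *m G' *m (G' *m r^t*)) 0 0.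
  rewrite [X in _ * (\tr X - _)]resolvent_rank_one linearD /= linearZ /= addrAC subrr add0r.
  rewrite mxtrace_mulC mulrCA; congr (_ * _).
  by rewrite row_mul_rank_one -scalemxAl [RHS]mxE /mxtrace big_ord1.
have D0 : 0 < sqn (1 + q).
  rewrite lt_neqAle sqn_ge0 andbT eq_sym; apply: contra rank_one_denom_neq0.
  by rewrite /sqn paddr_eq0 ?sqr_ge0// !sqrf_eq0 eq_complex.
rewrite -(ler_pM2l D0) -sqnM hd.
set e := complex.Im z.
have hq : complex.Im q = c * complex.Im (qform r G') by rewrite ImM Re_real Im_real mul0r addr0.
pose u := r *m G'; pose v := r *m G'^t*.
have hu : complex.Im (qform r G') = e * vnorm_sq u by exact: Im_qform_resolvent.
have hv : complex.Im (qform r G') = e * vnorm_sq v by exact: Im_qform_resolventV.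
have -> : (u *m (G' *m r^t*)) 0 0 = \sum_j u 0 j * (v 0 j)^*.
  have -> : G' *m r^t* = v^t* by rewrite /v trmxC_mul trmxCK.
  by rewrite mxE; apply: eq_bigr => j _; rewrite !mxE.
(* Cauchy-Schwarz: [key] at [t] proportional to the inner product [s]. *)
have cs : sqn (\sum_j u 0 j * (v 0 j)^*) <= vnorm_sq u ^+ 2.
  have uv : vnorm_sq u = vnorm_sq v by apply: (mulfI (lt0r_neq0 zp)); rewrite -hu.
  set s := \sum_j _.
  have [s0|s0] := eqVneq (sqn s) 0; first by rewrite s0 sqr_ge0.
  have sp : 0 < sqn s by rewrite lt_neqAle eq_sym s0 sqn_ge0.
  have key (t : C) : 2 * complex.Re (s * t^*) <= vnorm_sq u * sqn t + vnorm_sq v.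
    rewrite /s mulr_suml Re_sum /vnorm_sq mulr_suml mulr_sumr -big_split /=.
    apply: ler_sum => j _; rewrite -sqnM.
    have -> : u 0 j * (v 0 j)^* * t^* = (u 0 j * t^*) * (v 0 j)^* by ring.
    rewrite Re_mulJ -[sqn (u 0 j * t)]/(sqn (u 0 j * t)).
    have -> : sqn (u 0 j * t) = sqn (u 0 j * t^*) by rewrite !sqnM sqnJ.
    rewrite /sqn; move: (u 0 j * t^*) (v 0 j) => a b.
    have := sqr_ge0 (complex.Re a - complex.Re b); have := sqr_ge0 (complex.Im a - complex.Im b).
    nra.
  have V0 : 0 <= vnorm_sq v by exact: vnorm_sq_ge0.
  rewrite uv; rewrite uv in key.
  have [V0'|Vn] := eqVneq (vnorm_sq v) 0.
    have := key s; rewrite V0' mul0r add0r mulJ_sqn Re_real; lra.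
  have Vp : 0 < vnorm_sq v by rewrite lt_neqAle eq_sym Vn.
  have := key (((vnorm_sq v)^-1%:C)%C * s).
  rewrite conjCM (_ : ((vnorm_sq v)^-1%:C)%C^* = ((vnorm_sq v)^-1%:C)%C); last exact: conjc_real.
  rewrite mulrCA mulJ_sqn ReM !Re_real !Im_real mul0r subr0 sqnM sqn_real.
  move=> k; have : vnorm_sq v * (2 * ((vnorm_sq v)^-1 * sqn s)) <=
     vnorm_sq v * (vnorm_sq v * ((vnorm_sq v)^-1 ^+ 2 * sqn s) + vnorm_sq v) by rewrite ler_pM2l.
  have -> : vnorm_sq v * (2 * ((vnorm_sq v)^-1 * sqn s)) = 2 * sqn s by field.
  have -> : vnorm_sq v * (vnorm_sq v * ((vnorm_sq v)^-1 ^+ 2 * sqn s) + vnorm_sq v)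
    = sqn s + vnorm_sq v ^+ 2 by field.
  by lra.
rewrite sqnM sqn_real ler_pdivlMr ?exprn_gt0//.
apply: (@le_trans _ _ (complex.Im (1 + q) ^+ 2)); last exact: sqr_Im_le.
rewrite ImD hq hu /= add0r.
have -> : (c * (e * vnorm_sq u)) ^+ 2 = c ^+ 2 * e ^+ 2 * vnorm_sq u ^+ 2 by ring.
rewrite mulrAC ler_wpM2l// mulr_ge0 ?sqr_ge0//.
Qed.

End rank_one.
End resolvent.

(** * Removing a row from a covariance matrix *)
Section leave_one_out.
Variable R : realType.
Local Notation C := R[i].
Local Open Scope sesquilinear_scope.
Variables (p n : nat) (M : 'M[C]_(p, n)).

Definition gram_without (k : 'I_p) : 'M[C]_n :=
  n%:R^-1 *: \sum_(l < p | l != k) ((row l M)^t* *m row l M).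

Definition invn : C := ((n%:R^-1)%:C)%C.

Lemma invnE : (n%:R : C)^-1 = invn.
Proof. by rewrite /invn fmorphV rmorph_nat. Qed.

Lemma trmxC_mul_rows : M^t* *m M = \sum_(l < p) ((row l M)^t* *m row l M).
Proof.
apply/matrixP => i j; rewrite mxE summxE; apply: eq_bigr => l _.
by rewrite !mxE big_ord1 !mxE.
Qed.

Lemma sample_covariance_rows k : sample_covariance M =
  gram_without k + invn *: ((row k M)^t* *m row k M).
Proof.
rewrite /sample_covariance trmxC_mul_rows (bigD1 k)//= scalerDr addrC.
by rewrite /gram_without invnE.
Qed.

Lemma invnJ : invn^* = invn. Proof. exact: conjc_real. Qed.

Lemma gram_without_herm k : (gram_without k)^t* = gram_without k.
Proof.
rewrite /gram_without invnE linearZ /= map_mxZ -[X in X *: _]/(invn^*) invnJ.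
congr (_ *: _); rewrite linear_sum /= rmorph_sum /=; apply: eq_bigr => l _.
by rewrite -[LHS]/(((row l M)^t* *m row l M)^t*) trmxC_mul trmxCK.
Qed.

Lemma sample_covariance_herm : (sample_covariance M)^t* = sample_covariance M.
Proof.
rewrite /sample_covariance invnE linearZ /= map_mxZ -[X in X *: _]/(invn^*) invnJ.
by rewrite -[X in _ *: X]/((M^t* *m M)^t*) trmxC_mul trmxCK.
Qed.

Definition loo_qform (z : C) (k : 'I_p) : C :=
  invn * qform (row k M) (resolvent (gram_without k) z).

(** The left-hand side is the trace of [W * (W - z)^-1], a sum over the rows of
    [M] of quadratic forms in the full resolvent; the rank-one formula replaces
    it by the resolvent without the row. *)
Lemma tr_resolvent_loo (z : C) : complex.Im z != 0 ->
  n%:R + z * \tr (resolvent (sample_covariance M) z) =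
  \sum_(k < p) loo_qform z k / (1 + loo_qform z k).
Proof.
move=> z0; set W := sample_covariance M; set G := resolvent W z.
have : \tr ((W - z%:M) *m G) = n%:R by rewrite mul_resolvent// ?sample_covariance_herm// mxtrace1.
rewrite mulmxBl linearB /= mul_scalar_mx linearZ /= => <-; rewrite subrK.
rewrite {1}/W /sample_covariance trmxC_mul_rows invnE -scalemxAl linearZ /=.
rewrite mulmx_suml linear_sum /= mulr_sumr; apply: eq_bigr => k _.
rewrite /loo_qform -qform_rank_oneE// ?gram_without_herm//.
rewrite -sample_covariance_rows -/W -/G; congr (_ * _).
by rewrite -mulmxA mxtrace_mulC /mxtrace big_ord1.
Qed.

Lemma tr_loo_le (z : C) k : 0 < complex.Im z ->
  sqn (\tr (resolvent (gram_without k) z) - \tr (resolvent (sample_covariance M) z))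
  <= (complex.Im z ^+ 2)^-1.
Proof.
move=> z0; rewrite (sample_covariance_rows k).
by apply: tr_rank_one_le; rewrite ?gram_without_herm ?gt_eqF ?invr_ge0.
Qed.

End leave_one_out.

(** * Concentration of the leave-one-out quadratic forms *)
Section concentration.
Variables (R : realType) (p n : nat) (V : finType).
Variables (w : 'I_p -> 'I_n -> V -> R) (x : 'I_p -> 'I_n -> V -> R[i]) (B : R).
Hypothesis w_prob : forall k, prob_weights (w k).
Hypothesis x_Re0 : forall k i, \sum_v w k i v * complex.Re (x k i v) = 0.
Hypothesis x_Im0 : forall k i, \sum_v w k i v * complex.Im (x k i v) = 0.
Hypothesis x_var : forall k i, \sum_v w k i v * sqn (x k i v) = 1.
Hypothesis x_bound : forall k i v, sqn (x k i v) <= B.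

Local Notation rowT := {ffun 'I_n -> V}.
Local Notation sampleT := {ffun 'I_p -> rowT}.

Definition row_weight (k : 'I_p) (r : rowT) : R := \prod_i w k i (r i).
Definition sample_matrix (o : sampleT) : 'M[R[i]]_(p, n) := \matrix_(k, i) x k i (o k i).

Lemma row_weight_prob : prob_weights row_weight.
Proof.
move=> k; split; first exact: fexp_weight_ge0.
exact: fexp_weight_sum.
Qed.

Definition loo_stieltjes (M : 'M[R[i]]_(p, n)) z k : R[i] :=
  invn R n * \tr (resolvent (gram_without M k) z).

(** The deviation is measured in units of [1 + Im m], because the variance of
    the quadratic form is proportional to [Im m]; the direction [d] makes the
    event one-sided. *)
Definition deviates (d z : R[i]) (tau : R) (k : 'I_p) (M : 'M[R[i]]_(p, n)) : bool :=
  tau * (1 + complex.Im (loo_stieltjes M z k)) <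
  complex.Re (d * (loo_qform M z k - loo_stieltjes M z k)).

Lemma gram_without_resample k o o' :
  gram_without (sample_matrix (resample [set k]%SET o o')) k =
  gram_without (sample_matrix o) k.
Proof.
rewrite /gram_without; congr (_ *: _); apply: eq_bigr => l lk.
by congr (map_mx _ (trmx _) *m _); apply/rowP => i; rewrite !mxE !ffunE finset.in_set1 (negbTE lk).
Qed.

Lemma qform_sum (r : 'rV[R[i]]_n) (A : 'M[R[i]]_n) :
  qform r A = \sum_i \sum_j r 0 i * A i j * (r 0 j)^*.
Proof.
rewrite /qform mxE exchange_big /=; apply: eq_bigr => j _.
by rewrite !mxE mulr_suml.
Qed.

(** Given the other rows this is the exponential Markov inequality for a
    quadratic form in row [k], whose squared Frobenius norm is
    [Im m / (n * Im z)]. *)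
Lemma loo_deviation_le (d z : R[i]) (tau : R) (k : 'I_p) :
  (0 < n)%N -> 0 < B -> sqn d = 1 -> 0 < complex.Im z -> 0 < tau -> tau <= 6 ->
  fexp row_weight (fun o => (deviates d z tau k (sample_matrix o))%:R) <=
  expR (- (tau ^+ 2 * n%:R * complex.Im z / (768 * B))).
Proof.
move=> n0 B0 d1 e0 t0 t6; set e := complex.Im z.
have N0 : 0 < n%:R :> R by rewrite ltr0n.
(* With this value the second-order term of the moment bound is exactly
   [lam * tau * Im m]; [tau <= 6] makes it an admissible parameter. *)
pose lam := tau / 768 * (n%:R * e) / B.
have lam0 : 0 <= lam.
  apply: divr_ge0 (ltW B0); apply: mulr_ge0; first exact: divr_ge0 (ltW t0) (ler0n _ _).
  exact: mulr_ge0 (ltW N0) (ltW e0).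
apply: (@le_trans _ _ (fexp row_weight (fun o => expR (lam *
   (complex.Re (d * (loo_qform (sample_matrix o) z k - loo_stieltjes (sample_matrix o) z k)) -
    tau * (1 + complex.Im (loo_stieltjes (sample_matrix o) z k))))))).
  apply: (ler_fexp row_weight_prob) => o; rewrite /deviates.
  case: ltP => h; last exact: expR_ge0.
  by rewrite -[leLHS]expR0 ler_expR mulr_ge0// subr_ge0 ltW.
rewrite (fexp_resample row_weight_prob [set k]%SET).
rewrite -[leRHS](fexp_cst row_weight_prob); apply: (ler_fexp row_weight_prob) => o.
set G := resolvent (gram_without (sample_matrix o) k) z.
set m := invn R n * \tr G.
pose X (r : rowT) := expR (lam * complex.Re (\sum_i \sum_j
   x k i (r i) * (d * invn R n * G i j) * (x k j (r j))^* - \sum_i d * invn R n * G i i)).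
have X_E o' : expR (lam *
   (complex.Re (d * (loo_qform (sample_matrix (resample [set k]%SET o o')) z k -
                     loo_stieltjes (sample_matrix (resample [set k]%SET o o')) z k)) -
    tau * (1 + complex.Im (loo_stieltjes (sample_matrix (resample [set k]%SET o o')) z k)))) =
   expR (- (lam * tau * (1 + complex.Im m))) * X (o' k).
  rewrite /loo_qform /loo_stieltjes gram_without_resample -/G -/m -expRD; congr expR.
  rewrite mulrBr addrC; congr (_ + _); first by ring.
  congr (_ * complex.Re _); rewrite mulrBr qform_sum /m; congr (_ - _).
    rewrite mulrA mulr_sumr; apply: eq_bigr => i _; rewrite mulr_sumr.
    apply: eq_bigr => j _; rewrite !mxE !ffunE finset.in_set1 eqxx; ring.
  by rewrite mulrA /mxtrace mulr_sumr.
rewrite (eq_fexp _ X_E) fexpZ fexp_marginal; last exact: row_weight_prob.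
rewrite -/(fexp (w k) X).
have hW := gram_without_herm (sample_matrix o) k.
have e0' : complex.Im z != 0 by rewrite gt_eqF.
have sc : sqn (d * invn R n) = n%:R^-1 ^+ 2 by rewrite sqnM d1 mul1r sqn_real.
have en : n%:R * e != 0 by rewrite mulf_neq0 ?gt_eqF.
have := @quadratic_form_mgf_le R _ V (w k) (x k) B (w_prob k) (x_Re0 k) (x_Im0 k)
  (x_var k) (x_bound k) (fun i j => d * invn R n * G i j) (n%:R^-1 ^+ 2 / e ^+ 2) lam.
rewrite -sc => /(_ (divr_ge0 (sqn_ge0 _) (sqr_ge0 _)) (resolvent_opnorm _ hW e0')).
rewrite adjoint_resolvent// -(sqnJ (d * _)) -sqrrN -ImJ.
have eJ0 : complex.Im (z^*) != 0 by rewrite ImJ oppr_eq0.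
move=> /(_ (resolvent_opnorm _ hW eJ0)).
rewrite ImJ sqrrN sqnJ sc => H.
have lamL : (128 * lam * B) ^+ 2 * (n%:R^-1 ^+ 2 / e ^+ 2) <= 1.
  have -> : (128 * lam * B) ^+ 2 * (n%:R^-1 ^+ 2 / e ^+ 2) = (tau / 6) ^+ 2.
    by rewrite /lam; field; rewrite !gt_eqF.
  have tau6 : 0 <= tau / 6 by apply: divr_ge0 (ltW t0) (ler0n _ _).
  by rewrite expr_le1//; lra.
apply: le_trans (ler_wpM2l (expR_ge0 _) (H lamL)) _.
have frobE : frob_sq (fun i j => d * invn R n * G i j) = complex.Im m / (n%:R * e).
  transitivity (n%:R^-1 ^+ 2 * \sum_i \sum_j sqn (G i j)).
    rewrite mulr_sumr; apply: eq_bigr => i _; rewrite mulr_sumr.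
    by apply: eq_bigr => j _; rewrite sqnM sc.
  rewrite /m ImM Re_real Im_real mul0r addr0 Im_tr_resolvent// -/e -/G.
  by field; rewrite !gt_eqF.
rewrite frobE -expRD ler_expR le_eqVlt; apply/orP; left; apply/eqP.
by rewrite /lam; field; rewrite !gt_eqF.
Qed.

End concentration.

(** * Spectrum of a covariance matrix *)
Section spectrum.
Variable R : realType.
Local Notation C := R[i].
Local Open Scope sesquilinear_scope.

Definition evals n (W : 'M[C]_n) : seq R := [seq complex.Re z | z <- eigenvalues W].

Section hermitian.
Variables (n : nat) (W : 'M[C]_n).
Hypothesis hW : W^t* = W.
Local Notation P := (spectralmx W).
Local Notation D := (spectral_diag W).

Lemma spectral_decomposition : W = invmx P *m diag_mx D *m P.
Proof. by apply/orthomx_spectralP/normalmxP; rewrite hW. Qed.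

Lemma spectral_conj : P *m W *m invmx P = diag_mx D.
Proof.
rewrite [X in _ *m X *m _]spectral_decomposition.
by rewrite !mulmxA mulmxV ?spectral_unit// mul1mx mulmxK ?spectral_unit.
Qed.

Lemma spectral_diag_real j : (D 0 j) = (complex.Re (D 0 j))%:C%C.
Proof.
have h : W \is hermsymmx by apply/is_hermitianmxP; rewrite expr0 scale1r hW.
have /mxOverP /(_ 0 j) := hermitian_spectral_diag_real h.
by move=> /RRe_real.
Qed.

Lemma char_poly_hermitian : char_poly W = \prod_j ('X - (D 0 j)%:P).
Proof.
have Pu := spectral_unit W.
transitivity (char_poly (diag_mx D)); last first.
  rewrite char_poly_trig; last exact/diag_mx_is_trig.
  by apply: eq_bigr => j _; rewrite mxE eqxx mulr1n.
rewrite /char_poly {1}spectral_decomposition.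
set Q := map_mx (@polyC C) P; set Q' := map_mx (@polyC C) (invmx P).
have QQ : Q' *m Q = 1%:M by rewrite -map_mxM mulVmx// map_mx1.
have -> : char_poly_mx (invmx P *m diag_mx D *m P) = Q' *m char_poly_mx (diag_mx D) *m Q.
  rewrite /char_poly_mx !map_mxM mulmxBr mulmxBl; congr (_ - _).
  by rewrite mul_mx_scalar -scalemxAl QQ scalemx1.
rewrite !det_mulmx mulrAC -det_mulmx QQ det1 mul1r//.
Qed.

Lemma evals_perm : perm_eq (evals W) [seq complex.Re (D 0 j) | j <- enum 'I_n].
Proof.
rewrite /evals (map_comp (@complex.Re R) (fun j => D 0 j)); apply: perm_map.
apply: prod_XsubC_eq.
rewrite /eigenvalues; case: closed_field_poly_normal => s /= /esym.
rewrite (monicP (char_poly_monic W)) scale1r => ->.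
by rewrite char_poly_hermitian big_map big_enum.
Qed.

Lemma size_evals : size (evals W) = n.
Proof. by rewrite (perm_size evals_perm) size_map size_enum_ord. Qed.

Lemma tr_resolvent (z : C) : complex.Im z != 0 ->
  \tr (resolvent W z) = \sum_(l <- evals W) ((l%:C)%C - z)^-1.
Proof.
move=> z0; have Pu := spectral_unit W.
have dz j : D 0 j - z != 0.
  apply: contra z0; rewrite spectral_diag_real subr_eq0 => /eqP <-; exact/eqP/Im_real.
pose X := invmx P *m diag_mx (\row_j (D 0 j - z)^-1) *m P.
have hX : (W - z%:M) *m X = 1%:M.
  have -> : W - z%:M = invmx P *m diag_mx (\row_j (D 0 j - z)) *m P.
    have -> : diag_mx (\row_j (D 0 j - z)) = diag_mx D - z%:M.
      apply/matrixP => i j; rewrite !mxE; case: eqP => [->|_]; rewrite ?mulr1n ?mulr0n ?subr0//.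
    transitivity (invmx P *m diag_mx D *m P - z%:M).
      by congr (_ - _); exact: spectral_decomposition.
    rewrite mulmxBr mulmxBl; congr (_ - _).
    by rewrite mul_mx_scalar -scalemxAl mulVmx// scalemx1.
  rewrite /X !mulmxA mulmxK// -[_ *m diag_mx _ *m diag_mx _]mulmxA mulmx_diag.
  rewrite (_ : \row_j _ = const_mx 1) ?diag_const_mx ?mulmx1 ?mulVmx//.
  by apply/rowP => j; rewrite !mxE mulfV.
have -> : resolvent W z = X.
  by rewrite -[LHS]mulmx1 -hX mulmxA resolvent_mul// mul1mx.
rewrite /X -mulmxA mxtrace_mulC mulmxK// mxtrace_diag.
rewrite (perm_big _ evals_perm) big_map big_enum /=; apply: eq_bigr => j _.
by rewrite mxE -spectral_diag_real.
Qed.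

End hermitian.

Section covariance.
Variables (p n : nat) (M : 'M[C]_(p, n)).
Let W := sample_covariance M.
Local Notation P := (spectralmx W).
Local Notation D := (spectral_diag W).

Lemma covariance_spectral_ge0 j : 0 <= complex.Re (D 0 j).
Proof.
have hW := sample_covariance_herm M; have Pu := spectral_unit W.
have PV : P^t* = invmx P by rewrite invmx_unitary// spectral_unitarymx.
have : P *m W *m P^t* = diag_mx D.
  by rewrite PV; exact: spectral_conj.
move=> /matrixP /(_ j j); rewrite [RHS]mxE eqxx mulr1n => <-.
have -> : (P *m W *m P^t*) j j = invn R n * (vnorm_sq (row j P *m M^t*))%:C%C.
  rewrite -mul_row_trmxC trmxC_mul trmxCK.
  have -> : (P *m W *m P^t*) j j = (row j P *m W *m (row j P)^t*) 0 0.
    rewrite !mxE; apply: eq_bigr => i _; rewrite !mxE; congr (_ * _).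
    by apply: eq_bigr => l _; rewrite !mxE.
  rewrite {2}/W /sample_covariance invnE -scalemxAr -scalemxAl mxE; congr (_ * _).
  by rewrite !mulmxA.
rewrite ReM !Re_real !Im_real mulr0 subr0 mulr_ge0 ?invr_ge0//.
exact: vnorm_sq_ge0.
Qed.

(** [W] has rank at most [p], and adding the projection [Z] onto the null
    coordinates of its diagonal form gives an invertible matrix. *)
Lemma covariance_kernel : (n - p <= count_mem 0%R (evals W))%N.
Proof.
have hW := sample_covariance_herm M; have Pu := spectral_unit W.
rewrite (permP (evals_perm hW)) count_map.
pose Z : 'M[C]_n := \sum_(j | complex.Re (D 0 j) == 0) delta_mx j j.
pose dR j : R := complex.Re (D 0 j).
have Zr : (\rank Z <= count (preim dR (pred1 0%R)) (enum 'I_n))%N.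
  rewrite -sum1_count big_enum_cond /= /Z.
  elim/big_rec2: _ => [|j k A _ IH]; first by rewrite mxrank0.
  by rewrite (leq_trans (mxrank_add _ _))// mxrank_delta leq_add.
have Wr : (\rank (diag_mx D) <= p)%N.
  have -> : diag_mx D = P *m W *m invmx P.
    by rewrite [RHS]spectral_conj.
  rewrite (leq_trans (mxrankM_maxl _ _))// (leq_trans (mxrankM_maxr _ _))//.
  rewrite /W /sample_covariance (leq_trans (mxrank_scale _ _))//.
  by rewrite (leq_trans (mxrankM_maxr _ _))// rank_leq_row.
have : \rank (diag_mx D + Z)%R = n.
  apply/eqP; rewrite -/(row_free _) row_free_unit.
  have -> : diag_mx D + Z = diag_mx (\row_j (if complex.Re (D 0 j) == 0 then 1 else D 0 j)).
    apply/matrixP => i j; rewrite /Z !mxE summxE.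
    have -> : \sum_(k | complex.Re (D 0 k) == 0) delta_mx k k i j =
        ((i == j) && (complex.Re (D 0 j) == 0))%:R :> C.
      case: eqP => [<-|/eqP ij]; last first.
        rewrite big1// => k _; rewrite mxE; case: eqP => // <-.
        by rewrite eq_sym (negbTE ij).
      rewrite andTb; have [i0|i0] := boolP (complex.Re (D 0 i) == 0); last first.
        rewrite big1// => k k0; rewrite mxE; case: eqP => // ik.
        by move: i0; rewrite ik k0.
      rewrite (bigD1 i)//= mxE !eqxx big1 ?addr0// => k /andP[_ ki].
      by rewrite mxE eq_sym (negbTE ki).
    case: eqP => [<-|_] /=; last by rewrite !mulr0n addr0.
    rewrite !mulr1n; case: eqP => [h|]; rewrite ?addr0//.
    by rewrite spectral_diag_real// h add0r.
  rewrite unitmxE det_diag unitfE; apply/prodf_neq0 => j _; rewrite mxE.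
  case: ifP => [_|/negbT h]; first exact: oner_neq0.
  by apply: contra h => /eqP ->.
move=> rn; rewrite leq_subLR -[X in (X <= _)%N]rn.
apply: leq_trans (mxrank_add _ _) _; exact: leq_add.
Qed.

Lemma covariance_evals_ge0 l : l \in evals W -> 0 <= l.
Proof.
rewrite (perm_mem (evals_perm (sample_covariance_herm M))).
by case/mapP => j _ ->; exact: covariance_spectral_ge0.
Qed.

(** The spectrum is nonnegative and contains [0] at least [n - p] times, so the
    dropped eigenvalues all vanish. *)
Lemma eigenvalue_countE (I : interval R) :
  (forall l, l \in I -> 0 < l) ->
  eigenvalue_count p W I = count (fun l => l \in I) (evals W).
Proof.
move=> I0; rewrite /eigenvalue_count /top_eigenvalues -/(evals W).
set s := sort _ _.
have ps : perm_eq s (evals W) by rewrite perm_sort.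
rewrite -(permP ps) -[in RHS](cat_take_drop (n - p) s) count_cat.
suff -> : count (fun l => l \in I) (take (n - p) s) = 0%N by [].
apply/eqP; rewrite -leqn0 leqNgt -has_count; apply/negP => /hasP[l].
move=> /(nthP 0)[j]; rewrite size_take_min leq_min => /andP[jnp js].
rewrite nth_take// => lE lI.
have ss : sorted <=%R s by apply: sort_sorted; exact: le_total.
have : (count_mem 0%R s <= j)%N.
  rewrite -[s](cat_take_drop j) count_cat.
  have -> : count_mem 0%R (drop j s) = 0%N.
    apply/eqP; rewrite -leqn0 leqNgt -has_count; apply/negP => /hasP[l'].
    move=> /(nthP 0)[m]; rewrite size_drop nth_drop => mlt <- /eqP h0.
    have : s`_j <= s`_(j + m).
      apply: (sorted_leq_nth le_trans le_refl 0 ss); rewrite ?inE ?leq_addr//.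
      by rewrite -ltn_subRL.
    by rewrite lE h0 leNgt I0.
  by rewrite addn0 (leq_trans (count_size _ _))// size_take_min geq_minl.
rewrite (permP ps) => h; have := leq_trans covariance_kernel h.
by rewrite leqNgt jnp.
Qed.

End covariance.
End spectrum.

(** * Modulus of a complex number *)
Section modulus.
Variable R : realType.
Local Notation C := R[i].
Implicit Types u v : C.
Definition cmod u : R := Num.sqrt (sqn u).

Lemma cmodE u : cmod u = Normc.normc u. Proof. by case: u. Qed.
Lemma cmod_ge0 u : 0 <= cmod u. Proof. exact: sqrtr_ge0. Qed.
Lemma cmod_sqr u : cmod u ^+ 2 = sqn u. Proof. by rewrite sqr_sqrtr ?sqn_ge0. Qed.
Lemma cmodM u v : cmod (u * v) = cmod u * cmod v.
Proof. by rewrite /cmod sqnM sqrtrM ?sqn_ge0. Qed.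
Lemma cmodN u : cmod (- u) = cmod u. Proof. by rewrite /cmod sqnN. Qed.
Lemma cmodD_le u v : cmod (u + v) <= cmod u + cmod v.
Proof. by rewrite !cmodE le_normcD. Qed.
Lemma cmodB_le u v : cmod (u - v) <= cmod u + cmod v.
Proof. by rewrite (le_trans (cmodD_le _ _))// cmodN. Qed.
Lemma cmodBC u v : cmod (u - v) = cmod (v - u).
Proof. by rewrite -cmodN opprB. Qed.
Lemma cmodB_ge u v : cmod u - cmod v <= cmod (u - v).
Proof. by rewrite lerBlDr (le_trans _ (cmodD_le _ _))// subrK. Qed.
Lemma cmod_eq0 u : (cmod u == 0) = (u == 0).
Proof.
rewrite sqrtr_eq0 le_eqVlt ltNge sqn_ge0 orbF /sqn paddr_eq0 ?sqr_ge0//.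
by rewrite !sqrf_eq0 eq_complex.
Qed.
Lemma cmod_gt0 u : (0 < cmod u) = (u != 0).
Proof. by rewrite lt_neqAle cmod_ge0 andbT eq_sym cmod_eq0. Qed.
Lemma cmodV u : cmod u^-1 = (cmod u)^-1.
Proof. by rewrite !cmodE Normc.normcV. Qed.
Lemma cmod_real (r : R) : cmod (r%:C)%C = `|r|.
Proof. by rewrite /cmod sqn_real sqrtr_sqr. Qed.
Lemma cmod_pos (r : R) : 0 <= r -> cmod (r%:C)%C = r.
Proof. by move=> r0; rewrite cmod_real ger0_norm. Qed.
Lemma cmod1 : cmod 1 = 1. Proof. by rewrite (cmod_pos ler01). Qed.
Lemma Re_le_cmod u : `|complex.Re u| <= cmod u.
Proof. by rewrite -sqrtr_sqr ler_wsqrtr// sqr_Re_le. Qed.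
Lemma Im_le_cmod u : `|complex.Im u| <= cmod u.
Proof. by rewrite -sqrtr_sqr ler_wsqrtr// sqr_Im_le. Qed.
Lemma cmod_le_ReIm u : cmod u <= `|complex.Re u| + `|complex.Im u|.
Proof.
rewrite -(ger0_norm (addr_ge0 (normr_ge0 _) (normr_ge0 _))) -sqrtr_sqr ler_wsqrtr//.
rewrite /sqn sqrrD !real_normK ?num_real//.
have := mulr_ge0 (normr_ge0 (complex.Re u)) (normr_ge0 (complex.Im u)); lra.
Qed.
Lemma cmod_le_sqn u (r : R) : 0 <= r -> sqn u <= r ^+ 2 -> cmod u <= r.
Proof. by move=> r0 h; rewrite -(ger0_norm r0) -sqrtr_sqr ler_wsqrtr. Qed.
Lemma cmod_sum_le (J : Type) (s : seq J) (P : pred J) (F : J -> C) :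
  cmod (\sum_(j <- s | P j) F j) <= \sum_(j <- s | P j) cmod (F j).
Proof.
elim/big_rec2: _ => [|j a b _ IH]; first by rewrite /cmod sqn0 sqrtr0.
by rewrite (le_trans (cmodD_le _ _))// lerD2l.
Qed.
End modulus.

(** * The self-consistent equation *)
Section self_consistent_equation.
Variable R : realType.
Local Notation C := R[i].

Definition stieltjes n (W : 'M[C]_n) (z : C) : C := invn R n * \tr (resolvent W z).

(** The residual of the quadratic equation solved by [z] times the Stieltjes
    transform of the limiting law of [W]. *)
Definition mp_residual (y : R) (z v : C) : C := v ^+ 2 + (z + 1 - (y%:C)%C) * v + z.

(** Four directions are enough to bound the modulus of each deviation. *)
Definition good_at p n (M : 'M[C]_(p, n)) (tau : R) (z : C) :=
  forall (k : 'I_p) (d : C), d \in [:: 1; -1; 'i%C; -'i%C] -> ~~ deviates d z tau k M.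

(** The quadratic form is close to the normalized trace of the resolvent without
    the row, and that trace is within [(Im z)^-1] of the full one. *)
Lemma loo_close p n (M : 'M[C]_(p, n)) (tau A : R) (z : C) (k : 'I_p) :
  (0 < n)%N -> 0 < complex.Im z -> good_at M tau z ->
  tau <= 1 -> (n%:R * complex.Im z)^-1 <= tau ->
  cmod (stieltjes (sample_covariance M) z) <= A ->
  cmod (loo_qform M z k - stieltjes (sample_covariance M) z) <= tau * (2 * A + 5).
Proof.
move=> n0 e0 good t1 ne mA; set m := stieltjes _ _.
have N0 : 0 < n%:R :> R by rewrite ltr0n.
pose mk := loo_stieltjes M z k.
have mkm : cmod (mk - m) <= tau.
  apply: le_trans ne; rewrite /mk /m /loo_stieltjes /stieltjes -mulrBr cmodM.
  rewrite cmod_pos ?invr_ge0// invfM ler_pM2l ?invr_gt0//.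
  apply: cmod_le_sqn; first by rewrite invr_ge0 ltW.
  by rewrite exprVn; exact: tr_loo_le.
have Imk : complex.Im mk <= A + tau.
  apply: le_trans (ler_norm _) _; apply: le_trans (Im_le_cmod _) _.
  have -> : mk = m + (mk - m) by ring.
  by apply: le_trans (cmodD_le _ _) _; exact: lerD.
have t0 : 0 <= tau by apply: le_trans ne; rewrite invr_ge0 mulr_ge0 ?ltW.
have qk : cmod (loo_qform M z k - mk) <= 2 * (tau * (1 + complex.Im mk)).
  apply: le_trans (cmod_le_ReIm _) _; set u := loo_qform M z k - mk.
  have dev d : d \in [:: 1; -1; 'i%C; -'i%C] -> complex.Re (d * u) <= tau * (1 + complex.Im mk).
    by move=> dI; have := good k d dI; rewrite /deviates -leNgt.
  have [I1 I2 I3 I4] : [/\ 1 \in [:: 1; -1; 'i%C; -'i%C : C], -1 \in [:: 1; -1; 'i%C; -'i%C : C],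
    'i%C \in [:: 1; -1; 'i%C; -'i%C : C] & -'i%C \in [:: 1; -1; 'i%C; -'i%C : C]].
    by rewrite !inE !eqxx !orbT.
  have := dev _ I1; rewrite mul1r => d1.
  have := dev _ I2; rewrite mulN1r ReN => d2.
  have := dev _ I3; rewrite ReM /= mul0r mul1r sub0r => d3.
  have := dev _ I4; rewrite mulNr ReN ReM /= mul0r mul1r sub0r opprK => d4.
  rewrite mulrDl mul1r; apply: lerD; rewrite ler_norml; apply/andP; split;
    clear -d1 d2 d3 d4; lra.
have -> : loo_qform M z k - m = (loo_qform M z k - mk) + (mk - m) by ring.
apply: le_trans (cmodD_le _ _) _.
have := ler_wpM2l t0 Imk; have := mulr_ge0 t0 t0; have := ler_wpM2l t0 t1.
nra.
Qed.

(** If all the forms [q k] were equal to [m], the identity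
    [1 + z * m = n^-1 * \sum_k q k / (1 + q k)] would be the quadratic equation
    with parameter [p / n]; the lower bound [c] controls the denominators. *)
Lemma residual_step p n (M : 'M[C]_(p, n)) (tau A c y : R) (z : C) :
  (0 < n)%N -> (p <= n)%N -> 0 < complex.Im z -> good_at M tau z ->
  tau <= 1 -> (n%:R * complex.Im z)^-1 <= tau ->
  cmod (stieltjes (sample_covariance M) z) <= A ->
  c <= cmod (1 + stieltjes (sample_covariance M) z) ->
  0 < c -> 2 * (tau * (2 * A + 5)) <= c ->
  cmod (mp_residual y z (z * stieltjes (sample_covariance M) z)) <=
  `|p%:R / n%:R - y| * cmod (z * stieltjes (sample_covariance M) z) +
  cmod z * (2 * (tau * (2 * A + 5)) / c).
Proof.
move=> n0 pn e0 good t1 ne mA mc c0 tc; set m := stieltjes _ _; rewrite -/m in mA mc.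
have N0 : 0 < n%:R :> R by rewrite ltr0n.
have NC : n%:R != 0 :> C by rewrite pnatr_eq0 -lt0n.
pose q k := loo_qform M z k.
have e0' : complex.Im z != 0 by rewrite gt_eqF.
set t := tau * _ in tc *.
have qm k : cmod (q k - m) <= t by exact: loo_close.
have t0 : 0 <= t.
  have [] := leqP p 0 => [|p0]; last exact: le_trans (cmod_ge0 _) (qm (Ordinal p0)).
  move=> _; have A0 := le_trans (cmod_ge0 _) mA.
  apply: mulr_ge0; last by lra.
  by apply: le_trans ne; rewrite invr_ge0; exact: mulr_ge0 (ltW N0) (ltW e0).
have m0 : 0 < cmod (1 + m) by apply: lt_le_trans mc.
have m1 : 1 + m != 0 by rewrite -cmod_gt0.
have qc k : c / 2 <= cmod (1 + q k).
  have := cmodB_ge (1 + m) (m - q k); rewrite (_ : 1 + m - (m - q k) = 1 + q k); last by ring.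
  rewrite (cmodBC m); have := qm k; lra.
have q1 k : 1 + q k != 0 by rewrite -cmod_gt0; apply: lt_le_trans (qc k); lra.
have sumE : 1 + z * m = invn R n * \sum_(k < p) (q k / (1 + q k)).
  rewrite -tr_resolvent_loo// mulrDr /m /stieltjes mulrCA; congr (_ + _).
  by rewrite -invnE mulVf.
pose err := invn R n * \sum_(k < p) ((1 + q k)^-1 - (1 + m)^-1).
pose yn : R := p%:R / n%:R.
have ynE : (yn%:C)%C = invn R n * p%:R.
  by rewrite /yn mulrC rmorphM /= rmorph_nat.
have eqE : 1 + z * m = (yn%:C)%C - (yn%:C)%C / (1 + m) - err.
  rewrite sumE /err ynE -mulrA -!mulrBr; congr (_ * _).
  have -> : p%:R / (1 + m) = \sum_(k < p) (1 + m)^-1 :> C.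
    by rewrite sumr_const card_ord mulr_natl.
  have -> : p%:R = \sum_(k < p) (1 : C) by rewrite sumr_const card_ord.
  rewrite -!sumrB; apply: eq_bigr => k _.
  by have := q1 k; move: m1 => a b; field; rewrite a b.
have resE : mp_residual y z (z * m) = ((yn - y)%:C)%C * (z * m) - z * ((1 + m) * err).
  have -> : mp_residual y z (z * m) =
    (1 + z * m) * (z * (1 + m)) - (y%:C)%C * (z * m) by rewrite /mp_residual; ring.
  rewrite eqE rmorphB /=; by field.
rewrite resE; apply: le_trans (cmodB_le _ _) _; apply: lerD.
  by rewrite cmodM cmod_real.
rewrite cmodM ler_wpM2l ?cmod_ge0// /err mulrCA cmodM mulr_sumr.
rewrite cmod_pos ?invr_ge0//.
apply: (@le_trans _ _ (n%:R^-1 * \sum_(k < p) (2 * t / c))); last first.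
  rewrite sumr_const card_ord -[_ *+ p]mulr_natl [X in X <= _](mulrA n%:R^-1 p%:R).
  apply: ler_piMl; first by apply: divr_ge0 (ltW c0); lra.
  by rewrite mulrC ler_pdivrMr// mul1r ler_nat.
rewrite ler_wpM2l ?invr_ge0//; apply: le_trans (cmod_sum_le _ _ _) _.
apply: ler_sum => k _.
have -> : (1 + m) * ((1 + q k)^-1 - (1 + m)^-1) = - (q k - m) / (1 + q k).
  by have := q1 k; move: m1 => a b; field; rewrite a b.
rewrite cmodM cmodN cmodV.
have h0 : 0 < cmod (1 + q k) by rewrite cmod_gt0.
rewrite ler_pdivrMr//.
have h1 : 2 * t / c * (c / 2) <= 2 * t / c * cmod (1 + q k).
  apply: ler_wpM2l (qc k); apply: divr_ge0 (ltW c0); lra.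
have h2 : 2 * t / c * (c / 2) = t by field; rewrite gt_eqF.
by apply: le_trans h1; rewrite h2; exact: qm.
Qed.

(** A small residual keeps [v] bounded, and keeps [z + v] away from [0], which
    is not an approximate solution since [y * z] does not vanish. *)
Lemma residual_apriori (y eps : R) (z v : C) :
  0 <= y -> y <= 1 -> 0 < eps -> eps <= complex.Re z -> cmod z <= 8 ->
  cmod (mp_residual y z v) <= 1 -> cmod (mp_residual y z v) <= y * eps / 2 ->
  cmod v <= 10 /\ y * eps / 24 <= cmod (z + v).
Proof.
move=> y0 y1 e0 ze z8 r1 ry; set e := mp_residual y z v in r1 ry.
have z1 : cmod (z + 1 - (y%:C)%C) <= 9.
  have -> : z + 1 - (y%:C)%C = z + ((1 - y)%:C)%C by rewrite rmorphB /=; ring.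
  apply: le_trans (cmodD_le _ _) _; rewrite cmod_pos; lra.
have v10 : cmod v <= 10.
  have h : cmod v ^+ 2 <= 9 * cmod v + 9.
    rewrite expr2 -cmodM -expr2.
    have -> : v ^+ 2 = e - (z + 1 - (y%:C)%C) * v - z by rewrite /e /mp_residual; ring.
    apply: le_trans (cmodB_le _ _) _.
    have := cmodB_le e ((z + 1 - (y%:C)%C) * v); rewrite cmodM.
    have := ler_wpM2r (cmod_ge0 v) z1; lra.
  rewrite leNgt; apply/negP => v10; move: h; rewrite leNgt => /negP; apply.
  by move: v10; set x := cmod v => v10; nra.
split=> //.
have eE : (z + v) * (1 + v - (y%:C)%C) = e - (y%:C)%C * z by rewrite /e /mp_residual; ring.
have h1 : cmod (1 + v - (y%:C)%C) <= 12.
  apply: le_trans (cmodB_le _ _) _; rewrite cmod_pos//.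
  have := cmodD_le 1 v; rewrite cmod1; lra.
have h2 : y * eps / 2 <= cmod ((z + v) * (1 + v - (y%:C)%C)).
  rewrite eE cmodBC; apply: le_trans (cmodB_ge _ _).
  rewrite cmodM cmod_pos//.
  have zc : eps <= cmod z by apply: le_trans ze (le_trans (ler_norm _) (Re_le_cmod _)).
  have := ler_wpM2l y0 zc; lra.
rewrite cmodM in h2.
have := ler_wpM2l (cmod_ge0 (z + v)) h1; lra.
Qed.

End self_consistent_equation.

(** * Descent towards the real axis *)
Section bootstrap.
Variable R : realType.
Local Notation C := R[i].
Local Open Scope sesquilinear_scope.

Lemma real_sub_cmod_ge (l : R) (z : C) : complex.Im z <= cmod ((l%:C)%C - z).
Proof.
apply: le_trans (Im_le_cmod _); rewrite ImD ImN Im_real add0r normrN; exact: ler_norm.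
Qed.

Lemma stieltjesE n (W : 'M[C]_n) (z : C) : W^t* = W -> complex.Im z != 0 ->
  stieltjes W z = invn R n * \sum_(l <- evals W) ((l%:C)%C - z)^-1.
Proof. by move=> hW z0; rewrite /stieltjes tr_resolvent. Qed.

Lemma mean_cmod_le n (W : 'M[C]_n) (F : R -> C) (b : R) :
  W^t* = W -> 0 <= b -> (forall l, cmod (F l) <= b) ->
  cmod (invn R n * \sum_(l <- evals W) F l) <= b.
Proof.
move=> hW b0 Fb; rewrite cmodM cmod_pos ?invr_ge0//.
have [n0|n0] := posnP n; first by rewrite [X in X^-1](_ : _ = 0) ?invr0 ?mul0r// n0.
rewrite ler_pdivrMl ?ltr0n//; apply: le_trans (cmod_sum_le _ _ _) _.
apply: (@le_trans _ _ (\sum_(l <- evals W) b)); first by apply: ler_sum => l _.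
by rewrite big_const_seq count_predT size_evals// iter_addr_0 mulr_natl.
Qed.

Lemma stieltjes_le n (W : 'M[C]_n) (z : C) : W^t* = W -> 0 < complex.Im z ->
  cmod (stieltjes W z) <= (complex.Im z)^-1.
Proof.
move=> hW z0; rewrite stieltjesE ?gt_eqF//; apply: mean_cmod_le => // [|l].
  by rewrite invr_ge0 ltW.
have h := real_sub_cmod_ge l z.
by rewrite cmodV lef_pV2// posrE (lt_le_trans z0).
Qed.

Lemma stieltjes_lipschitz n (W : 'M[C]_n) (z z' : C) :
  W^t* = W -> 0 < complex.Im z -> 0 < complex.Im z' ->
  cmod (stieltjes W z - stieltjes W z') <= cmod (z - z') / (complex.Im z * complex.Im z').
Proof.
move=> hW z0 z0'; rewrite !stieltjesE ?gt_eqF// -mulrBr -sumrB.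
have d0 : 0 < complex.Im z * complex.Im z' by exact: mulr_gt0.
apply: (@mean_cmod_le _ _ (fun l => ((l%:C)%C - z)^-1 - ((l%:C)%C - z')^-1)) => // [|l].
  by rewrite divr_ge0 ?cmod_ge0 ?ltW.
have h := real_sub_cmod_ge l z; have h' := real_sub_cmod_ge l z'.
have n1 : (l%:C)%C - z != 0 by rewrite -cmod_gt0 (lt_le_trans z0).
have n2 : (l%:C)%C - z' != 0 by rewrite -cmod_gt0 (lt_le_trans z0').
have -> : ((l%:C)%C - z)^-1 - ((l%:C)%C - z')^-1 =
   (z - z') / (((l%:C)%C - z) * ((l%:C)%C - z')) by field; rewrite n1 n2.
rewrite cmodM cmodV cmodM ler_wpM2l ?cmod_ge0// lef_pV2 ?posrE//.
  by apply: ler_pM => //; exact: ltW.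
by apply: lt_le_trans d0 _; apply: ler_pM => //; exact: ltW.
Qed.

(** Next to the small residual stand the two bounds from which the following
    step of the descent starts. *)
Definition local_law (y eps e1 : R) (z m : C) : Prop :=
  [/\ cmod (mp_residual y z (z * m)) <= e1, cmod (z * m) <= 10 &
      y * eps / 24 <= cmod (z + z * m)].

Variables (p n : nat) (M : 'M[C]_(p, n)) (eps y e1 tau : R).
Let W := sample_covariance M.
Hypotheses (n0 : (0 < n)%N) (pn : (p <= n)%N) (eps0 : 0 < eps) (y0 : 0 < y) (y1 : y <= 1).
Hypotheses (e1_1 : e1 <= 1) (e1_y : e1 <= y * eps / 2) (tau1 : tau <= 1).
Let A : R := 11 / eps.
Let t : R := tau * (2 * A + 5).
Let c : R := y * eps / 384.
Hypotheses (tc : 2 * t <= c)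
  (te : `|p%:R / n%:R - y| * 11 + 8 * (2 * t / c) <= e1).

(** The weak bounds [11] and [y * eps / 48] come back as [10] and [y * eps / 24],
    with a gain that exceeds the variation over one step of the grid. *)
Lemma apriori_improves (z : C) :
  eps <= complex.Re z -> complex.Re z <= 4 -> 0 < complex.Im z -> complex.Im z <= 4 ->
  (n%:R * complex.Im z)^-1 <= tau -> good_at M tau z ->
  cmod (z * stieltjes W z) <= 11 -> y * eps / 48 <= cmod (z + z * stieltjes W z) ->
  local_law y eps e1 z (stieltjes W z).
Proof.
move=> Re_ge Re_le Im_gt Im_le ne good; set m := stieltjes W z => v11 zv.
have z8 : cmod z <= 8.
  apply: le_trans (cmod_le_ReIm _) _; rewrite !ger0_norm; first by lra.
    exact: ltW.
  by apply: le_trans Re_ge; exact: ltW.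
have ze : eps <= cmod z by apply: le_trans Re_ge (le_trans (ler_norm _) (Re_le_cmod _)).
have mA : cmod m <= A.
  rewrite /A ler_pdivlMr// mulrC; apply: le_trans v11; rewrite cmodM.
  by rewrite ler_wpM2r ?cmod_ge0.
have ye : 0 < y * eps by exact: mulr_gt0.
have mc : c <= cmod (1 + m).
  have : y * eps / 48 <= 8 * cmod (1 + m).
    apply: le_trans zv _; rewrite -[X in cmod (X + _)]mulr1 -mulrDr cmodM.
    by rewrite ler_wpM2r ?cmod_ge0.
  rewrite /c; lra.
have c0 : 0 < c by rewrite /c; lra.
have tau0 : 0 <= tau.
  by apply: le_trans ne; rewrite invr_ge0; apply: mulr_ge0 (ler0n _ _) (ltW Im_gt).
have t0 : 0 <= t.
  apply: mulr_ge0 => //; have : 0 <= A by apply: divr_ge0 (ler0n _ _) (ltW eps0).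
  lra.
have res : cmod (mp_residual y z (z * m)) <= e1.
  apply: le_trans te; apply: le_trans (residual_step y n0 pn Im_gt good tau1 ne mA mc c0 tc) _.
  apply: lerD; first exact: ler_wpM2l.
  by apply: ler_wpM2r z8; apply: divr_ge0 (ltW c0); rewrite -/t; lra.
have [h1 h2] := residual_apriori (ltW y0) y1 eps0 Re_ge z8 (le_trans res e1_1) (le_trans res e1_y).
by split.
Qed.

Definition grid_pt (a b : nat) : C := Complex (a%:R / n%:R ^+ 3) (b%:R / n%:R ^+ 3).

Lemma cmod_grid_step a b : cmod (grid_pt a b.+1 - grid_pt a b) = (n%:R ^+ 3)^-1.
Proof.
have -> : grid_pt a b.+1 - grid_pt a b = ((n%:R ^+ 3)^-1%:C)%C * 'i%C.
  apply/eqP; rewrite eq_complex /= -[in b.+1%:R]natr1; apply/andP; split; apply/eqP; ring.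
rewrite cmodM cmod_pos ?invr_ge0 ?exprn_ge0//.
by rewrite /cmod /sqn /= expr0n expr1n add0r sqrtr1 mulr1.
Qed.

Hypotheses (n_large : 10 / n%:R <= y * eps / 48) (n9 : (9 <= n)%N) (y_eps : eps <= 4).
Variable eta0 : R.
Hypothesis (eta0_gt0 : 0 < eta0) (ne0 : (n%:R * eta0)^-1 <= tau).

(** Downward induction on a vertical line of the grid. At height [4] the trivial
    bound on the transform is enough; further down a step of length [n ^- 3]
    changes the transform by at most [n^-1], because [n^-1 <= Im z]. *)
Lemma grid_local_law (a : nat) :
  eps <= complex.Re (grid_pt a 0) -> complex.Re (grid_pt a 0) <= 4 ->
  (forall b, eta0 <= complex.Im (grid_pt a b) -> (b <= 4 * n ^ 3)%N ->
     good_at M tau (grid_pt a b)) ->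
  forall b, (b <= 4 * n ^ 3)%N -> eta0 <= complex.Im (grid_pt a b) ->
  local_law y eps e1 (grid_pt a b) (stieltjes W (grid_pt a b)).
Proof.
(* [s] counts the steps below height [4]. *)
move=> Re_ge Re_le good b b4; have [s] : exists s, (b + s = 4 * n ^ 3)%N.
  by exists (4 * n ^ 3 - b)%N; rewrite subnKC.
have hW : W^t* = W := sample_covariance_herm M.
have N3 : 0 < n%:R ^+ 3 :> R by rewrite exprn_gt0// ltr0n.
have N0 : 0 < n%:R :> R by rewrite ltr0n.
have neb u : eta0 <= u -> (n%:R * u)^-1 <= tau.
  move=> hu; apply: le_trans ne0; rewrite lef_pV2 ?posrE ?mulr_gt0//; last exact: lt_le_trans hu.
  by rewrite ler_pM2l.
elim: s b b4 => [|s IH] b b4 bs eb.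
  have z4 : complex.Im (grid_pt a b) = 4.
    by rewrite /= -[b]addn0 bs natrM natrX mulfK// gt_eqF.
  have Imz : 0 < complex.Im (grid_pt a b) by rewrite z4.
  have m4 := stieltjes_le hW Imz; rewrite z4 in m4.
  have z8 : cmod (grid_pt a b) <= 8.
    apply: le_trans (cmod_le_ReIm _) _; rewrite z4 !ger0_norm//; first by lra.
    by apply: le_trans Re_ge; exact: ltW.
  have z4' : 4 <= cmod (grid_pt a b).
    by rewrite -z4; apply: le_trans (ler_norm _) (Im_le_cmod _).
  apply: apriori_improves => //; rewrite ?z4//.
  - by apply: neb; rewrite -z4.
  - exact: good.
  - rewrite cmodM; have := ler_pM (cmod_ge0 _) (cmod_ge0 _) z8 m4; lra.
  - set m := stieltjes _ _ in m4 *; rewrite -[X in cmod (X + _)]mulr1 -mulrDr cmodM.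
    have := cmodB_ge 1 (- m); rewrite opprK cmodN cmod1 => h.
    have h1 : 3 / 4 <= cmod (1 + m) by lra.
    have h2 : 4 * (3 / 4) <= cmod (grid_pt a b) * cmod (1 + m) by apply: ler_pM.
    have h3 : y * eps <= 4 by rewrite -[4]mul1r; apply: ler_pM => //; exact: ltW.
    lra.
have b1 : (b.+1 <= 4 * n ^ 3)%N by rewrite -bs -addn1 leq_add2l.
have eb1 : eta0 <= complex.Im (grid_pt a b.+1).
  by apply: le_trans eb _; rewrite /= ler_pM2r ?invr_gt0// ler_nat.
have [_ v10 zv] := IH b.+1 b1 (etrans (addSnnS _ _) bs) eb1.
set z := grid_pt a b; set z1 := grid_pt a b.+1 in v10 zv.
have Iz : 0 < complex.Im z by exact: lt_le_trans eb.
have Iz1 : 0 < complex.Im z1 by exact: lt_le_trans eb1.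
have ninv u : eta0 <= u -> u^-1 <= n%:R.
  move=> hu; have u0 : 0 < u by exact: lt_le_trans hu.
  have := le_trans (neb u hu) tau1; rewrite invf_le1 ?mulr_gt0// => h.
  by rewrite -[leLHS]mul1r ler_pdivrMr.
have dm : cmod (stieltjes W z1 - stieltjes W z) <= n%:R^-1.
  apply: le_trans (stieltjes_lipschitz hW Iz1 Iz) _.
  rewrite cmod_grid_step.
  have -> : n%:R^-1 = (n%:R ^+ 3)^-1 * (n%:R * n%:R) :> R by field; rewrite gt_eqF.
  apply: ler_wpM2l; first by rewrite invr_ge0 ltW.
  rewrite [X in X <= _]invfM; apply: ler_pM; rewrite ?invr_ge0 ?(ltW Iz) ?(ltW Iz1)//; exact: ninv.
have z8 : cmod z <= 8.
  apply: le_trans (cmod_le_ReIm _) _; rewrite !ger0_norm ?(ltW Iz)//.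
    have : complex.Im z <= 4.
      by rewrite /= ler_pdivrMr// -natrX -natrM ler_nat.
    by have -> : complex.Re z = complex.Re (grid_pt a 0) by []; lra.
  by apply: le_trans Re_ge; exact: ltW.
have dz : cmod (z1 - z) <= n%:R^-1.
  rewrite cmod_grid_step lef_pV2 ?posrE// -[leLHS]mulr1 exprS ler_pM2l// exprn_ege1//.
  by rewrite ler1n.
have dv : cmod (z1 * stieltjes W z1 - z * stieltjes W z) <= 9 / n%:R.
  have -> : z1 * stieltjes W z1 - z * stieltjes W z =
    (z1 - z) * stieltjes W z1 + z * (stieltjes W z1 - stieltjes W z) by ring.
  apply: le_trans (cmodD_le _ _) _.
  rewrite [cmod (_ * stieltjes W z1)]cmodM [cmod (z * _)]cmodM.
  have h1 : cmod (z1 - z) * cmod (stieltjes W z1) <= n%:R^-1.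
    rewrite cmod_grid_step.
    have h := le_trans (stieltjes_le hW Iz1) (ninv _ eb1).
    have := ler_wpM2l (ltW (_ : 0 < (n%:R ^+ 3)^-1)) h; rewrite invr_gt0 => /(_ N3) h'.
    apply: le_trans h' _.
    have -> : (n%:R ^+ 3)^-1 * n%:R = n%:R^-1 * n%:R^-1 :> R by field; rewrite gt_eqF.
    apply: ler_piMl; first by rewrite invr_ge0 ltW.
    by rewrite invf_le1// ler1n.
  have h2 : cmod z * cmod (stieltjes W z1 - stieltjes W z) <= 8 * n%:R^-1.
    by apply: ler_pM; rewrite ?cmod_ge0.
  have -> : 9 / n%:R = n%:R^-1 + 8 * n%:R^-1 :> R by ring.
  exact: lerD h1 h2.
have n1 : n%:R^-1 * 9 <= 1 :> R.
  by rewrite mulrC ler_pdivrMr// mul1r ler_nat.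
apply: apriori_improves => //.
- by rewrite /= ler_pdivrMr// -natrX -natrM ler_nat.
- exact: neb.
- exact: good.
- have := cmodD_le (z1 * stieltjes W z1) (z * stieltjes W z - z1 * stieltjes W z1).
  rewrite addrC subrK [X in _ + X]cmodBC; lra.
- have := cmodD_le (z + z * stieltjes W z) ((z1 - z) + (z1 * stieltjes W z1 - z * stieltjes W z)).
  rewrite (_ : _ + _ + (_ + _) = z1 + z1 * stieltjes W z1); last by ring.
  move=> h1; have h2 : y * eps / 24 <= cmod (z + z * stieltjes W z) + 10 / n%:R.
    apply: le_trans zv _; apply: le_trans h1 _; rewrite lerD2l.
    apply: le_trans (cmodD_le _ _) _; rewrite (_ : 10 / n%:R = n%:R^-1 + 9 / n%:R); last by ring.
    exact: lerD dz dv.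
  by move: h2 n_large; move: (cmod _) (10 / _) (y * eps) => *; lra.
Qed.

End bootstrap.

(** * Union bound over a grid *)
Section union_bound.
Variables (R : realType) (p n : nat) (V : finType).
Variables (w : 'I_p -> 'I_n -> V -> R) (x : 'I_p -> 'I_n -> V -> R[i]) (B : R).
Hypothesis w_prob : forall k, prob_weights (w k).
Hypothesis x_Re0 : forall k i, \sum_v w k i v * complex.Re (x k i v) = 0.
Hypothesis x_Im0 : forall k i, \sum_v w k i v * complex.Im (x k i v) = 0.
Hypothesis x_var : forall k i, \sum_v w k i v * sqn (x k i v) = 1.
Hypothesis x_bound : forall k i v, sqn (x k i v) <= B.

Definition grid_good (eta0 tau : R) (M : 'M[R[i]]_(p, n)) :=
  forall a b, (a <= 4 * n ^ 3)%N -> (b <= 4 * n ^ 3)%N ->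
    eta0 <= complex.Im (grid_pt R n a b) -> good_at M tau (grid_pt R n a b).

Definition directions : seq R[i] := [:: 1; -1; 'i%C; -'i%C].

Lemma sqn_direction d : d \in directions -> sqn d = 1.
Proof.
rewrite !inE => /or4P[] /eqP ->; rewrite ?sqnN ?(sqn_real 1) ?expr1n//;
by rewrite /sqn /= expr0n expr1n add0r.
Qed.

Lemma exists_le_sum (U : finType) (P : pred U) :
  ([exists u, P u])%:R <= \sum_u (P u)%:R :> R.
Proof.
case: existsP => [[u Pu]|_]; last by apply: sumr_ge0.
by rewrite (bigD1 u)//= Pu lerDl sumr_ge0.
Qed.

(** Union bound over the grid points, the rows and the directions. *)
Lemma grid_good_prob (eta0 tau : R) :
  (0 < n)%N -> 0 < B -> 0 < eta0 -> 0 < tau -> tau <= 6 ->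
  exists2 bad : pred {ffun 'I_p -> {ffun 'I_n -> V}},
   forall o, ~~ bad o -> grid_good eta0 tau (sample_matrix x o) &
   fexp (row_weight w) (fun o => (bad o)%:R) <=
   ((4 * n ^ 3).+1 ^ 2 * p * 4)%:R * expR (- (tau ^+ 2 * n%:R * eta0 / (768 * B))).
Proof.
move=> n0 B0 eta0_gt0 t0 t6; pose N := (4 * n ^ 3).+1.
pose U := ('I_N * 'I_N * 'I_p * 'I_4)%type.
pose zu (u : U) := grid_pt R n u.1.1.1 u.1.1.2.
pose ev (u : U) o := (eta0 <= complex.Im (zu u)) &&
  deviates (nth 0 directions u.2) (zu u) tau u.1.2 (sample_matrix x o).
exists (fun o => [exists u, ev u o]).
  move=> o /existsPn h a b aN bN eb k d dI.
  have jd : (index d directions < 4)%N by rewrite index_mem.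
  have := h (Ordinal (aN : a < N)%N, Ordinal (bN : b < N)%N, k, Ordinal jd).
  by rewrite /ev /zu /= eb /= nth_index.
apply: (@le_trans _ _ (\sum_u fexp (row_weight w) (fun o => (ev u o)%:R))).
  rewrite -fexp_sum; apply: (ler_fexp (row_weight_prob w_prob)) => o.
  exact: exists_le_sum.
set bd := expR _.
apply: (@le_trans _ _ (\sum_(u : U) bd)); last first.
  rewrite sumr_const -[_ *+ _]mulr_natl !card_prod !card_ord.
  by rewrite -mulnn.
apply: ler_sum => u _.
have [eu|eu] := boolP (eta0 <= complex.Im (zu u)); last first.
  rewrite (@eq_fexp _ _ _ _ _ (fun=> 0)); last by move=> o; rewrite /ev (negbTE eu).
  by rewrite (fexp_cst (row_weight_prob w_prob)) expR_ge0.
rewrite (@eq_fexp _ _ _ _ _ (fun o => (deviates (nth 0 directions u.2) (zu u) tau u.1.2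
  (sample_matrix x o))%:R)); last by move=> o; rewrite /ev eu.
have sd : sqn (nth 0 directions u.2) = 1 by apply/sqn_direction/mem_nth.
apply: le_trans (loo_deviation_le w_prob x_Re0 x_Im0 x_var x_bound u.1.2 n0 B0 sd
   (lt_le_trans eta0_gt0 eu) t0 t6) _.
rewrite ler_expR lerN2; apply: ler_wpM2r; first by rewrite invr_ge0; apply: mulr_ge0 (ler0n _ _) (ltW B0).
by apply: ler_wpM2l eu; apply: mulr_ge0 (sqr_ge0 _) (ler0n _ _).
Qed.

End union_bound.

(** There are polynomially many events, while each of them fails with
    probability at most [n `^ (- (C1 + 8))]. *)
Lemma union_bound_numerics (R : realType) (p n : nat) (C1 c : R) :
  (100 <= n)%N -> (p <= n)%N -> (C1 + 8) * ln n%:R <= c ->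
  ((4 * n ^ 3).+1 ^ 2 * p * 4)%:R * expR (- c) <= n%:R `^ (- C1).
Proof.
move=> n100 pn hc.
have n0 : (0 < n)%N by apply: leq_trans n100.
have N0 : 0 < n%:R :> R by rewrite ltr0n.
have h1 : expR (- c) <= expR (- C1 * ln n%:R) * (n%:R ^+ 8)^-1.
  have -> : (n%:R ^+ 8)^-1 = expR (- (8 * ln n%:R)) :> R.
    by rewrite expRN expRM_natl lnK.
  by rewrite -expRD ler_expR; lra.
have h2 : (((4 * n ^ 3).+1 ^ 2 * p * 4)%:R : R) <= n%:R ^+ 8.
  rewrite -natrX ler_nat.
  have a1 : ((4 * n ^ 3).+1 <= 5 * n ^ 3)%N.
    by rewrite -addn1 (mulnDl 4 1) mul1n leq_add2l expn_gt0 n0.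
  apply: (@leq_trans ((5 * n ^ 3) ^ 2 * n * 4)%N).
    by rewrite leq_mul2r /= leq_mul// leq_exp2r.
  have -> : ((5 * n ^ 3) ^ 2 * n * 4 = 100 * n ^ 7)%N.
    by rewrite expnMn -expnM -mulnA [(n * 4)%N]mulnC mulnACA -expnSr.
  by rewrite [X in (_ <= X)%N]expnS leq_mul2r n100 orbT.
have -> : n%:R `^ (- C1) = expR (- C1 * ln n%:R) by rewrite /powR gt_eqF.
apply: (@le_trans _ _ (n%:R ^+ 8 * (expR (- C1 * ln n%:R) * (n%:R ^+ 8)^-1))).
  by apply: ler_pM => //; exact: expR_ge0.
by rewrite mulrCA divff ?mulr1// expf_neq0// gt_eqF.
Qed.

(** * Counting points with Poisson kernels *)
Section integral_on_segments.
Variable R : realType.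
Local Notation mu := (@lebesgue_measure R).
Local Notation Rint a b f := (\int[mu]_(x in [set` `[a, b]]) f x)%R.

Definition continuous_on (lo hi : R) (f : R -> R) :=
  forall x, lo <= x -> x <= hi -> {for x, continuous f}.

Lemma continuous_onW (lo hi lo' hi' : R) f :
  lo <= lo' -> hi' <= hi -> continuous_on lo hi f -> continuous_on lo' hi' f.
Proof. by move=> h h' cf x lx xh; apply: cf; [exact: le_trans lx|exact: le_trans h']. Qed.

Lemma continuous_on_within a b (f : R -> R) :
  continuous_on a b f -> {within `[a, b], continuous f}.
Proof.
move=> cf; apply: continuous_in_subspaceT => x; rewrite inE /= in_itv /= => /andP[].
exact: cf.
Qed.

Lemma continuous_on_integrable a b (f : R -> R) :
  continuous_on a b f -> mu.-integrable `[a, b] (EFin \o f).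
Proof.
move=> cf; apply: continuous_compact_integrable; first exact: segment_compact.
exact: continuous_on_within.
Qed.

Lemma Rint_le a b (f g : R -> R) : continuous_on a b f -> continuous_on a b g ->
  (forall x, a <= x -> x <= b -> f x <= g x) -> Rint a b f <= Rint a b g.
Proof.
move=> cf cg fg; apply: le_Rintegral => //; try exact: continuous_on_integrable.
by move=> x /=; rewrite in_itv /= => /andP[]; exact: fg.
Qed.

Lemma Rint_cst a b (c : R) : a <= b -> Rint a b (fun=> c) = c * (b - a).
Proof.
by move=> ab; rewrite Rintegral_cst//= lebesgue_measure_itv /= lte_fin; case: ltgtP ab => // -> _; rewrite subrr.
Qed.

Lemma continuous_on_cst a b (c : R) : continuous_on a b (fun=> c).
Proof. by move=> x _ _; exact: cvg_cst. Qed.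

Lemma continuous_onD a b f g : continuous_on a b f -> continuous_on a b g ->
  continuous_on a b (fun x => f x + g x).
Proof. by move=> cf cg x ax xb; apply: cvgD; [exact: cf|exact: cg]. Qed.

Lemma continuous_onM a b f g : continuous_on a b f -> continuous_on a b g ->
  continuous_on a b (fun x => f x * g x).
Proof. by move=> cf cg x ax xb; apply: cvgM; [exact: cf|exact: cg]. Qed.

Lemma RintD a b f g : continuous_on a b f -> continuous_on a b g ->
  Rint a b (fun x => f x + g x) = Rint a b f + Rint a b g.
Proof. by move=> cf cg; apply: RintegralD => //; exact: continuous_on_integrable. Qed.

Lemma RintZ a b (c : R) f : continuous_on a b f ->
  Rint a b (fun x => c * f x) = c * Rint a b f.
Proof. by move=> cf; apply: RintegralZl => //; exact: continuous_on_integrable. Qed.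

Lemma Rint_split a b c f : a <= c -> c <= b -> continuous_on a b f ->
  Rint a b f = Rint a c f + Rint c b f.
Proof.
move=> ac cb cf; have fi := continuous_on_integrable cf.
have := @Rintegral_itvB R f (BLeft a) (BRight b) c fi.
rewrite !bnd_simp => /(_ ac cb) h.
rewrite -[Rint c b f]Rintegral_itv_obnd_cbnd; first by rewrite -h addrC subrK.
by apply: integrableS fi => //; apply: subset_itvr; rewrite bnd_simp.
Qed.

End integral_on_segments.

Section poisson_kernel.
Variable R : realType.
Local Notation mu := (@lebesgue_measure R).
Local Notation Rint a b f := (\int[mu]_(x in [set` `[a, b]]) f x)%R.

Definition poisson (eta u : R) : R := eta / (u ^+ 2 + eta ^+ 2).

Lemma poisson_ge0 eta u : 0 <= eta -> 0 <= poisson eta u.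
Proof. by move=> e0; apply: divr_ge0 => //; rewrite addr_ge0 ?sqr_ge0. Qed.

Lemma poisson_continuous eta l (a b : R) : 0 < eta ->
  continuous_on a b (fun x => poisson eta (l - x)).
Proof.
move=> e0 x _ _; apply: cvgM; first exact: cvg_cst.
apply: cvgV.
  by rewrite gt_eqF// ltr_wpDl ?sqr_ge0// exprn_gt0.
apply: cvgD; last exact: cvg_cst.
apply: (@continuous_comp _ _ _ (fun x => l - x) (fun x => x ^+ 2)).
  by apply: cvgB; [exact: cvg_cst|exact: cvg_id].
exact: exprn_continuous.
Qed.

Lemma is_derive_atan_poisson eta l (x : R) : 0 < eta ->
  is_derive x 1 (fun x => atan ((x - l) / eta)) (poisson eta (l - x)).
Proof.
move=> e0.
have h1 : is_derive x 1 (fun x : R => (x - l) / eta) eta^-1.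
  have h : is_derive x 1 (fun x : R => eta^-1 *: (x - l)) (eta^-1 *: (1 - 0)).
    apply: is_deriveZ; apply: is_deriveB.
  rewrite (_ : (fun x : R => (x - l) / eta) = (fun x => eta^-1 *: (x - l))).
    by move: h; rewrite subr0 [X in is_derive _ _ _ X](mulr1 eta^-1).
  by apply/funext => t; rewrite mulrC.
have := @is_derive1_comp R (@atan R) (fun x => (x - l) / eta) x _ _ (is_derive1_atan _) h1.
rewrite [X in is_derive _ _ _ X](_ : _ = poisson eta (l - x))//.
rewrite /poisson.
have e2 : eta ^+ 2 != 0 by rewrite expf_neq0 ?gt_eqF.
have h2 : (x - l) ^+ 2 + eta ^+ 2 != 0 by rewrite gt_eqF// ltr_wpDl ?sqr_ge0 ?exprn_gt0.
field.
by rewrite (gt_eqF e0) andbT -(sqrrN (l - x)) opprB.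
Qed.

Lemma Rint_poisson eta l (a b : R) : 0 < eta -> a < b ->
  Rint a b (fun x => poisson eta (l - x)) = atan ((b - l) / eta) - atan ((a - l) / eta).
Proof.
move=> e0 ab; rewrite /Rintegral.
have dA x := is_derive_atan_poisson l x e0.
have cA (x : R) : {for x, continuous (fun x => atan ((x - l) / eta))}.
  by apply: differentiable_continuous; apply/derivable1_diffP; case: (dA x).
rewrite (@continuous_FTC2 R _ (fun x => atan ((x - l) / eta)))//.
- by apply: continuous_on_within; exact: poisson_continuous.
- split.
  + by move=> x _; case: (dA x).
  + exact: cvg_at_right_filter (cA a).
  + exact: cvg_at_left_filter (cA b).
- by move=> x _; rewrite derive1E; case: (dA x).
Qed.

(** [pi / 2 - atan x] is [atan x^-1], and [atan] lies below the identity. *)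
Lemma pi_sub_atan_le (x : R) : 0 < x -> pi / 2 - x^-1 <= atan x.
Proof.
move=> x0.
have a0 : 0 < atan x by rewrite -atan0 lt_atan.
have a1 := atan_ltpi2 x.
have xi0 : 0 < x^-1 by rewrite invr_gt0.
have aE : pi / 2 - atan x = atan x^-1.
  rewrite -[LHS]tanK; last by rewrite in_itv /=; apply/andP; split; lra.
  congr atan; rewrite -[in RHS](atanK x) /tan sinB cosB cos_pihalf sin_pihalf.
  by rewrite !mul1r !mul0r subr0 add0r invf_div.
have : atan x^-1 <= x^-1.
  have ca : {within `[0, x^-1], continuous (@atan R)}.
    by apply: continuous_subspaceT => t; exact: continuous_atan.
  have [c _] := MVT_segment (ltW xi0) (fun t _ => is_derive1_atan t) ca.
  rewrite atan0 !subr0 => ->; apply: ler_piMl; first exact: ltW.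
  by rewrite invf_le1 ?lerDl ?sqr_ge0// ltr_pwDl ?sqr_ge0.
by rewrite -aE; lra.
Qed.

Definition poisson_sum (eta : R) (s : seq R) (x : R) : R :=
  \sum_(l <- s) poisson eta (l - x).

Lemma poisson_sum_continuous eta s (a b : R) : 0 < eta ->
  continuous_on a b (poisson_sum eta s).
Proof.
move=> e0; elim: s => [|l s IH].
  rewrite (_ : poisson_sum eta [::] = fun=> 0); first exact: continuous_on_cst.
  by apply/funext => x; rewrite /poisson_sum big_nil.
rewrite (_ : poisson_sum eta (l :: s) = fun x => poisson eta (l - x) + poisson_sum eta s x).
  by apply: continuous_onD => //; exact: poisson_continuous.
by apply/funext => x; rewrite /poisson_sum big_cons.
Qed.

Lemma Rint_poisson_sum eta s (a b : R) : 0 < eta -> a < b ->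
  Rint a b (poisson_sum eta s) =
  \sum_(l <- s) (atan ((b - l) / eta) - atan ((a - l) / eta)).
Proof.
move=> e0 ab; elim: s => [|l s IH].
  rewrite (_ : poisson_sum eta [::] = fun=> 0).
    by rewrite big_nil Rint_cst ?mul0r// ltW.
  by apply/funext => x; rewrite /poisson_sum big_nil.
rewrite (_ : poisson_sum eta (l :: s) = fun x => poisson eta (l - x) + poisson_sum eta s x).
  rewrite RintD ?Rint_poisson// ?IH ?big_cons//.
    exact: poisson_continuous.
  exact: poisson_sum_continuous.
by apply/funext => x; rewrite /poisson_sum big_cons.
Qed.

Lemma poisson_sum_filter_le eta (P : pred R) s x : 0 <= eta ->
  poisson_sum eta (seq.filter P s) x <= poisson_sum eta s x.
Proof.
move=> e0; rewrite /poisson_sum big_filter [leRHS](bigID P) /= lerDl.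
by apply: sumr_ge0 => l _; exact: poisson_ge0.
Qed.

(** At distance [r] from its centre a kernel is small compared with the kernel
    of the coarser scale [r]. *)
Lemma poisson_scale_le eta r u : 0 < eta -> 0 < r -> r ^+ 2 <= u ^+ 2 ->
  poisson eta u <= 2 * eta / r * poisson r u.
Proof.
move=> e0 r0 ru; rewrite /poisson.
have d1 : 0 < u ^+ 2 + eta ^+ 2 by rewrite ltr_wpDl ?sqr_ge0// exprn_gt0.
have d2 : 0 < u ^+ 2 + r ^+ 2 by rewrite ltr_wpDl ?sqr_ge0// exprn_gt0.
have -> : 2 * eta / r * (r / (u ^+ 2 + r ^+ 2)) = eta * (2 / (u ^+ 2 + r ^+ 2)).
  by field; rewrite !gt_eqF.
apply: ler_wpM2l; first exact: ltW.
rewrite ler_pdivlMr// mulrC ler_pdivrMr//.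
by have := sqr_ge0 eta; lra.
Qed.

End poisson_kernel.

Lemma sum_cst_seq (R : realType) (s : seq R) (c : R) :
  \sum_(l <- s) c = (size s)%:R * c.
Proof. by rewrite big_const_seq count_predT iter_addr_0 mulr_natl. Qed.

Section counting.
Variable R : realType.
Local Notation Rint a b f := (\int[@lebesgue_measure R]_(x in [set` `[a, b]]) f x)%R.
Variables (s : seq R) (g : R -> R) (N theta C G eta r lo hi al be : R).
Hypotheses (N0 : 0 < N) (theta0 : 0 <= theta) (theta1 : theta <= 1) (C0 : 0 <= C) (G0 : 0 <= G).
Hypotheses (eta0 : 0 < eta) (r0 : 0 < r) (re : 2 * eta <= r).
Hypotheses (lo_al : lo <= al - r) (be_hi : be + r <= hi) (rl : 4 * r <= be - al).
Hypothesis g_cont : continuous_on lo hi g.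
Hypothesis g_bound : forall x, lo <= x -> x <= hi -> 0 <= g x /\ g x <= G.
Hypothesis fine_scale : forall x, lo <= x -> x <= hi ->
  `|poisson_sum eta s x - N * g x| <= N * theta.
Hypothesis coarse_scale : forall x, lo <= x -> x <= hi -> poisson_sum r s x <= N * C.

Let al_be : al < be. Proof. by move: r0 rl; lra. Qed.

Lemma Rint_bounds u v : u <= v -> lo <= u -> v <= hi ->
  0 <= Rint u v g /\ Rint u v g <= G * (v - u).
Proof.
move=> uv lu vh; split.
  apply: Rintegral_ge0 => x; rewrite /= in_itv /= => /andP[ux xv].
  by have [] := g_bound (le_trans lu ux) (le_trans xv vh).
rewrite -Rint_cst//; apply: Rint_le.
- exact: continuous_onW g_cont.
- exact: continuous_on_cst.
- by move=> x ux xv; have [] := g_bound (le_trans lu ux) (le_trans xv vh).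
Qed.

(** Integrating over the enlarged interval captures almost all of the mass of
    every kernel centred in the interval. *)
Lemma count_upper : (count (fun l => al <= l <= be) s)%:R * (pi - 2 * (eta / r)) <=
  N * (Rint al be g + 2 * r * G + theta * (be - al + 2 * r)).
Proof.
pose s1 := seq.filter (fun l => al <= l <= be) s.
have ab : al - r < be + r by move: r0 al_be; lra.
have gD : continuous_on (al - r) (be + r) (fun x => N * (g x + theta)).
  apply: continuous_onM; first exact: continuous_on_cst.
  by apply: continuous_onD; [exact: continuous_onW g_cont|exact: continuous_on_cst].
have h1 : Rint (al - r) (be + r) (poisson_sum eta s1) <=
          Rint (al - r) (be + r) (fun x => N * (g x + theta)).
  apply: Rint_le => // [|x lx xh]; first exact: poisson_sum_continuous.
  apply: le_trans (poisson_sum_filter_le _ _ _ (ltW eta0)) _.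
  have := fine_scale (le_trans lo_al lx) (le_trans xh be_hi).
  by rewrite ler_norml => /andP[_]; lra.
have h2 : Rint (al - r) (be + r) (fun x => N * (g x + theta)) <=
   N * (Rint al be g + 2 * r * G + theta * (be - al + 2 * r)).
  rewrite RintZ; last first.
    by apply: continuous_onD; [exact: continuous_onW g_cont|exact: continuous_on_cst].
  rewrite ler_pM2l// RintD; [|exact: continuous_onW g_cont|exact: continuous_on_cst].
  rewrite Rint_cst; last exact: ltW.
  rewrite (@Rint_split _ _ _ al); [| | |exact: continuous_onW g_cont]; first last.
  - by move: r0 al_be; lra.
  - by move: r0; lra.
  rewrite (@Rint_split _ al _ be); [| | |]; first last.
  - by apply: continuous_onW g_cont => //; move: lo_al r0; lra.
  - by move: r0; lra.
  - exact: ltW.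
  have [_ b1] := @Rint_bounds (al - r) al ltac:(by move: r0; lra) lo_al ltac:(by move: r0 al_be be_hi; lra).
  have [_ b2] := @Rint_bounds be (be + r) ltac:(by move: r0; lra) ltac:(by move: r0 al_be lo_al; lra) be_hi.
  move: b1 b2; lra.
apply: le_trans (le_trans h1 h2); rewrite Rint_poisson_sum//.
rewrite -size_filter -/s1 -sum_cst_seq.
rewrite !big_seq; apply: ler_sum => l; rewrite mem_filter => /andP[/andP[l1 l2] _].
have re0 : 0 < r / eta by exact: divr_gt0.
have at1 := pi_sub_atan_le re0; rewrite invf_div in at1.
have m1 : atan (r / eta) <= atan ((be + r - l) / eta).
  by apply: le_atan; rewrite ler_pM2r ?invr_gt0//; move: l2; lra.
have m2 : atan ((al - r - l) / eta) <= - atan (r / eta).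
  by rewrite -atanN; apply: le_atan; rewrite -mulNr ler_pM2r ?invr_gt0//; move: l1; lra.
move: at1 m1 m2; lra.
Qed.

(** Integrating over the shrunk interval, kernels centred outside are dominated
    by those of the coarser scale [r]. *)
Lemma count_lower :
  N * (Rint al be g - 2 * r * G - theta * (be - al) - 2 * (eta / r) * C * (be - al)) <=
  (count (fun l => al < l < be) s)%:R * pi.
Proof.
pose P := (fun l => al < l < be); pose s2 := seq.filter P s.
have ab : al + r < be - r by move: r0 rl; lra.
have lo1 : lo <= al + r by move: r0 lo_al; lra.
have hi1 : be - r <= hi by move: r0 be_hi; lra.
pose K := theta + 2 * (eta / r) * C.
have gD : continuous_on (al + r) (be - r) (fun x => g x + - K).
  by apply: continuous_onD; [exact: continuous_onW g_cont|exact: continuous_on_cst].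
have h1 : Rint (al + r) (be - r) (fun x => N * (g x + - K)) <=
          Rint (al + r) (be - r) (poisson_sum eta s2).
  apply: Rint_le => [||x lx xh].
  - by apply: continuous_onM => //; exact: continuous_on_cst.
  - exact: poisson_sum_continuous.
  have lx' := le_trans lo1 lx; have xh' := le_trans xh hi1.
  have := fine_scale lx' xh'; rewrite ler_norml => /andP[f1 _].
  have f2 := coarse_scale lx' xh'.
  have f3 : poisson_sum eta (seq.filter (predC P) s) x <= 2 * (eta / r) * (N * C).
    apply: (@le_trans _ _ (2 * (eta / r) * poisson_sum r s x)); last first.
      by apply: ler_wpM2l f2; apply: mulr_ge0 => //; exact: divr_ge0 (ltW eta0) (ltW r0).
    apply: (@le_trans _ _ (2 * (eta / r) * poisson_sum r (seq.filter (predC P) s) x)); last first.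
      apply: ler_wpM2l; first by apply: mulr_ge0 => //; exact: divr_ge0 (ltW eta0) (ltW r0).
      exact: poisson_sum_filter_le (ltW r0).
    rewrite /poisson_sum mulr_sumr !big_seq; apply: ler_sum => l.
    rewrite mem_filter /P /= => /andP[lP _].
    have -> : 2 * (eta / r) = 2 * eta / r by rewrite mulrA.
    apply: poisson_scale_le => //.
    have [l1|l1] := leP l al.
      by rewrite -(sqrrN (l - x)) opprB ler_sqr ?nnegrE; move: r0 lx l1; lra.
    move: lP; rewrite l1 /= -leNgt => l2.
    by rewrite ler_sqr ?nnegrE; move: r0 xh l2; lra.
  have f4 : poisson_sum eta s x = poisson_sum eta s2 x + poisson_sum eta (seq.filter (predC P) s) x.
    by rewrite /poisson_sum !big_filter (bigID P).
  rewrite /K; rewrite f4 in f1; move: f1 f3; lra.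
have h2 : N * (Rint al be g - 2 * r * G - theta * (be - al) - 2 * (eta / r) * C * (be - al)) <=
    Rint (al + r) (be - r) (fun x => N * (g x + - K)).
  rewrite RintZ// ler_pM2l// RintD; [|exact: continuous_onW g_cont|exact: continuous_on_cst].
  rewrite Rint_cst; last exact: ltW.
  have lo2 : lo <= al by move: r0 lo_al; lra.
  have hi2 : be <= hi by move: r0 be_hi; lra.
  rewrite (@Rint_split _ al be (al + r)); [| | |exact: continuous_onW g_cont]; first last.
  - by move: r0 ab; lra.
  - by move: r0; lra.
  rewrite (@Rint_split _ (al + r) be (be - r)); [| | |exact: continuous_onW g_cont]; first last.
  - by move: r0; lra.
  - exact: ltW.
  have [_ b1] := @Rint_bounds al (al + r) ltac:(by move: r0; lra) lo2 ltac:(by move: ab hi1; lra).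
  have [_ b2] := @Rint_bounds (be - r) be ltac:(by move: r0; lra) ltac:(by move: ab lo1; lra) hi2.
  have K0 : 0 <= K.
    apply: addr_ge0 => //; apply: mulr_ge0 => //.
    by apply: mulr_ge0 => //; exact: divr_ge0 (ltW eta0) (ltW r0).
  have := mulr_ge0 K0 (ltW r0).
  have : K * (be - al) = theta * (be - al) + 2 * (eta / r) * C * (be - al) by rewrite /K mulrDl.
  move: b1 b2; lra.
apply: le_trans h2 (le_trans h1 _); rewrite Rint_poisson_sum//.
rewrite -size_filter -/s2 -sum_cst_seq.
apply: ler_sum => l _.
by have := atan_ltpi2 ((be - r - l) / eta); have := atan_gtNpi2 ((al + r - l) / eta); lra.
Qed.

(** The bound on [m] itself implied by [count_upper] turns the loss
    [2 * (eta / r)] per point into an additive error. *)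
Lemma count_close (m : nat) :
  (count (fun l => (al < l < be)%R) s <= m)%N -> (m <= count (fun l => (al <= l <= be)%R) s)%N ->
  `|m%:R * pi - N * Rint al be g| <=
  N * (be - al) * (2 * theta + 2 * (r / (be - al)) * G + 2 * (eta / r) * (C + 2 * G + 2)).
Proof.
move=> m1 m2; set L := be - al.
have L0 : 0 < L by rewrite /L subr_gt0.
have q0 : 0 < eta / r by exact: divr_gt0.
have q1 : 2 * (eta / r) <= 1 by rewrite mulrA ler_pdivrMr// mul1r.
have pi2 : 2 <= pi :> R by exact: pi_ge2.
have m1' : (count (fun l => al < l < be) s)%:R * pi <= m%:R * pi :> R.
  by apply: ler_wpM2r; [exact: pi_ge0|rewrite ler_nat].
have m2' : m%:R * (pi - 2 * (eta / r)) <=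
   (count (fun l => al <= l <= be) s)%:R * (pi - 2 * (eta / r)) :> R.
  by apply: ler_wpM2r; [move: q1 pi2; lra|rewrite ler_nat].
have up := le_trans m2' count_upper; have low := le_trans count_lower m1'.
have rG : 2 * (r / L) * G * L = 2 * r * G by field; rewrite gt_eqF.
set Ig := Rint al be g in up low *.
have [I0 IG] : 0 <= Ig /\ Ig <= G * L.
  by apply: Rint_bounds; rewrite ?(ltW al_be)//; move: r0 lo_al be_hi; lra.
rewrite -/L in up low; set q := eta / r in q0 q1 up low *.
have r0L : 4 * r <= L by [].
have rGL : 2 * r * G <= G * L by have := ler_wpM2l G0 r0L; have := mulr_ge0 G0 (ltW r0); lra.
have tL : theta * L <= L by rewrite ler_piMl// ltW.
have tr : theta * r <= r by rewrite ler_piMl// ltW.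
have tr' : theta * (4 * r) <= theta * L by exact: ler_wpM2l.
have bd : Ig + 2 * r * G + theta * (L + 2 * r) <= (2 * G + 2) * L by move: tL tr r0L IG rGL; lra.
have mN : m%:R <= N * ((2 * G + 2) * L).
  apply: (@le_trans _ _ (m%:R * (pi - 2 * q))); first by rewrite ler_peMr//; move: q1 pi2; lra.
  by apply: le_trans up _; rewrite ler_pM2l.
have E : N * L * (2 * theta + 2 * (r / L) * G + 2 * q * (C + 2 * G + 2)) =
   N * (2 * (theta * L) + 2 * r * G + 2 * q * C * L) + 2 * q * (N * ((2 * G + 2) * L)).
  by rewrite -rG; ring.
rewrite E ler_norml; apply/andP; split.
  have h0 : 0 <= 2 * q * (N * ((2 * G + 2) * L)).
    apply: mulr_ge0; first by apply: mulr_ge0 => //; exact: ltW.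
    by apply: le_trans mN; exact: ler0n.
  have h1 : 0 <= N * (theta * L) by apply: mulr_ge0 (ltW N0) (mulr_ge0 theta0 (ltW L0)).
  move: low h0 h1; lra.
have h1 : m%:R * (2 * q) <= N * ((2 * G + 2) * L) * (2 * q).
  by apply: ler_wpM2r mN; apply: mulr_ge0 => //; exact: ltW.
have h2 : 0 <= N * (2 * q * C * L).
  apply: mulr_ge0 (ltW N0) (mulr_ge0 (mulr_ge0 _ C0) (ltW L0)).
  by apply: mulr_ge0 => //; exact: ltW.
have h3 : N * (theta * (4 * r)) <= N * (theta * L) by rewrite ler_pM2l.
have h4 : 0 <= N * (theta * r) by apply: mulr_ge0 (ltW N0) (mulr_ge0 theta0 (ltW r0)).
move: up h1 h2 h3 h4; lra.
Qed.

End counting.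

(** * Stability of the limiting equation *)
Section stability.
Variable R : realType.
Local Notation C := R[i].
Local Open Scope sesquilinear_scope.
Implicit Types (y eps x : R).

(** In the bulk this is [pi * y] times the limiting density, and the imaginary
    part of the limiting transform on the real axis. *)
Definition mp_shape y x : R := Num.sqrt ((MP_b y - x) * (x - MP_a y)) / (2 * x).

Lemma MP_a_ge0 y : 0 <= MP_a y. Proof. exact: sqr_ge0. Qed.

Lemma MP_b_le4 y : y <= 1 -> MP_b y <= 4.
Proof.
move=> y1; have s1 : Num.sqrt y <= 1 by rewrite -sqrtr1 ler_wsqrtr.
have s0 := sqrtr_ge0 y; rewrite /MP_b; nra.
Qed.

Lemma MP_edges y : 0 <= y ->
  MP_b y + MP_a y = 2 * (1 + y) /\ MP_b y * MP_a y = (1 - y) ^+ 2.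
Proof.
move=> y0; have h : Num.sqrt y ^+ 2 = y by exact: sqr_sqrtr.
split; rewrite /MP_a /MP_b.
  by transitivity (2 * (1 + Num.sqrt y ^+ 2)); [ring|rewrite h].
by transitivity ((1 - Num.sqrt y ^+ 2) ^+ 2); [ring|rewrite h].
Qed.

Lemma bulk_nonempty_ratio y eps x : 0 <= eps -> 0 <= y ->
  MP_a y + eps <= x -> x <= MP_b y - eps -> eps ^+ 2 / 4 <= y.
Proof.
move=> e0 y0 ax xb; have h : eps <= 2 * Num.sqrt y.
  have : MP_b y - MP_a y = 4 * Num.sqrt y by rewrite /MP_a /MP_b; ring.
  lra.
have h2 : eps ^+ 2 <= (2 * Num.sqrt y) ^+ 2 by rewrite ler_sqr ?nnegrE// (le_trans e0 h).
rewrite exprMn sqr_sqrtr// in h2; lra.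
Qed.

Lemma bulk_sqrt_ge y eps x : 0 <= eps ->
  MP_a y + eps <= x -> x <= MP_b y - eps ->
  eps <= Num.sqrt ((MP_b y - x) * (x - MP_a y)).
Proof.
move=> e0 ax xb; rewrite -[leLHS](ger0_norm e0) -sqrtr_sqr ler_wsqrtr// expr2.
by apply: ler_pM => //; lra.
Qed.

(** The two exact solutions at the real point [E] are complex conjugates;
    [0 <= Im v] keeps [v] away from the one in the lower half-plane. *)
Lemma mp_stability y eps e1 (E eta : R) (v : C) :
  0 < eps -> 0 < y -> y <= 1 -> MP_a y + eps <= E -> E <= MP_b y - eps -> 0 < eta ->
  0 <= complex.Im v -> cmod v <= 11 -> cmod (mp_residual y (Complex E eta) v) <= e1 ->
  `|complex.Im (v / Complex E eta) - mp_shape y E| <= (2 * e1 + 26 * eta) / eps ^+ 2.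
Proof.
move=> e0 y0 y1 aE Eb eta0 Iv v11 res; set z := Complex E eta in res *.
have [hs hp] := MP_edges (ltW y0).
set sq := Num.sqrt ((MP_b y - E) * (E - MP_a y)).
have sqe : eps <= sq by exact: bulk_sqrt_ge (ltW e0) aE Eb.
have sq2 : sq ^+ 2 = 4 * E - (E + 1 - y) ^+ 2.
  rewrite sqr_sqrtr; last by apply: mulr_ge0; move: aE Eb e0; lra.
  have -> : (MP_b y - E) * (E - MP_a y) = (MP_b y + MP_a y) * E - E ^+ 2 - MP_b y * MP_a y by ring.
  by rewrite hs hp; ring.
have Ee : eps <= E by have := MP_a_ge0 y; lra.
have E0 : 0 < E by exact: lt_le_trans Ee.
have E4 : E <= 4 by have := MP_b_le4 y1; lra.
pose v0 : C := Complex (- (E + 1 - y) / 2) (sq / 2).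
have fact : (v - v0) * (v - v0^*) = mp_residual y z v - 'i%C * (eta%:C)%C * (v + 1).
  have hh : (sq / 2) ^+ 2 = E - ((E + 1 - y) / 2) ^+ 2.
    by rewrite exprMn sq2; field.
  rewrite /mp_residual /v0 /z; case: (v) => a b; apply/eqP; rewrite eq_complex /=.
  apply/andP; split; apply/eqP; last by field.
  transitivity (a * a - b * b + (E + 1 - y) * a + ((E + 1 - y) / 2) ^+ 2 + (sq / 2) ^+ 2); first by field.
  by rewrite hh; field.
have far : eps / 2 <= cmod (v - v0^*).
  apply: le_trans (le_trans (ler_norm _) (Im_le_cmod _)).
  by rewrite ImD ImN ImJ opprK /=; lra.
have eta_c : cmod ('i%C * (eta%:C)%C * (v + 1)) <= 12 * eta.
  rewrite !cmodM cmod_pos ?(ltW eta0)//.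
  have -> : cmod ('i%C : C) = 1 by rewrite /cmod /sqn /= expr0n expr1n add0r sqrtr1.
  have h : cmod (v + 1) <= 12 by have := cmodD_le v 1; rewrite cmod1; lra.
  by rewrite mul1r mulrC; apply: ler_wpM2r => //; exact: ltW.
have close : cmod (v - v0) * (eps / 2) <= e1 + 12 * eta.
  apply: (@le_trans _ _ (cmod (v - v0) * cmod (v - v0^*))); first by rewrite ler_wpM2l ?cmod_ge0.
  rewrite -cmodM fact; apply: le_trans (cmodB_le _ _) _; exact: lerD.
have v0c : cmod v0 <= 2.
  apply: cmod_le_sqn => //; rewrite /sqn /=.
  have -> : (- (E + 1 - y) / 2) ^+ 2 + (sq / 2) ^+ 2 = ((E + 1 - y) ^+ 2 + sq ^+ 2) / 4 by field.
  by rewrite sq2; lra.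
have zE : E <= cmod z by exact: le_trans (ler_norm _) (Re_le_cmod z).
have zn : z != 0 by rewrite -cmod_gt0 (lt_le_trans E0).
have EC : (E%:C)%C != 0 :> C by rewrite -cmod_gt0 cmod_pos ?(ltW E0).
have shape : mp_shape y E = complex.Im (v0 * (E%:C)%C^-1).
  have -> : (E%:C)%C^-1 = (E^-1%:C)%C :> C by rewrite -fmorphV.
  rewrite ImM Re_real Im_real mulr0 add0r /mp_shape -/sq /=.
  by field; rewrite gt_eqF.
rewrite shape -ImN -ImD; apply: le_trans (Im_le_cmod _) _.
have -> : v / z - v0 * (E%:C)%C^-1 = (v - v0) / z + v0 * (((E%:C)%C - z) / (z * (E%:C)%C)).
  by field; rewrite zn EC.
apply: le_trans (cmodD_le _ _) _; rewrite !cmodM !cmodV cmodM (cmod_pos (ltW E0)).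
have -> : cmod ((E%:C)%C - z) = eta.
  by rewrite /cmod /sqn /z /= subrr expr0n add0r sub0r sqrrN sqrtr_sqr ger0_norm// ltW.
have p1 : cmod (v - v0) / cmod z <= (2 * e1 + 24 * eta) / eps ^+ 2.
  have h1 : cmod (v - v0) <= (2 * e1 + 24 * eta) / eps by rewrite ler_pdivlMr//; lra.
  have -> : (2 * e1 + 24 * eta) / eps ^+ 2 = (2 * e1 + 24 * eta) / eps * eps^-1.
    by field; rewrite gt_eqF.
  apply: ler_pM => //; rewrite ?cmod_ge0 ?invr_ge0 ?cmod_ge0//.
  by rewrite lef_pV2 ?posrE ?(lt_le_trans E0 zE)// (le_trans Ee zE).
have p2 : cmod v0 * (eta / (cmod z * E)) <= 2 * (eta / eps ^+ 2).
  apply: ler_pM => //; rewrite ?cmod_ge0//.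
    apply: divr_ge0 (ltW eta0) _; apply: mulr_ge0 (cmod_ge0 _) (ltW E0).
  apply: ler_wpM2l; first exact: ltW.
  have c0 : 0 < cmod z by exact: lt_le_trans zE.
  rewrite lef_pV2 ?posrE ?exprn_gt0// ?mulr_gt0// expr2.
  by apply: ler_pM => //; rewrite ?(ltW e0)//; exact: le_trans zE.
have -> : (2 * e1 + 26 * eta) / eps ^+ 2 = (2 * e1 + 24 * eta) / eps ^+ 2 + 2 * (eta / eps ^+ 2).
  by ring.
exact: lerD p1 p2.
Qed.

Lemma Im_inv (u : C) : complex.Im u^-1 = - complex.Im u / sqn u.
Proof. by case: u => a b; rewrite /sqn /= mulNr. Qed.

Lemma Im_cauchy_kernel (l : R) (z : C) :
  complex.Im ((l%:C)%C - z)^-1 = poisson (complex.Im z) (l - complex.Re z).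
Proof. by rewrite Im_inv /poisson /sqn ImD ReD ImN ReN Im_real Re_real add0r opprK sqrrN. Qed.

Lemma Im_stieltjes n (W : 'M[C]_n) (z : C) : W^t* = W -> complex.Im z != 0 ->
  complex.Im (stieltjes W z) = n%:R^-1 * poisson_sum (complex.Im z) (evals W) (complex.Re z).
Proof.
move=> hW z0; rewrite stieltjesE// ImM Re_real Im_real mul0r addr0 Im_sum.
by congr (_ * _); apply: eq_bigr => l _; rewrite Im_cauchy_kernel.
Qed.

(** Since [z / (l - z) = l / (l - z) - 1], this follows from the nonnegativity of
    the spectrum. *)
Lemma Im_z_stieltjes_ge0 p n (M : 'M[C]_(p, n)) (z : C) : 0 < complex.Im z ->
  0 <= complex.Im (z * stieltjes (sample_covariance M) z).
Proof.
move=> z0; have hW := sample_covariance_herm M.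
rewrite stieltjesE ?gt_eqF// mulrCA ImM Re_real Im_real mul0r addr0.
apply: mulr_ge0; first by rewrite invr_ge0.
rewrite mulr_sumr Im_sum big_seq; apply: sumr_ge0 => l lW.
have l0 := covariance_evals_ge0 lW.
have n1 : (l%:C)%C - z != 0 by rewrite -cmod_gt0 (lt_le_trans z0)// real_sub_cmod_ge.
have -> : z * ((l%:C)%C - z)^-1 = (l%:C)%C * ((l%:C)%C - z)^-1 - 1 by field.
rewrite ImD ImN /= oppr0 addr0 ImM Re_real Im_real mul0r addr0 Im_cauchy_kernel.
by rewrite mulr_ge0// poisson_ge0// ltW.
Qed.

(** The imaginary part of the transform at [E + i * eta] is the Poisson sum at
    [E]. The first bound uses only [cmod v <= 11]; it serves at the coarse scale. *)
Lemma poisson_sum_close p n (M : 'M[C]_(p, n)) y eps e1 (E eta : R) :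
  (0 < n)%N -> 0 < eps -> 0 < y -> y <= 1 ->
  MP_a y + eps <= E -> E <= MP_b y - eps -> 0 < eta ->
  let z := Complex E eta in let v := z * stieltjes (sample_covariance M) z in
  cmod v <= 11 ->
  (poisson_sum eta (evals (sample_covariance M)) E <= n%:R * (11 / eps)) /\
  (cmod (mp_residual y z v) <= e1 ->
   `|poisson_sum eta (evals (sample_covariance M)) E - n%:R * mp_shape y E| <=
     n%:R * ((2 * e1 + 26 * eta) / eps ^+ 2)).
Proof.
move=> n0 e0 y0 y1 aE Eb eta0 z v v11.
have hW := sample_covariance_herm M.
have N0 : 0 < n%:R :> R by rewrite ltr0n.
have z0 : complex.Im z != 0 by rewrite gt_eqF.
have := Im_stieltjes hW z0; rewrite /= => /(congr1 ( *%R n%:R)).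
rewrite mulVKf ?gt_eqF//.
set m := stieltjes _ _ in v v11 *; move=> <-.
have zE : eps <= cmod z.
  by have := MP_a_ge0 y; have := le_trans (ler_norm _) (Re_le_cmod z); rewrite /=; lra.
have zn : z != 0 by rewrite -cmod_gt0 (lt_le_trans e0).
have mE : m = v / z by rewrite /v mulrAC divff ?mul1r.
split.
  rewrite ler_pM2l//; apply: le_trans (le_trans (ler_norm _) (Im_le_cmod _)) _.
  rewrite mE cmodM cmodV; apply: ler_pM; rewrite ?cmod_ge0 ?invr_ge0 ?cmod_ge0//.
  by rewrite lef_pV2// posrE ?cmod_gt0.
move=> res; rewrite -mulrBr normrM (ger0_norm (ltW N0)) ler_pM2l// mE.
by apply: mp_stability => //; exact: Im_z_stieltjes_ge0.
Qed.

End stability.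

(** * Discretization of the entries *)
Section nets.
Variable R : realType.
Local Notation C := R[i].

Lemma measurable_truncn_gt (K d : R) (k : nat) : 0 < d ->
  measurable [set x : R | (k < Num.truncn ((x + K) / d))%N].
Proof.
move=> d0; rewrite (_ : [set x | _] = `[k.+1%:R * d - K, +oo[%classic); first exact: measurable_itv.
apply/seteqP; split => x /=; rewrite truncn_gt_nat ler_pdivlMr// in_itv /= andbT; lra.
Qed.

Lemma measurable_truncn_eq (K d : R) (k : nat) : 0 < d ->
  measurable [set x : R | Num.truncn ((x + K) / d) = k].
Proof.
move=> d0; case: k => [|k].
  rewrite (_ : [set x | _] = ~` [set x : R | (0 < Num.truncn ((x + K) / d))%N]).
    by apply: measurableC; exact: measurable_truncn_gt.
  by apply/seteqP; split => x /=; [move=> ->|move/negP; rewrite -eqn0Ngt => /eqP].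
rewrite (_ : [set x | _] = [set x : R | (k < Num.truncn ((x + K) / d))%N] `\`
   [set x : R | (k.+1 < Num.truncn ((x + K) / d))%N]).
  by apply: measurableD; exact: measurable_truncn_gt.
apply/seteqP; split => x /=; first by move=> ->; rewrite ltnSn ltnn.
by move=> [h1 /negP]; rewrite -leqNgt => h2; apply/eqP; rewrite eqn_leq h1 h2.
Qed.

Lemma real_net (K d : R) : 0 <= K -> 0 < d ->
  exists N (f : R -> 'I_N.+1) (c : 'I_N.+1 -> R),
    (forall a, measurable (f @^-1` [set a])) /\
    (forall x, `|x| <= K -> `|c (f x) - x| <= d).
Proof.
move=> K0 d0; pose N := Num.truncn ((K + K) / d).
exists N, (fun x => inord (Num.truncn ((x + K) / d))), (fun a => a%:R * d - K); split.
  move=> a; rewrite (_ : _ @^-1` _ =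
    \bigcup_(k in [set k : nat | inord k = a :> 'I_N.+1]) [set x : R | Num.truncn ((x + K) / d) = k]).
    by apply: bigcup_measurable => k _; exact: measurable_truncn_eq.
  apply/seteqP; split => x /=; first by move=> h; exists (Num.truncn ((x + K) / d)).
  by move=> [k /= <- ->].
move=> x; rewrite ler_norml => /andP[x1 x2].
have u0 : 0 <= (x + K) / d by apply: divr_ge0 (ltW d0); lra.
rewrite inordK; last by rewrite ltnS; apply: le_truncn; rewrite ler_pM2r ?invr_gt0//; lra.
have /andP[t1 t2] := truncn_itv u0.
rewrite -(ler_pM2r d0) divfK ?gt_eqF// in t1.
rewrite -(ltr_pM2r d0) divfK ?gt_eqF// -natr1 mulrDl mul1r in t2.
by rewrite ler_norml; apply/andP; split; lra.
Qed.

Lemma borelC_open (A : set C^o) : open A -> measurable (A : set (borelC R)).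
Proof. by move=> oA; apply: sub_sigma_algebra. Qed.

Lemma cmod_open (A : set C^o) :
  (forall u, A u -> exists2 e : R, 0 < e & forall v, cmod (u - v) < e -> A v) -> open A.
Proof.
move=> h; rewrite openE => u Au; have [e e0 he] := h u Au.
apply/nbhs_ballP; exists (e%:C)%C => /=; first by rewrite ltcR.
move=> v; rewrite /ball /= => uv; apply: he.
move: uv; rewrite normc_def ltcR; congr (_ < _).
Qed.

Lemma measurable_Re : measurable_fun setT (@complex.Re R : borelC R -> R).
Proof.
apply: (measurability _ (RGenOInfty.measurableE R)) => _ [_ [x ->] <-].
rewrite setTI; apply: borelC_open; apply: cmod_open => u /=.
rewrite in_itv /= andbT => xu; exists (complex.Re u - x); first by lra.
move=> v uv; rewrite in_itv /= andbT.
have := le_lt_trans (le_trans (ler_norm _) (Re_le_cmod (u - v))) uv.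
by rewrite ReD ReN; lra.
Qed.

Lemma measurable_Im : measurable_fun setT (@complex.Im R : borelC R -> R).
Proof.
apply: (measurability _ (RGenOInfty.measurableE R)) => _ [_ [x ->] <-].
rewrite setTI; apply: borelC_open; apply: cmod_open => u /=.
rewrite in_itv /= andbT => xu; exists (complex.Im u - x); first by lra.
move=> v uv; rewrite in_itv /= andbT.
have := le_lt_trans (le_trans (ler_norm _) (Im_le_cmod (u - v))) uv.
by rewrite ImD ImN; lra.
Qed.

Lemma measurable_sqn : measurable_fun setT (@sqn R : borelC R -> R).
Proof.
apply: measurable_funD; apply: measurable_funX; [exact: measurable_Re|exact: measurable_Im].
Qed.

(** A finite Borel partition of the disc of radius [K] into small cells, with a
    representative of modulus at most [B] for every cell. *)
Lemma complex_net (K d B : R) : 0 <= K -> 0 < d -> K + 2 * d <= B ->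
  exists (V : finType) (f : C -> V) (c : V -> C),
  [/\ forall v, measurable (f @^-1` [set v] : set (borelC R)),
      forall v, cmod (c v) <= B &
      forall u, cmod u <= K -> cmod (c (f u) - u) <= 2 * d].
Proof.
move=> K0 d0 KB; have [N [f [c [mf cf]]]] := real_net K0 d0.
pose c0 (v : 'I_N.+1 * 'I_N.+1) : C := Complex (c v.1) (c v.2).
exists ('I_N.+1 * 'I_N.+1)%type, (fun u => (f (complex.Re u), f (complex.Im u))),
  (fun v => if cmod (c0 v) <= B then c0 v else 0); split.
- move=> [a b].
  rewrite (_ : _ @^-1` _ = (@complex.Re R : borelC R -> R) @^-1` (f @^-1` [set a]) `&`
                           (@complex.Im R : borelC R -> R) @^-1` (f @^-1` [set b])).
    apply: measurableI.
      by rewrite -[X in measurable X]setTI; exact: (measurable_Re measurableT (mf a)).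
    by rewrite -[X in measurable X]setTI; exact: (measurable_Im measurableT (mf b)).
  by apply/seteqP; split => u /=; [case=> -> ->|move=> [-> ->]].
- (* A cell whose centre has modulus above [B] does not meet the disc; [0] is
     only a default there. *)
  move=> v; case: ifP => // _; rewrite /cmod sqn0 sqrtr0.
  by apply: le_trans KB; lra.
- move=> u uK.
  have h : cmod (c0 (f (complex.Re u), f (complex.Im u)) - u) <= 2 * d.
    apply: le_trans (cmod_le_ReIm _) _; rewrite ReD ImD ReN ImN /= mulrDl mul1r.
    apply: lerD; apply: cf; apply: le_trans uK; [exact: Re_le_cmod|exact: Im_le_cmod].
  case: ifP => // /negP; case; apply: le_trans KB.
  rewrite -[c0 _](subrK u); apply: le_trans (cmodD_le _ _) _; lra.
Qed.

End nets.

Section discretized_expectation.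
Context (d : measure_display) (T : measurableType d) (R : realType) (P : probability T R).
Local Open Scope ereal_scope.

(** The integrability of [Y] is a consequence: [Y] differs from [Z] by a function
    bounded almost everywhere. *)
Lemma integral_ae_close (Y Z : T -> R) (c : R) :
  measurable_fun setT Y -> P.-integrable setT (EFin \o Z) -> (0 <= c)%R ->
  {ae P, forall t, (`|Y t - Z t| <= c)%R} ->
  (`| fine (\int[P]_t (Y t)%:E)%E - fine (\int[P]_t (Z t)%:E)%E | <= c)%R.
Proof.
move=> mY iZ c0 YZ.
have mZ : measurable_fun setT Z by have /measurable_int/measurable_EFinP := iZ.
pose D t := (Y t - Z t)%R.
have mD : measurable_fun setT D by exact: measurable_funB.
have aD : \int[P]_t `|(D t)%:E| <= c%:E.
  have -> : c%:E = \int[P]_t (cst c%:E) t.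
    by rewrite integral_cst//= probability_setT mule1.
  apply: ae_ge0_le_integral => //.
  - by apply: measurableT_comp => //; exact/measurable_EFinP.
  - by move: YZ; apply: filterS => t h _; rewrite /= lee_fin.
have iD : P.-integrable setT (EFin \o D).
  apply/integrableP; split; first exact/measurable_EFinP.
  by apply: le_lt_trans aD _; rewrite ltry.
have iY : P.-integrable setT (EFin \o Y).
  rewrite (_ : EFin \o Y = (EFin \o D) \+ (EFin \o Z)); first exact: integrableD.
  by apply/funext => t /=; rewrite -EFinD /D subrK.
have E : (fine (\int[P]_t (Y t)%:E) - fine (\int[P]_t (Z t)%:E))%R = fine (\int[P]_t (D t)%:E).
  have := @RintegralB _ _ _ P setT Y Z measurableT iY iZ.
  by rewrite /Rintegral => <-.
rewrite E -lee_fin.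
have fD : \int[P]_t (D t)%:E \is a fin_num by exact: integrable_fin_num.
apply: le_trans aD; rewrite -fine_abse//.
rewrite fineK; last by rewrite fin_num_abs abse_id -fin_num_abs.
by apply: le_abse_integral => //; exact/measurable_EFinP.
Qed.

Lemma finite_valued_integral (V : finType) (S : V -> set T) (F : T -> V) (h : V -> R) :
  (forall v, S v = F @^-1` [set v]) -> (forall v, measurable (S v)) ->
  P.-integrable setT (EFin \o (h \o F)) /\
  (fine (\int[P]_t (h (F t))%:E) = \sum_v fine (P (S v)) * h v)%R.
Proof.
move=> SF mS.
have iS v : P.-integrable setT (EFin \o (fun t => h v * \1_(S v) t)%R).
  rewrite (_ : EFin \o _ = (fun t => (h v)%:E * (EFin \o \1_(S v)) t)); last first.
    by apply/funext => t /=; rewrite EFinM.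
  by apply: integrableZl => //; exact: integrable_indic.
have hE t : (h (F t))%:E = \sum_(v <- index_enum V) (EFin \o (fun t => h v * \1_(S v) t)%R) t.
  rewrite /= sumEFin; congr EFin; rewrite (bigD1 (F t))//=.
  rewrite big1 ?addr0 => [|v vF]; rewrite indicE SF.
    by rewrite mem_set ?mulr1.
  by rewrite memNset ?mulr0// => /= /eqP; rewrite eq_sym (negbTE vF).
split.
  rewrite (_ : EFin \o (h \o F) =
     fun t => \sum_(v <- index_enum V) (EFin \o (fun t => h v * \1_(S v) t)%R) t).
    exact: integrable_sum.
  by apply/funext => t; exact: hE.
under eq_integral do rewrite hE.
rewrite integral_sum//.
have E v : \int[P]_t (EFin \o (fun t => h v * \1_(S v) t)%R) t = (fine (P (S v)) * h v)%R%:E.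
  rewrite (_ : (fun t => _) = (fun t => (h v)%:E * (EFin \o \1_(S v)) t)); last first.
    by apply/funext => t /=; rewrite EFinM.
  rewrite integralZl//; last exact: integrable_indic.
  rewrite integral_indic// setIT muleC EFinM fineK//.
  by rewrite fin_num_measure.
by under eq_bigr do rewrite E; rewrite sumEFin.
Qed.

End discretized_expectation.

Section entry.
Context (d : measure_display) (T : measurableType d) (R : realType) (P : probability T R).
Local Notation C := R[i].
Variables (X : T -> C) (K e : R) (V : finType) (f : C -> V) (c : V -> C).
Hypotheses (mX : complex_rv X) (bX : K_bounded P K X) (EX : cexpectation P X = 0)
  (VX : cvariance P X = 1%E).
Hypotheses (K1 : 1 <= K) (e0 : 0 < e) (Ke : 20 * K * e <= 1).
Hypotheses (mf : forall v, measurable (f @^-1` [set v] : set (borelC R)))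
  (c_le : forall v, cmod (c v) <= 2 * K)
  (f_acc : forall u, cmod u <= K -> cmod (c (f u) - u) <= e).

Let S v : set T := X @^-1` (f @^-1` [set v]).
Definition cell_weight (v : V) : R := fine (P (S v)).
Local Notation w := cell_weight.

Lemma measurable_cell v : measurable (S v).
Proof. by rewrite -[X in measurable X]setTI; apply: mX. Qed.

Lemma measurable_disc : measurable ([set u | cmod u <= K] : set (borelC R)).
Proof.
rewrite (_ : [set u | _] = (@sqn R : borelC R -> R) @^-1` `]-oo, K ^+ 2]%classic).
  by rewrite -[X in measurable X]setTI; exact: measurable_sqn.
have K0 : 0 <= K by apply: le_trans K1.
apply/seteqP; split => u /=; rewrite in_itv /= -cmod_sqr => h.
  by rewrite ler_sqr ?nnegrE ?cmod_ge0.
by rewrite -ler_sqr ?nnegrE ?cmod_ge0.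
Qed.

Lemma bounded_event : P (X @^-1` [set u | cmod u <= K]) = 1%E.
Proof.
move: bX; rewrite /K_bounded => <-; congr (P _); apply/seteqP; split => t /=; by rewrite cmodE.
Qed.

Lemma ae_bounded : {ae P, forall t, cmod (X t) <= K}.
Proof.
have mA : measurable (X @^-1` [set u | cmod u <= K]).
  by rewrite -[X in measurable X]setTI; apply: mX => //; exact: measurable_disc.
exists (~` (X @^-1` [set u | cmod u <= K])); split => //.
  exact: measurableC.
by rewrite [LHS]probability_setC// bounded_event subee.
Qed.

Lemma cell_weight_ge0 v : 0 <= w v. Proof. exact: fine_ge0. Qed.

Lemma finite_law (h : V -> R) :
  P.-integrable setT (EFin \o (h \o (f \o X))) /\
  fine (\int[P]_t (h (f (X t)))%:E)%E = \sum_v w v * h v.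
Proof. exact: (@finite_valued_integral _ _ _ P V S (f \o X) h (fun=> erefl) measurable_cell). Qed.

Lemma cell_weight_sum : \sum_v w v = 1.
Proof.
have [_] := finite_law (fun=> 1); rewrite integral_cst//= probability_setT mule1 /= => ->.
by apply: eq_bigr => v _; rewrite mulr1.
Qed.

Lemma finite_law_close (g : C -> R) (b : R) :
  measurable_fun setT (g : borelC R -> R) -> 0 <= b ->
  (forall u, cmod u <= K -> `|g u - g (c (f u))| <= b) ->
  `|fine (\int[P]_t (g (X t))%:E)%E - \sum_v w v * g (c v)| <= b.
Proof.
move=> mg b0 gb; have [iZ <-] := finite_law (g \o c).
apply: (integral_ae_close _ iZ b0); first exact: (measurableT_comp mg).
by apply: filterS ae_bounded => t Xt /=; exact: gb.
Qed.

Let mr : R := \sum_v w v * complex.Re (c v).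
Let mi : R := \sum_v w v * complex.Im (c v).
Let s2 : R := \sum_v w v * sqn (c v).

Lemma mesh_small : [/\ 1 <= K, 0 < e, e <= K * e & 20 * (K * e) <= 1].
Proof.
split=> //; last by rewrite mulrA.
by have := ler_wpM2r (ltW e0) K1; rewrite mul1r.
Qed.

Lemma mean_Re_le : `|mr| <= e.
Proof.
have := @finite_law_close (@complex.Re R) e (@measurable_Re R) (ltW e0).
have -> : fine (\int[P]_t (complex.Re (X t))%:E)%E = 0.
  by move: EX; rewrite /cexpectation unlock => /(congr1 (@complex.Re R)).
rewrite sub0r normrN; apply => u uK; rewrite -ReN -ReD.
by apply: le_trans (Re_le_cmod _) _; rewrite cmodBC; exact: f_acc.
Qed.

Lemma mean_Im_le : `|mi| <= e.
Proof.
have := @finite_law_close (@complex.Im R) e (@measurable_Im R) (ltW e0).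
have -> : fine (\int[P]_t (complex.Im (X t))%:E)%E = 0.
  by move: EX; rewrite /cexpectation unlock => /(congr1 (@complex.Im R)).
rewrite sub0r normrN; apply => u uK; rewrite -ImN -ImD.
by apply: le_trans (Im_le_cmod _) _; rewrite cmodBC; exact: f_acc.
Qed.

Lemma second_moment_close : `|s2 - 1| <= 3 * K * e.
Proof.
have K0 : 0 <= K by apply: le_trans K1.
have b0 : 0 <= 3 * K * e by apply: mulr_ge0 (ltW e0); exact: mulr_ge0.
have := @finite_law_close (@sqn R) (3 * K * e) (@measurable_sqn R) b0.
have -> : fine (\int[P]_t (sqn (X t))%:E)%E = 1.
  move: VX; rewrite /cvariance EX unlock => /(congr1 fine) /= <-.
  congr fine; apply: eq_integral => t _; congr EFin.
  by rewrite subr0 -cmodE cmod_sqr.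
rewrite distrC; apply => u uK; rewrite -!cmod_sqr.
have -> : cmod u ^+ 2 - cmod (c (f u)) ^+ 2 =
  (cmod u + cmod (c (f u))) * (cmod u - cmod (c (f u))) by ring.
rewrite normrM; apply: ler_pM => //.
  rewrite ger0_norm ?addr_ge0 ?cmod_ge0//; have := c_le (f u); lra.
apply: le_trans (f_acc uK); rewrite ler_norml; apply/andP; split.
  by have := cmodB_ge (c (f u)) u; lra.
by rewrite cmodBC; exact: cmodB_ge.
Qed.

Let m : C := Complex mr mi.

Lemma cmod_mean_le : cmod m <= 2 * e.
Proof.
apply: le_trans (cmod_le_ReIm _) _ => /=; have := mean_Re_le; have := mean_Im_le; lra.
Qed.

Let v2 : R := \sum_v w v * sqn (c v - m).

Lemma variance_close : `|v2 - 1| <= 5 * K * e.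
Proof.
have -> : v2 = s2 - sqn m.
  transitivity (\sum_v (w v * sqn (c v) + w v * complex.Re (c v) * (- 2 * mr) +
                        w v * complex.Im (c v) * (- 2 * mi) + w v * sqn m)).
    apply: eq_bigr => v _; rewrite /sqn ReD ImD ReN ImN /=; ring.
  rewrite !big_split /= -!mulr_suml cell_weight_sum -/s2 -/mr -/mi /sqn /=; ring.
have h1 := second_moment_close; have h2 : sqn m <= 2 * K * e.
  rewrite -cmod_sqr expr2; apply: (@le_trans _ _ (2 * e * 1)).
    apply: ler_pM; rewrite ?cmod_ge0//; first exact: cmod_mean_le.
    by apply: le_trans cmod_mean_le _; have [_ _ eK Ke'] := mesh_small; lra.
  by have [_ _ eK Ke'] := mesh_small; lra.
have h3 := sqn_ge0 m.
by move: h1; rewrite !ler_norml => /andP[a b]; apply/andP; split; lra.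
Qed.

Let iota : R := (Num.sqrt v2)^-1.

Lemma variance_bounds : 3 / 4 <= v2 <= 5 / 4.
Proof.
have [_ _ eK Ke'] := mesh_small.
by have := variance_close; rewrite ler_norml => /andP[a b]; apply/andP; split; lra.
Qed.

Lemma scale_close : 0 < iota /\ iota <= 2 /\ `|iota - 1| <= 10 * K * e.
Proof.
have /andP[a b] := variance_bounds.
have v0 : 0 <= v2 by lra.
set s := Num.sqrt v2.
have ss : s ^+ 2 = v2 by exact: sqr_sqrtr.
have s0 : 0 <= s by exact: sqrtr_ge0.
have sh : 1 / 2 <= s by rewrite leNgt; apply/negP => h; nra.
have sp : 0 < s by lra.
have i2 : iota <= 2 by rewrite /iota -/s -[s^-1]mul1r ler_pdivrMr//; lra.
split; first by rewrite invr_gt0.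
split=> //.
have -> : iota - 1 = iota * ((1 - v2) / (1 + s)).
  rewrite -ss /iota -/s; field; rewrite (gt_eqF sp) gt_eqF//; lra.
have i0 : 0 <= iota by rewrite invr_ge0.
rewrite normrM (ger0_norm i0).
have -> : 10 * K * e = 2 * (5 * K * e) by ring.
apply: ler_pM => //; rewrite normrM; apply: le_trans variance_close.
have s1 : 0 < 1 + s by lra.
have s2' : (1 + s)^-1 <= 1 by rewrite invf_le1// lerDl.
rewrite distrC; apply: ler_piMr => //; rewrite ger0_norm//.
by rewrite invr_ge0 ltW.
Qed.

(** Rounding to the cells changes the first two moments slightly; an affine
    correction restores mean [0] and variance [1] exactly. *)
Definition cell_value (v : V) : C := (iota%:C)%C * (c v - m).

Lemma entry_normalized :
  [/\ \sum_v w v * complex.Re (cell_value v) = 0,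
      \sum_v w v * complex.Im (cell_value v) = 0,
      \sum_v w v * sqn (cell_value v) = 1,
      forall v, sqn (cell_value v) <= 36 * K ^+ 2 &
      forall u, cmod u <= K -> cmod (cell_value (f u) - u) <= 33 * K ^+ 2 * e].
Proof.
have [i0 [i2 i1]] := scale_close.
have [K1' e0' eK Ke'] := mesh_small.
have cm v : cmod (c v - m) <= 3 * K.
  by apply: le_trans (cmodB_le _ _) _; have := c_le v; have := cmod_mean_le; lra.
split.
- transitivity (iota * (\sum_v w v * complex.Re (c v) - (\sum_v w v) * mr)).
    rewrite mulr_suml -sumrB mulr_sumr; apply: eq_bigr => v _.
    rewrite /cell_value ReM Re_real Im_real ReD ReN /=; ring.
  by rewrite cell_weight_sum -/mr mul1r subrr mulr0.
- transitivity (iota * (\sum_v w v * complex.Im (c v) - (\sum_v w v) * mi)).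
    rewrite mulr_suml -sumrB mulr_sumr; apply: eq_bigr => v _.
    rewrite /cell_value ImM Re_real Im_real ImD ImN /=; ring.
  by rewrite cell_weight_sum -/mi mul1r subrr mulr0.
- transitivity (iota ^+ 2 * v2).
    rewrite mulr_sumr; apply: eq_bigr => v _.
    by rewrite /cell_value sqnM sqn_real mulrCA.
  have /andP[a b] := variance_bounds.
  rewrite /iota exprVn sqr_sqrtr; last by lra.
  by rewrite mulVf// gt_eqF//; lra.
- move=> v; rewrite -cmod_sqr.
  have -> : 36 * K ^+ 2 = (2 * (3 * K)) ^+ 2 by ring.
  have K0 : 0 <= 2 * (3 * K) by lra.
  rewrite ler_sqr ?nnegrE ?cmod_ge0// /cell_value cmodM cmod_pos ?(ltW i0)//.
  by apply: ler_pM => //; rewrite ?cmod_ge0// ltW.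
- move=> u uK.
  have -> : cell_value (f u) - u = ((iota - 1)%:C)%C * (c (f u) - m) - m + (c (f u) - u).
    by rewrite /cell_value rmorphB /=; ring.
  apply: le_trans (cmodD_le _ _) _.
  have h1 : cmod (((iota - 1)%:C)%C * (c (f u) - m)) <= 10 * K * e * (3 * K).
    by rewrite cmodM cmod_real; apply: ler_pM; rewrite ?cmod_ge0.
  have h2 := cmodB_le (((iota - 1)%:C)%C * (c (f u) - m)) m.
  have h3 := cmod_mean_le; have h4 := f_acc uK.
  have h5 : e <= K ^+ 2 * e by apply: ler_peMl; rewrite ?(ltW e0)// exprn_ege1.
  have -> : 33 * K ^+ 2 * e = 10 * K * e * (3 * K) + 3 * (K ^+ 2 * e) by ring.
  lra.
Qed.

End entry.

Section joint_discretization.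
Context (d : measure_display) (T : measurableType d) (R : realType) (P : probability T R).
Local Notation C := R[i].
Variables (p n : nat) (M : T -> 'M[C]_(p, n)) (K : R).
Hypotheses (mM : forall i j, complex_rv (fun t => M t i j))
  (indep : independent_rvs P (fun (ij : 'I_p * 'I_n) t => M t ij.1 ij.2))
  (bM : forall i j, K_bounded P K (fun t => M t i j))
  (EM : forall i j, cexpectation P (fun t => M t i j) = 0)
  (VM : forall i j, cvariance P (fun t => M t i j) = 1%E).
Hypothesis K1 : 1 <= K.

Section transfer.
Variables (V : finType) (f : C -> V).
Hypothesis mf : forall v, measurable (f @^-1` [set v] : set (borelC R)).
Local Notation w := (fun k i => cell_weight P (fun t => M t k i) f).
Local Notation sampleT := {ffun 'I_p -> {ffun 'I_n -> V}}.

Definition discretized (t : T) : sampleT := [ffun k => [ffun i => f (M t k i)]].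

Let cell (o : sampleT) : set T :=
  \bigcap_(ij in [set: 'I_p * 'I_n]) (fun t => M t ij.1 ij.2) @^-1` (f @^-1` [set o ij.1 ij.2]).

Lemma cellE o : cell o = discretized @^-1` [set o].
Proof.
apply/seteqP; split => t /=.
  move=> h; apply/ffunP => k; apply/ffunP => i; rewrite !ffunE.
  exact: (h (k, i) I).
by move=> <- [k i] _ /=; rewrite !ffunE.
Qed.

Lemma measurable_sample_cell o : measurable (cell o).
Proof.
apply: fin_bigcap_measurable => [|[k i] _]; first exact: finite_finset.
exact: (measurable_cell (mM k i) mf).
Qed.

(** Independence makes the law of the discretized matrix a product. *)
Lemma cell_probability o : fine (P (cell o)) = \prod_k row_weight w k (o k).
Proof.
rewrite /cell indep => [|ij]; last exact: mf.
have E (ij : 'I_p * 'I_n) : P ((fun t => M t ij.1 ij.2) @^-1` (f @^-1` [set o ij.1 ij.2])) =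
    (w ij.1 ij.2 (o ij.1 ij.2))%:E.
  rewrite /cell_weight fineK// fin_num_measure//.
  exact: (measurable_cell (mM ij.1 ij.2) mf).
rewrite (eq_bigr _ (fun ij _ => E ij)) prodEFin /= /row_weight.
by rewrite (pair_bigA _ (fun k i => w k i (o k i))).
Qed.

Lemma discretized_probability (bad : pred sampleT) :
  measurable [set t | bad (discretized t)] /\
  P [set t | bad (discretized t)] = (fexp (row_weight w) (fun o => (bad o)%:R))%:E.
Proof.
have [iB EB] := @finite_valued_integral _ _ _ P _ cell discretized
   (fun o => (bad o)%:R) cellE measurable_sample_cell.
set A := [set t | _].
have hA : (fun o : sampleT => (bad o)%:R) \o discretized = \1_A :> (T -> R).
  by apply/funext => t /=; rewrite indicE /A; case: (boolP (bad _)) => h;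
     [rewrite mem_set|rewrite memNset//=; exact/negP].
have mA : measurable A.
  have /measurable_int/measurable_EFinP mh := iB.
  have -> : A = ((fun o : sampleT => (bad o)%:R) \o discretized) @^-1` [set 1 : R].
    apply/seteqP; split => t /=; rewrite /A /=; first by move=> ->.
    by case: (bad _) => //= /esym/eqP; rewrite oner_eq0.
  by rewrite -[X in measurable X]setTI; exact: mh.
split=> //.
have -> : fexp (row_weight w) (fun o => (bad o)%:R) = fine (\int[P]_t (bad (discretized t))%:R%:E)%E.
  rewrite EB /fexp; apply: eq_bigr => o _; congr (_ * _).
  by rewrite cell_probability.
have -> : (\int[P]_t (bad (discretized t))%:R%:E)%E = P A.
  transitivity (\int[P]_t (\1_A t)%:E)%E; last by rewrite integral_indic// setIT.
  by apply: eq_integral => t _; rewrite -hA.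
by rewrite fineK// fin_num_measure.
Qed.

(** The null set on which some entry exceeds [K] is removed together with the
    bad event. *)
Lemma transfer (bad : pred sampleT) (q : R) :
  fexp (row_weight w) (fun o => (bad o)%:R) <= q ->
  exists2 A : set T, measurable A & ((1 - q)%:E <= P A)%E /\
    forall t, A t -> ~~ bad (discretized t) /\ forall k i, cmod (M t k i) <= K.
Proof.
move=> hq; have [mB PB] := discretized_probability bad.
set B := [set t | bad (discretized t)] in mB PB.
pose A0 : set T := \bigcap_(ij in [set: 'I_p * 'I_n])
   (fun t => M t ij.1 ij.2) @^-1` [set u | cmod u <= K].
have mA0 : measurable A0.
  apply: fin_bigcap_measurable => [|[k i] _]; first exact: finite_finset.
  by rewrite -[X in measurable X]setTI; apply: mM => //; exact: measurable_disc.
have PA0 : P A0 = 1%E.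
  rewrite /A0 indep => [|ij]; last exact: measurable_disc.
  by apply: big1 => ij _; exact: bounded_event.
exists (A0 `&` ~` B); first by apply: measurableI => //; exact: measurableC.
split; last first.
  move=> t [h1 h2]; split; last by move=> k i; exact: (h1 (k, i) I).
  exact/negP.
have -> : A0 `&` ~` B = ~` (~` A0 `|` B) by rewrite setCU setCK.
have mU : measurable (~` A0 `|` B) by apply: measurableU => //; exact: measurableC.
rewrite probability_setC//.
have hU : (P (~` A0 `|` B) <= q%:E)%E.
  apply: (@le_trans _ _ (P (~` A0) + P B)%E).
    by apply: measureU2 => //; exact: measurableC.
  by rewrite probability_setC// PA0 subee// add0e PB lee_fin.
by rewrite EFinB leeB.
Qed.

End transfer.

(** A product space on which the independent entries have mean [0] and variance
    [1] exactly, coupled with [M] up to an error [s] in every entry. *)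
Lemma discretization (s : R) : 0 < s -> s <= 1 ->
  exists (V : finType) (w : 'I_p -> 'I_n -> V -> R) (x : 'I_p -> 'I_n -> V -> C),
  [/\ (forall k, prob_weights (w k)),
      (forall k i, \sum_v w k i v * complex.Re (x k i v) = 0),
      (forall k i, \sum_v w k i v * complex.Im (x k i v) = 0),
      (forall k i, \sum_v w k i v * sqn (x k i v) = 1) &
      (forall k i v, sqn (x k i v) <= 36 * K ^+ 2)] /\
  forall (bad : pred {ffun 'I_p -> {ffun 'I_n -> V}}) (q : R),
    fexp (row_weight w) (fun o => (bad o)%:R) <= q ->
    exists2 A : set T, measurable A & ((1 - q)%:E <= P A)%E /\
      forall t, A t -> (forall k i, cmod (M t k i) <= K) /\
        exists2 o, ~~ bad o & forall k i, cmod (sample_matrix x o k i - M t k i) <= s.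
Proof.
move=> s0 s1.
have K0 : 0 < K by apply: lt_le_trans K1.
pose e := s / (66 * K ^+ 2).
have KK : 0 < 66 * K ^+ 2 by rewrite mulr_gt0// exprn_gt0.
have e0 : 0 < e by exact: divr_gt0.
have eE : 66 * K ^+ 2 * e = s by rewrite /e mulrCA divff ?mulr1// gt_eqF.
have K2 : K <= K ^+ 2 by rewrite expr2 ler_peMl// ltW.
have Ke : 20 * K * e <= 1.
  by have := ler_wpM2r (ltW e0) K2; rewrite -mulrA; move: eE s1; rewrite -mulrA; lra.
have e2 : 0 < e / 2 by rewrite divr_gt0.
have KB : K + 2 * (e / 2) <= 2 * K.
  by have := ler_wpM2r (ltW e0) K1; move: Ke K1; rewrite -mulrA; lra.
have [V [f [c [mf cB acc]]]] := complex_net (ltW K0) e2 KB.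
have acc' u : cmod u <= K -> cmod (c (f u) - u) <= e.
  by move=> uK; have := acc u uK; rewrite mulrCA divff ?mulr1// pnatr_eq0.
have en k i := entry_normalized (mM k i) (bM k i) (EM k i) (VM k i) K1 e0 Ke mf cB acc'.
pose x k i := cell_value P (fun t => M t k i) f c.
exists V, (fun k i => cell_weight P (fun t => M t k i) f), x; split.
  split=> [k i|k i|k i|k i|k i].
  - split; first by move=> v; exact: cell_weight_ge0.
    exact: (cell_weight_sum P (mM k i) mf).
  - by have [] := en k i.
  - by have [] := en k i.
  - by have [] := en k i.
  - by have [] := en k i.
move=> bad q hq; have [A mA [PA hA]] := transfer mf hq.
exists A => //; split=> // t At; have [hb hK] := hA t At; split=> //.
exists (discretized f t) => // k i; rewrite mxE !ffunE.
have [_ _ _ _ h] := en k i; apply: le_trans (h _ (hK k i)) _.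
have h0 : 0 <= K ^+ 2 * e by rewrite mulr_ge0 ?sqr_ge0 ?ltW.
move: eE; rewrite -!mulrA; lra.
Qed.

End joint_discretization.

(** * From the grid and the discretized matrix to all points *)
Section perturbation.
Variable R : realType.
Local Notation C := R[i].
Local Open Scope sesquilinear_scope.

Lemma resolvent_entry_cmod n (W : 'M[C]_n) z i j : W^t* = W -> 0 < complex.Im z ->
  cmod (resolvent W z i j) <= (complex.Im z)^-1.
Proof.
move=> hW z0; apply: cmod_le_sqn; first by rewrite invr_ge0 ltW.
by rewrite exprVn; apply: resolvent_entry_le; rewrite ?gt_eqF.
Qed.

Lemma stieltjes_perturbation n (W W' : 'M[C]_n) z (s : R) :
  W^t* = W -> W'^t* = W' -> 0 < complex.Im z -> 0 <= s ->
  (forall i j, cmod (W' i j - W i j) <= s) ->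
  cmod (stieltjes W z - stieltjes W' z) <= n%:R ^+ 2 * s / complex.Im z ^+ 2.
Proof.
move=> hW hW' z0 s0 WW'; set e := complex.Im z in z0 *.
have z0' : complex.Im z != 0 by rewrite gt_eqF.
set G := resolvent W z; set G' := resolvent W' z.
have GG : G - G' = G *m (W' - W) *m G'.
  have -> : W' - W = (W' - z%:M) - (W - z%:M) by rewrite opprB addrA subrK.
  rewrite mulmxBr mulmxBl -[G *m _ *m G']mulmxA mul_resolvent// mulmx1.
  by rewrite resolvent_mul// mul1mx.
rewrite /stieltjes -/G -/G' -mulrBr -linearB /= GG cmodM cmod_pos ?invr_ge0//.
have [n0|n0] := posnP n.
  have -> : n%:R = 0 :> R by rewrite n0.
  by rewrite invr0 mul0r expr0n mul0r mul0r.
have N0 : 0 < n%:R :> R by rewrite ltr0n.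
have b : cmod (\tr (G *m (W' - W) *m G')) <= \sum_(i < n) \sum_(j < n) \sum_(k < n) (e^-1 * s * e^-1).
  apply: le_trans (cmod_sum_le _ _ _) _; apply: ler_sum => i _.
  rewrite mxE; apply: le_trans (cmod_sum_le _ _ _) _; apply: ler_sum => j _.
  rewrite mxE mulr_suml; apply: le_trans (cmod_sum_le _ _ _) _; apply: ler_sum => k _.
  rewrite !cmodM; apply: ler_pM; rewrite ?mulr_ge0 ?cmod_ge0 ?resolvent_entry_cmod//.
  apply: ler_pM; rewrite ?cmod_ge0 ?resolvent_entry_cmod//.
  by have := WW' k j; rewrite !mxE.
rewrite ler_pdivrMl//; apply: le_trans b _.
rewrite !sumr_const !card_ord -!mulrnA -[X in X <= _]mulr_natl !natrM.
rewrite le_eqVlt; apply/orP; left; apply/eqP.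
by field; rewrite gt_eqF.
Qed.

Lemma sample_covariance_perturbation p n (M M' : 'M[C]_(p, n)) (K s : R) :
  (0 < n)%N -> (p <= n)%N -> 0 <= K -> 0 <= s ->
  (forall k i, cmod (M k i) <= K) -> (forall k i, sqn (M' k i) <= 36 * K ^+ 2) ->
  (forall k i, cmod (M' k i - M k i) <= s) ->
  forall i j, cmod (sample_covariance M' i j - sample_covariance M i j) <= 7 * K * s.
Proof.
move=> n0 pn K0 s0 hM hM' hd i j.
have hM6 k l : cmod (M' k l) <= 6 * K.
  apply: cmod_le_sqn; first by rewrite mulr_ge0.
  by rewrite exprMn (_ : 6 ^+ 2 = 36)// -natrX.
have N0 : 0 < n%:R :> R by rewrite ltr0n.
rewrite /sample_covariance invnE [X in cmod (X - _)]mxE [X in cmod (_ - X)]mxE -mulrBr.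
rewrite cmodM cmod_pos ?invr_ge0// ler_pdivrMl// !mxE -sumrB.
apply: le_trans (cmod_sum_le _ _ _) _.
apply: (@le_trans _ _ (\sum_(k < p) (7 * K * s))); last first.
  rewrite sumr_const card_ord -[_ *+ p]mulr_natl; apply: ler_wpM2r.
    by apply: mulr_ge0 s0; exact: mulr_ge0.
  by rewrite ler_nat.
apply: ler_sum => k _; rewrite !mxE.
have -> : (M' k i)^* * M' k j - (M k i)^* * M k j =
   (M' k i)^* * (M' k j - M k j) + (M' k i - M k i)^* * M k j.
  by rewrite rmorphB /=; ring.
apply: le_trans (cmodD_le _ _) _; rewrite !cmodM.
have cJ u : cmod (u^*) = cmod u :> R by rewrite /cmod sqnJ.
rewrite !cJ.
have h1 : cmod (M' k i) * cmod (M' k j - M k j) <= 6 * K * s by apply: ler_pM; rewrite ?cmod_ge0.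
have h2 : cmod (M' k i - M k i) * cmod (M k j) <= s * K by apply: ler_pM; rewrite ?cmod_ge0.
have -> : 7 * K * s = 6 * K * s + s * K by ring.
exact: lerD.
Qed.

Lemma residual_perturbation (y e n : R) (z z' v v' : C) :
  0 <= y -> y <= 1 -> 1 <= n -> cmod z <= 8 ->
  cmod (z - z') <= 2 / n -> cmod (v - v') <= 26 / n -> 26 <= n -> cmod v' <= 10 ->
  cmod (mp_residual y z' v') <= e ->
  cmod v <= 11 /\ cmod (mp_residual y z v) <= e + 1000 / n.
Proof.
move=> y0 y1 n1 z8 dz dv n26 v10 res.
have n0 : 0 < n by lra.
have v26 : 26 / n <= 1 by rewrite ler_pdivrMr// mul1r.
have v11 : cmod v <= 11 by have := cmodD_le v' (v - v'); rewrite addrC subrK; lra.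
split=> //.
have -> : mp_residual y z v = mp_residual y z' v' + ((v - v') * (v + v' + (z + 1 - (y%:C)%C))
   + (z - z') * (v' + 1)) by rewrite /mp_residual; ring.
apply: le_trans (cmodD_le _ _) _; apply: lerD => //.
apply: le_trans (cmodD_le _ _) _; rewrite !cmodM.
have h1 : cmod (v + v' + (z + 1 - (y%:C)%C)) <= 30.
  apply: le_trans (cmodD_le _ _) _; have := cmodD_le v v'.
  have -> : z + 1 - (y%:C)%C = z + ((1 - y)%:C)%C by rewrite rmorphB /=; ring.
  have := cmodD_le z ((1 - y)%:C)%C; rewrite cmod_pos; lra.
have h2 : cmod (v' + 1) <= 11 by have := cmodD_le v' 1; rewrite cmod1; lra.
have h3 : cmod (v - v') * cmod (v + v' + (z + 1 - (y%:C)%C)) <= 26 / n * 30.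
  by apply: ler_pM; rewrite ?cmod_ge0.
have h4 : cmod (z - z') * cmod (v' + 1) <= 2 / n * 11 by apply: ler_pM; rewrite ?cmod_ge0.
have ni : 0 < n^-1 by rewrite invr_gt0.
lra.
Qed.

(** Moving a point to the grid and [M] to [M'] costs a multiple of [1 / n] in the
    residual: the transform is Lipschitz with constant [n ^+ 2] at these heights,
    and the mesh and the coupling error are smaller powers of [n^-1]. *)
Lemma local_law_everywhere p n (M M' : 'M[C]_(p, n)) (K h y e1 tau eta0 : R) :
  (26 <= n)%N -> (p <= n)%N -> 1 <= K ->
  (forall k i, cmod (M k i) <= K) -> (forall k i, sqn (M' k i) <= 36 * K ^+ 2) ->
  (forall k i, cmod (M' k i - M k i) <= (7 * K * n%:R ^+ 5)^-1) ->
  0 < h -> h <= 1 -> 0 < y -> y <= 1 -> e1 <= 1 -> e1 <= y * (h / 2) / 2 -> tau <= 1 ->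
  let t := tau * (2 * (11 / (h / 2)) + 5) in let c := y * (h / 2) / 384 in
  2 * t <= c -> `|p%:R / n%:R - y| * 11 + 8 * (2 * t / c) <= e1 ->
  10 / n%:R <= y * (h / 2) / 48 -> 2 / n%:R <= h ->
  0 < eta0 -> (n%:R * eta0)^-1 <= tau -> grid_good eta0 tau M' ->
  forall E eta, h <= E -> E <= 4 -> eta0 <= eta -> eta < 4 ->
  let z := Complex E eta in let v := z * stieltjes (sample_covariance M) z in
  cmod v <= 11 /\ cmod (mp_residual y z v) <= e1 + 1000 / n%:R.
Proof.
move=> n26 pn K1 hM hM' hd h0 h1 y0 y1 e1_1 e1y tau1 t c tc te nl nh eta0_gt0 ne good E eta hE E4 eeta eta4 z v.
have n0 : (0 < n)%N by apply: leq_trans n26.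
have n9 : (9 <= n)%N by apply: leq_trans n26.
have h20 : 0 < h / 2 by exact: divr_gt0.
have h24 : h / 2 <= 4 by rewrite ler_pdivrMr//; apply: le_trans h1 _; rewrite -natrM ler1n.
have law := @grid_local_law R p n M' (h / 2) y e1 tau n0 pn h20 y0 y1 e1_1 e1y tau1
  tc te nl n9 h24 eta0 eta0_gt0 ne.
clear tc te nl e1y e1_1 h20 h24; clear t c.
have N0 : 0 < n%:R :> R by rewrite ltr0n.
have N1 : 1 <= n%:R :> R by rewrite ler1n.
have N3 : 0 < n%:R ^+ 3 :> R by rewrite exprn_gt0.
have E0 : 0 <= E by apply: le_trans (ltW h0) hE.
have eta_gt0 : 0 < eta by exact: lt_le_trans eeta.
(* The height is rounded up, so that the grid point stays above [eta0]. *)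
pose a := Num.truncn (E * n%:R ^+ 3); pose b := (Num.truncn (eta * n%:R ^+ 3)).+1.
have /andP[a1 a2] : a%:R <= E * n%:R ^+ 3 < a.+1%:R.
  by apply: truncn_itv; rewrite mulr_ge0// ltW.
have /andP[b1 b2] : b.-1%:R <= eta * n%:R ^+ 3 < b%:R.
  by apply: truncn_itv; rewrite mulr_ge0// ltW.
have a4 : (a <= 4 * n ^ 3)%N.
  rewrite -(ler_nat R) natrM natrX; apply: le_trans a1 _.
  by rewrite ler_pM2r.
have b4 : (b <= 4 * n ^ 3)%N.
  rewrite -(ltr_nat R) natrM natrX; apply: le_lt_trans b1 _.
  by rewrite ltr_pM2r.
set z' := grid_pt R n a b.
have n3n : (n%:R ^+ 3)^-1 <= n%:R^-1 :> R.
  by rewrite lef_pV2 ?posrE// -[leLHS]expr1 ler_weXn2l.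
have dRe : `|E - complex.Re z'| <= (n%:R ^+ 3)^-1.
  have h2 : complex.Re z' <= E by rewrite /= ler_pdivrMr.
  have h3 : E < complex.Re z' + (n%:R ^+ 3)^-1.
    by rewrite /= -[X in _ + X]mul1r -mulrDl natr1 ltr_pdivlMr.
  by rewrite ger0_norm; clear -h2 h3; lra.
have dIm : `|eta - complex.Im z'| <= (n%:R ^+ 3)^-1.
  have h2 : eta <= complex.Im z' by rewrite /= ler_pdivlMr// ltW.
  have h3 : complex.Im z' <= eta + (n%:R ^+ 3)^-1.
    rewrite /= -[b%:R]natr1 ler_pdivrMr// mulrDl mulVf ?gt_eqF// lerD2r//.
  by rewrite ler0_norm; clear -h2 h3; lra.
have etab : eta <= complex.Im z' by rewrite /= ler_pdivlMr// ltW.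
have eb : eta0 <= complex.Im z' by exact: le_trans etab.
have dz : cmod (z - z') <= 2 * (n%:R ^+ 3)^-1.
  apply: le_trans (cmod_le_ReIm _) _; rewrite ReD ImD ReN ImN /=; move: dRe dIm; rewrite /=; clear; lra.
have Re_a : complex.Re (grid_pt R n a 0) = complex.Re z' by [].
have Re_ge : h / 2 <= complex.Re z'.
  move: dRe; rewrite ler_norml => /andP[_ dR]; clear -dR n3n nh hE; lra.
have Re_le : complex.Re z' <= 4.
  by apply: le_trans E4; rewrite /= ler_pdivrMr.
have [res' v10 _] := law a Re_ge Re_le (fun b0 eb0 b04 => good a b0 a4 b04 eb0) b b4 eb.
clear law good.
rewrite -/z' in res' v10.
have ninv u : eta0 <= u -> u^-1 <= n%:R.
  move=> hu; have u0 : 0 < u by exact: lt_le_trans hu.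
  have : (n%:R * u)^-1 <= 1.
    apply: le_trans tau1; apply: le_trans ne.
    by rewrite lef_pV2 ?posrE ?mulr_gt0// ler_pM2l.
  by rewrite invf_le1 ?mulr_gt0// => hh; rewrite -[leLHS]mul1r ler_pdivrMr.
have Iz' : 0 < complex.Im z' by exact: lt_le_trans eb.
have Iz : 0 < complex.Im z by [].
have hW := sample_covariance_herm M; have hW' := sample_covariance_herm M'.
have i1 := ninv _ eeta; have i2 := ninv _ eb.
set m := stieltjes (sample_covariance M) z.
set m1 := stieltjes (sample_covariance M) z'.
set m' := stieltjes (sample_covariance M') z' in res' v10.
have dm1 : cmod (m - m1) <= 2 / n%:R.
  apply: le_trans (stieltjes_lipschitz hW Iz Iz') _.
  rewrite -/(complex.Im z) invfM.
  have -> : 2 / n%:R = 2 * (n%:R ^+ 3)^-1 * (n%:R * n%:R) :> R by field; rewrite gt_eqF.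
  apply: ler_pM => //; rewrite ?cmod_ge0//.
    by apply: mulr_ge0; rewrite invr_ge0 ltW.
  by apply: ler_pM => //; rewrite invr_ge0 ltW.
have dm2 : cmod (m1 - m') <= 1 / n%:R.
  have K0 : 0 < K by exact: lt_le_trans K1.
  pose s : R := (7 * K * n%:R ^+ 5)^-1.
  have s0 : 0 <= s.
    by rewrite invr_ge0; apply: mulr_ge0; [apply: mulr_ge0 (ltW K0)|exact: exprn_ge0].
  have pert := sample_covariance_perturbation n0 pn (ltW K0) s0 hM hM' hd.
  have ks0 : 0 <= 7 * K * s by apply: mulr_ge0 s0; apply: mulr_ge0 (ltW K0).
  apply: le_trans (stieltjes_perturbation hW hW' Iz' ks0 pert) _.
  have -> : 1 / n%:R = n%:R ^+ 2 * (7 * K * s) * (n%:R ^+ 2) :> R.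
    by rewrite /s; field; rewrite !gt_eqF.
  rewrite -exprVn; apply: ler_wpM2l; first by rewrite mulr_ge0// exprn_ge0// ltW.
  by rewrite ler_sqr ?nnegrE ?invr_ge0// ltW.
have z8 : cmod z <= 8.
  rewrite (_ : 8 = 4 + 4); last by rewrite -natrD.
  apply: le_trans (cmod_le_ReIm _) _; apply: lerD; rewrite /= ger0_norm//; exact: ltW.
have m'n : cmod m' <= n%:R.
  by apply: le_trans (stieltjes_le hW' Iz') _.
have dv : cmod (v - z' * m') <= 26 / n%:R.
  have -> : v - z' * m' = (z - z') * m' + z * ((m - m1) + (m1 - m')) by rewrite /v -/m; ring.
  apply: le_trans (cmodD_le _ _) _; rewrite [cmod (_ * m')]cmodM [cmod (z * _)]cmodM.
  have h2 : cmod (z - z') * cmod m' <= 2 * (n%:R ^+ 3)^-1 * n%:R by apply: ler_pM; rewrite ?cmod_ge0.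
  have h3 : 2 * (n%:R ^+ 3)^-1 * n%:R <= 2 / n%:R :> R.
    have -> : 2 * (n%:R ^+ 3)^-1 * n%:R = 2 * (n%:R^-1 * n%:R^-1) :> R by field; rewrite gt_eqF.
    rewrite ler_pM2l//; apply: ler_piMl; first by rewrite invr_ge0 ltW.
    by rewrite invf_le1.
  have h4 : cmod z * cmod ((m - m1) + (m1 - m')) <= 8 * (3 / n%:R).
    apply: ler_pM; rewrite ?cmod_ge0//; apply: le_trans (cmodD_le _ _) _.
    rewrite (_ : 3 / n%:R = 2 / n%:R + 1 / n%:R); last by ring.
    exact: lerD.
  rewrite (_ : 26 / n%:R = 2 / n%:R + 8 * (3 / n%:R)); last by ring.
  exact: lerD (le_trans h2 h3) h4.
have dz2 : cmod (z - z') <= 2 / n%:R by apply: le_trans dz _; rewrite ler_pM2l.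
have N26 : 26 <= n%:R :> R by rewrite ler_nat.
exact: residual_perturbation (ltW y0) y1 N1 z8 dz2 dv N26 v10 res'.
Qed.

End perturbation.

(** * The limiting density and the number of eigenvalues *)
Section limiting_density.
Variable R : realType.
Local Notation Rint a b f := (\int[@lebesgue_measure R]_(x in [set` `[a, b]]) f x)%R.
Implicit Types y eps h x al be : R.

Lemma mp_shape_continuous y h : 0 < h ->
  continuous_on (MP_a y + h) (MP_b y - h) (mp_shape y).
Proof.
move=> h0 x ax xb.
have x0 : 0 < x by have := MP_a_ge0 y; lra.
apply: cvgM.
  apply: (@continuous_comp _ _ _ (fun x => (MP_b y - x) * (x - MP_a y)) Num.sqrt); last exact: sqrt_continuous.
  apply: cvgM; apply: cvgB; try exact: cvg_cst; exact: cvg_id.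
apply: cvgV; first by rewrite gt_eqF// mulr_gt0.
by apply: cvgM; [exact: cvg_cst|exact: cvg_id].
Qed.

Lemma mp_shape_bounds y h x : y <= 1 -> 0 < h ->
  MP_a y + h <= x -> x <= MP_b y - h -> h / 8 <= mp_shape y x /\ mp_shape y x <= 2 / h.
Proof.
move=> y1 h0 ax xb; have a0 := MP_a_ge0 y; have b4 := MP_b_le4 y1.
have xh : h <= x by lra.
have x0 : 0 < x by lra.
have s1 := bulk_sqrt_ge (ltW h0) ax xb.
have s2 : Num.sqrt ((MP_b y - x) * (x - MP_a y)) <= 4.
  rewrite -[4](@ger0_norm R)// -sqrtr_sqr ler_wsqrtr// expr2.
  by apply: ler_pM; lra.
rewrite /mp_shape; split.
  apply: ler_pM => //; [exact: ltW|by rewrite lef_pV2 ?posrE//; lra].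
have -> : 2 / h = 4 * (2 * h)^-1 by field; rewrite gt_eqF.
apply: ler_pM; rewrite ?sqrtr_ge0 ?invr_ge0//; first by rewrite mulr_ge0// ltW.
by rewrite lef_pV2 ?posrE ?mulr_gt0// ler_pM2l.
Qed.

Lemma MP_density_shape y x : 0 < y -> MP_a y <= x -> x <= MP_b y ->
  MP_density y x = (pi * y)^-1 * mp_shape y x.
Proof.
move=> y0 ax xb; rewrite /MP_density /mp_shape indicE mem_set/=; last by rewrite in_itv /= ax.
rewrite mulr1; have [->|x0] := eqVneq x 0; first by rewrite !(mulr0, mul0r, invr0).
have pi0 : pi != 0 :> R by rewrite gt_eqF// pi_gt0.
by move: (pi : R) pi0 => c c0; field; rewrite c0 x0 gt_eqF.
Qed.

Lemma Rint_itv_bounds (b1 b2 : bool) al be (f : R -> R) : al <= be ->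
  continuous_on al be f ->
  (\int[@lebesgue_measure R]_(x in [set` Interval (BSide b1 al) (BSide b2 be)]) f x)%R =
  Rint al be f.
Proof.
move=> ab cf; have fi := continuous_on_integrable cf.
have sub c1 c2 : [set` Interval (BSide c1 al) (BSide c2 be)] `<=` [set` `[al, be]].
  by apply: subset_itv; rewrite bnd_simp; case: c1; case: c2.
have fi' c1 c2 : (@lebesgue_measure R).-integrable
    [set` Interval (BSide c1 al) (BSide c2 be)] (EFin \o f).
  by apply: integrableS fi => //; exact: sub.
have h1 : (\int[@lebesgue_measure R]_(x in [set` Interval (BSide b1 al) (BSide b2 be)]) f x)%R =
    (\int[@lebesgue_measure R]_(x in [set` Interval (BSide true al) (BSide b2 be)]) f x)%R.
  by case: b1 => //; rewrite Rintegral_itv_obnd_cbnd.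
by rewrite h1; case: b2 {h1} => //; rewrite Rintegral_itv_bndo_bndc.
Qed.

Lemma MP_mass_shape (b1 b2 : bool) y h al be : 0 < y -> 0 < h -> al <= be ->
  MP_a y + h <= al -> be <= MP_b y - h ->
  MP_mass y (Interval (BSide b1 al) (BSide b2 be)) = (pi * y)^-1 * Rint al be (mp_shape y).
Proof.
move=> y0 h0 ab aal beb.
have cf := continuous_onW aal beb (mp_shape_continuous h0).
rewrite -RintZ// -(Rint_itv_bounds b1 b2 ab); last first.
  by apply: continuous_onM => //; exact: continuous_on_cst.
rewrite /MP_mass; apply: eq_Rintegral => x; rewrite inE => xI.
have : x \in `[al, be] by apply: subset_itv xI; rewrite bnd_simp; case: (b1); case: (b2).
by rewrite in_itv /= => /andP[x1 x2]; apply: MP_density_shape => //; lra.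
Qed.

Lemma interval_in_bounded (I : interval R) (u v : R) :
  [set` I] `<=` `]u, v[%classic -> (0 < lebesgue_measure [set` I])%E ->
  exists b1 b2 al be, [/\ I = Interval (BSide b1 al) (BSide b2 be), al < be, u <= al, be <= v &
    lebesgue_measure [set` I] = (be - al)%:E].
Proof.
move=> sub; rewrite lebesgue_measure_itv; case: ifPn => [+ _|_]; last by rewrite ltxx.
have sub' x : x \in I -> u < x /\ x < v.
  by move=> xI; have := sub x xI; rewrite /= in_itv /= => /andP[].
case: I sub sub' => [[b1 al|b1] [b2 be|b2]] sub sub' //=.
- rewrite lte_fin => ab; exists b1, b2, al, be.
  have inI x : al < x -> x < be -> x \in Interval (BSide b1 al) (BSide b2 be).
    by move=> h1 h2; rewrite in_itv /=; case: (b1); case: (b2); rewrite /= ?h1 ?h2 ?(ltW h1) ?(ltW h2).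
  split=> //.
  + rewrite leNgt; apply/negP => au.
    have [|h1 _] := sub' ((al + Num.min u be) / 2); last first.
    * by move: h1; rewrite ltNge => /negP; apply; case: (leP u be) => h; lra.
    * by apply: inI; case: (leP u be) => h; lra.
  + rewrite leNgt; apply/negP => vb.
    have [|_ h1] := sub' ((be + Num.max v al) / 2); last first.
    * by move: h1; rewrite ltNge => /negP; apply; case: (leP v al) => h; lra.
    * by apply: inI; case: (leP v al) => h; lra.
- case: b2 sub sub' => //= sub sub' _.
  have [|_ h1] := sub' (Num.max (al + 1) v).
    rewrite in_itv /= andbT; have h : al < Num.max (al + 1) v by rewrite lt_max ltrDl ltr01.
    by case: (b1); rewrite /= ?h ?ltW.
  by move: h1; rewrite gt_max ltxx andbF.
- case: b1 sub sub' => //= sub sub' _.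
  have [|h1 _] := sub' (Num.min (be - 1) u).
    rewrite in_itv /=; have h : Num.min (be - 1) u < be by rewrite gt_min ltrBlDr ltrDl ltr01.
    by case: (b2); rewrite /= ?h ?ltW.
  by move: h1; rewrite lt_min ltxx andbF.
- case: b1 b2 sub sub' => [] [] //= sub sub' _.
  by have [_] := sub' v isT; rewrite ltxx.
Qed.

End limiting_density.

Section interval_count.
Variable R : realType.
Local Notation C := R[i].
Local Notation Rint a b f := (\int[@lebesgue_measure R]_(x in [set` `[a, b]]) f x)%R.

(** The local law is used at the two scales [eta] and [r], on a bulk with margin
    [h] smaller than [eps], so that the interval may be enlarged by [r]. *)
Lemma interval_count_close p n (M : 'M[C]_(p, n)) (y eps h e2 eta r delta al be : R) (b1 b2 : bool) :
  (0 < n)%N -> 0 < y -> y <= 1 -> 0 < eps -> eps <= 1 -> h = eps / 2 -> 0 < delta -> 0 <= e2 ->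
  (forall E s, h <= E -> E <= 4 -> eta <= s -> s < 4 ->
    let z := Complex E s in let v := z * stieltjes (sample_covariance M) z in
    cmod v <= 11 /\ cmod (mp_residual y z v) <= e2) ->
  0 < eta -> 2 * eta <= r -> r < 4 -> r <= h -> al < be -> 4 * r <= be - al ->
  MP_a y + eps <= al -> be <= MP_b y - eps ->
  (2 * e2 + 26 * eta) / h ^+ 2 <= 1 ->
  2 * ((2 * e2 + 26 * eta) / h ^+ 2) + 2 * (r / (be - al)) * (2 / h) +
    2 * (eta / r) * (11 / h + 2 * (2 / h) + 2) <= delta * eps / 32 ->
  `|p%:R / n%:R - y| <= delta * y / 4 -> y / 2 <= p%:R / n%:R ->
  `|(eigenvalue_count p (sample_covariance M) (Interval (BSide b1 al) (BSide b2 be)))%:R -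
     p%:R * MP_mass y (Interval (BSide b1 al) (BSide b2 be))| <=
  delta * (p%:R * MP_mass y (Interval (BSide b1 al) (BSide b2 be))).
Proof.
move=> n0 y0 y1 eps0 eps1 hE delta0 e20 law eta0 er r4 rh ab rL aal beb th1 err yp py.
set I := Interval _ _; set W := sample_covariance M in law *.
have h0 : 0 < h by rewrite hE divr_gt0.
have N0 : 0 < n%:R :> R by rewrite ltr0n.
have r0 : 0 < r by apply: lt_le_trans er; rewrite mulr_gt0.
have a0 := MP_a_ge0 y; have b4 := MP_b_le4 y1.
set theta := (2 * e2 + 26 * eta) / h ^+ 2 in th1 err.
have theta0 : 0 <= theta.
  apply: divr_ge0; last exact: sqr_ge0.
  by apply: addr_ge0; apply: mulr_ge0 => //; exact: ltW.
have bulk x : MP_a y + h <= x -> x <= MP_b y - h -> h <= x /\ x <= 4 by move=> h1 h2; split; clear -a0 b4 h0 h1 h2; lra.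
have eta4 : eta < 4 by clear -er r4 eta0; lra.
have fine_scale x : MP_a y + h <= x -> x <= MP_b y - h ->
    `|poisson_sum eta (evals W) x - n%:R * mp_shape y x| <= n%:R * theta.
  move=> x1 x2; have [x3 x4] := bulk x x1 x2.
  have [v11 res] := law x eta x3 x4 (lexx _) eta4.
  by have [_ ] := @poisson_sum_close R p n M y h e2 x eta n0 h0 y0 y1 x1 x2 eta0 v11; apply.
have coarse_scale x : MP_a y + h <= x -> x <= MP_b y - h ->
    poisson_sum r (evals W) x <= n%:R * (11 / h).
  move=> x1 x2; have [x3 x4] := bulk x x1 x2.
  have er' : eta <= r by clear -er eta0; lra.
  have [v11 _] := law x r x3 x4 er' r4.
  by have [h1 _] := @poisson_sum_close R p n M y h e2 x r n0 h0 y0 y1 x1 x2 r0 v11.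
have gb x : MP_a y + h <= x -> x <= MP_b y - h -> 0 <= mp_shape y x /\ mp_shape y x <= 2 / h.
  move=> x1 x2; have [h1 h2] := mp_shape_bounds y1 h0 x1 x2.
  by split=> //; apply: le_trans h1; rewrite divr_ge0// ltW.
have lo_al : MP_a y + h <= al - r by clear -aal rh hE; lra.
have be_hi : be + r <= MP_b y - h by clear -beb rh hE; lra.
have G0 : 0 <= 2 / h :> R by rewrite divr_ge0// ltW.
have C0 : 0 <= 11 / h :> R by rewrite divr_ge0// ltW.
set m := eigenvalue_count p W I.
have cE : m = count (fun l => l \in I) (evals W).
  apply: eigenvalue_countE => l; rewrite in_itv => /andP[+ _].
  by have al0 : 0 < al by [clear -aal a0 eps0; lra]; case: (b1) => /=; [exact: lt_le_trans|exact: lt_trans].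
have c1 : (count (fun l => (al < l < be)%R) (evals W) <= m)%N.
  rewrite cE; apply: sub_count => l /= /andP[l1 l2].
  by rewrite in_itv /=; case: (b1); case: (b2); rewrite /= ?l1 ?l2 ?(ltW l1) ?(ltW l2).
have c2 : (m <= count (fun l => (al <= l <= be)%R) (evals W))%N.
  rewrite cE; apply: sub_count => l /=; rewrite in_itv /= => /andP[].
  by case: (b1); case: (b2) => /= l1 l2; apply/andP; split; rewrite // ltW.
have := @count_close R (evals W) (mp_shape y) n%:R theta (11 / h) (2 / h) eta r
  (MP_a y + h) (MP_b y - h) al be N0 theta0 th1 C0 G0 eta0 r0 er lo_al be_hi rL
  (mp_shape_continuous h0) gb fine_scale coarse_scale m c1 c2.
set Ig := Rint al be (mp_shape y); set L := be - al in rL err *; move=> close.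
have L0 : 0 < L by rewrite /L subr_gt0.
have massE : MP_mass y I = (pi * y)^-1 * Ig by exact: MP_mass_shape eps0 (ltW ab) aal beb.
have pi0 : 0 < pi :> R by exact: pi_gt0.
have IgL : eps / 8 * L <= Ig.
  rewrite /L -Rint_cst; last exact: ltW.
  apply: Rint_le.
  - exact: continuous_on_cst.
  - exact: continuous_onW aal beb (mp_shape_continuous eps0).
  - move=> x x1 x2; have [//] := mp_shape_bounds y1 eps0 (le_trans aal x1) (le_trans x2 beb).
have close2 : `|m%:R * pi - n%:R * Ig| <= n%:R * L * (delta * eps / 32).
  by apply: le_trans close _; apply: ler_wpM2l err; rewrite mulr_ge0// ltW.
have Ig0 : 0 <= Ig by apply: le_trans IgL; rewrite !mulr_ge0// ?invr_ge0// ltW.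
set yn := p%:R / n%:R in yp py.
have pE : p%:R = n%:R * yn :> R by rewrite /yn mulrCA divff ?mulr1// gt_eqF.
rewrite massE pE.
(* Multiply through by [pi * y]. *)
have py0 : 0 < pi * y by exact: mulr_gt0.
rewrite -(ler_pM2l py0) -[X in X * `|_|](ger0_norm (ltW py0)) -normrM.
have -> : pi * y * (m%:R - n%:R * yn * ((pi * y)^-1 * Ig)) =
   y * (m%:R * pi - n%:R * Ig) + (y - yn) * (n%:R * Ig).
  by move: (pi : R) pi0 => c c0; field; rewrite !gt_eqF.
have -> : pi * y * (delta * (n%:R * yn * ((pi * y)^-1 * Ig))) = delta * yn * (n%:R * Ig).
  by move: (pi : R) pi0 => c c0; field; rewrite !gt_eqF.
apply: le_trans (ler_normD _ _) _; rewrite !normrM (ger0_norm (ltW y0)) (distrC y).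
rewrite (ger0_norm (ltW N0)) (ger0_norm Ig0).
have nI0 : 0 <= n%:R * Ig by rewrite mulr_ge0// ltW.
have t1 : y * `|m%:R * pi - n%:R * Ig| <= y * (n%:R * (delta / 4 * Ig)).
  rewrite ler_pM2l//; apply: le_trans close2 _; rewrite -mulrA ler_pM2l//.
  have -> : L * (delta * eps / 32) = delta / 4 * (eps / 8 * L) by field.
  by rewrite ler_pM2l// divr_gt0.
have t2 : `|yn - y| * (n%:R * Ig) <= delta * y / 4 * (n%:R * Ig) by exact: ler_wpM2r.
have t3 : delta * (y / 2) * (n%:R * Ig) <= delta * yn * (n%:R * Ig).
  by apply: ler_wpM2r => //; rewrite ler_pM2l.
apply: le_trans t3; apply: le_trans (lerD t1 t2) _.
by rewrite le_eqVlt; apply/orP; left; apply/eqP; field.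
Qed.

End interval_count.

(** * Choice of the scales *)
Section choice_of_constants.
Variable R : realType.

(** The scales satisfy [eta << rho * eta << L]: the kernels of scale [eta] resolve
    the interval with tails of relative size [rho^-1], and the margins
    [rho * eta] are short compared with its length [L]. *)
Lemma scale_choice (eps delta : R) : 0 < eps -> eps <= 1 -> 0 < delta ->
  let h := eps / 2 in
  exists e1 rho Lam, [/\ 0 < e1, e1 <= h ^+ 3 / 4, 0 < rho, 0 < Lam &
    forall eta L, 0 < eta -> Lam * eta <= L -> L <= 4 ->
    [/\ 2 * eta <= rho * eta, rho * eta <= h, 4 * (rho * eta) <= L,
      (2 * (2 * e1) + 26 * eta) / h ^+ 2 <= 1 &
      2 * ((2 * (2 * e1) + 26 * eta) / h ^+ 2) + 2 * (rho * eta / L) * (2 / h) +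
      2 * (eta / (rho * eta)) * (11 / h + 2 * (2 / h) + 2) <= delta * eps / 32]].
Proof.
move=> eps0 eps1 delta0 h.
have h0 : 0 < h by exact: divr_gt0.
have h1 : h <= 1 / 2 by rewrite /h ler_pM2r.
have de0 : 0 < delta * eps / 128 by exact: divr_gt0 (mulr_gt0 delta0 eps0) (ltr0n _ 128).
pose kap := Num.min 1 (delta * eps / 128).
have k0 : 0 < kap by rewrite lt_min ltr01.
have k1 : kap <= 1 by rewrite ge_min lexx.
have k2 : kap <= delta * eps / 128 by rewrite ge_min lexx orbT.
pose D := 11 / h + 2 * (2 / h) + 2.
have hi0 : 0 < h^-1 by rewrite invr_gt0.
have D0 : 0 < D by rewrite /D; lra.
pose rho := 2 * D / kap + 2.
have rho2 : 2 * D / kap <= rho by rewrite lerDl.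
have q0 : 0 < 2 * D / kap by rewrite divr_gt0// mulr_gt0.
have rho0 : 0 < rho by rewrite /rho; lra.
have h2 : 0 < h ^+ 2 by rewrite exprn_gt0.
pose Lam := 2 * rho * (2 / h) / kap + 4 * rho / h + 416 / (kap * h ^+ 2).
have a1 : 0 < 2 * rho * (2 / h) / kap by rewrite divr_gt0// !mulr_gt0.
have a2 : 0 < 4 * rho / h by rewrite divr_gt0// mulr_gt0.
have p416 : 0 < 416 :> R by rewrite ltr0n.
have a3 : 0 < 416 / (kap * h ^+ 2) by exact: divr_gt0 p416 (mulr_gt0 k0 h2).
have Lam0 : 0 < Lam by rewrite /Lam; clear -a1 a2 a3; lra.
have L1 : 2 * rho * (2 / h) <= kap * Lam.
  by rewrite [leRHS]mulrC -ler_pdivrMr// /Lam; clear -a1 a2 a3; lra.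
have L2 : 4 * rho <= h * Lam.
  by rewrite [leRHS]mulrC -ler_pdivrMr// /Lam; clear -a1 a2 a3; lra.
have L3 : 416 <= kap * h ^+ 2 * Lam.
  by rewrite [leRHS]mulrC -(ler_pdivrMr _ _ (mulr_gt0 k0 h2)) /Lam; clear -a1 a2 a3; lra.
have h3 : h ^+ 3 = h * h ^+ 2 by rewrite exprS.
exists (kap * h ^+ 3 / 16), rho, Lam; split=> //.
- by rewrite divr_gt0// mulr_gt0// exprn_gt0.
- have h3p : 0 < h ^+ 3 by rewrite exprn_gt0.
  have : kap * h ^+ 3 <= h ^+ 3 by rewrite ler_piMl// ltW.
  by move: h3p; clear; lra.
move=> eta L eta0 LL L4.
have Le : Lam * eta <= 4 by exact: le_trans L4.
have L0 : 0 < L by apply: lt_le_trans LL; rewrite mulr_gt0.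
have e26 : 26 * eta / h ^+ 2 <= kap / 4.
  rewrite ler_pdivrMr//.
  have u : 416 * eta <= kap * h ^+ 2 * (Lam * eta) by rewrite [leRHS]mulrA; apply: ler_wpM2r L3; exact: ltW.
  have v : kap * h ^+ 2 * (Lam * eta) <= kap * h ^+ 2 * 4.
    by apply: ler_wpM2l Le; rewrite ltW// mulr_gt0.
  by rewrite mulrAC; clear -u v; lra.
have e4 : 2 * (2 * (kap * h ^+ 3 / 16)) / h ^+ 2 <= kap / 8.
  have -> : 2 * (2 * (kap * h ^+ 3 / 16)) / h ^+ 2 = kap / 4 * h by field; rewrite gt_eqF.
  have -> : kap / 8 = kap / 4 * (1 / 2) by field.
  by rewrite ler_pM2l// divr_gt0.
have th : (2 * (2 * (kap * h ^+ 3 / 16)) + 26 * eta) / h ^+ 2 <= 3 / 8 * kap.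
  by rewrite mulrDl; clear -e26 e4; lra.
split.
- by rewrite ler_pM2r// /rho; clear -q0; lra.
- rewrite -(ler_pM2l (ltr0n R 4 : (0 < 4)%R)) mulrA.
  apply: (@le_trans _ _ (h * Lam * eta)); first by rewrite ler_pM2r.
  by rewrite -mulrA mulrC ler_pM2r.
- apply: le_trans LL; rewrite mulrA ler_pM2r//; apply: le_trans L2 _.
  by apply: ler_piMl; [exact: ltW|clear -h1; lra].
- by apply: le_trans th _; clear -k1; lra.
have t2 : 2 * (rho * eta / L) * (2 / h) <= kap.
  have -> : 2 * (rho * eta / L) * (2 / h) = (2 * rho * (2 / h) * eta) / L.
    by field; rewrite !gt_eqF.
  rewrite ler_pdivrMr//; apply: (@le_trans _ _ (kap * Lam * eta)); first by rewrite ler_pM2r.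
  by rewrite -mulrA ler_pM2l.
have t3 : 2 * (eta / (rho * eta)) * (11 / h + 2 * (2 / h) + 2) <= kap.
  rewrite -/D; have -> : 2 * (eta / (rho * eta)) * D = 2 * D / rho by field; rewrite !gt_eqF.
  by rewrite ler_pdivrMr// [leRHS]mulrC -ler_pdivrMr.
by clear -th t2 t3 k0 k2; lra.
Qed.

(** The lower bound [h ^+ 2] on the ratio makes the choice independent of [y]. *)
Lemma tau_choice (h e1 : R) : 0 < h -> h <= 1 -> 0 < e1 -> e1 <= 1 ->
  exists2 tau, 0 < tau & tau <= 1 /\ forall y, h ^+ 2 <= y ->
    let t := tau * (2 * (11 / (h / 2)) + 5) in let c := y * (h / 2) / 384 in
    2 * t <= c /\ 8 * (2 * t / c) <= e1 / 2.
Proof.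
move=> h0 h1 e0 e1'.
pose D := 2 * (11 / (h / 2)) + 5.
have D5 : 5 <= D by rewrite lerDr mulr_ge0// divr_ge0// divr_ge0// ltW.
have D0 : 0 < D by apply: lt_le_trans D5.
have h3 : 0 < h ^+ 3 by rewrite exprn_gt0.
have h31 : h ^+ 3 <= 1 by rewrite exprn_ile1// ltW.
pose q := e1 * (h ^+ 3 / 768) / 32.
have eh0 : 0 < e1 * h ^+ 3 by exact: mulr_gt0.
have eh1 : e1 * h ^+ 3 <= h ^+ 3 by rewrite ler_piMl// ltW.
have q0 : 0 < q by rewrite /q; lra.
have q1 : q <= 1 by rewrite /q; lra.
have tD : q / D * D = q by rewrite divfK// gt_eqF.
exists (q / D); first exact: divr_gt0.
split; first by rewrite ler_pdivrMr// mul1r; lra.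
move=> y hy t c; rewrite /t -/D tD.
have c0 : h ^+ 3 / 768 <= c.
  have : h ^+ 3 <= y * h by rewrite exprSr ler_pM2r.
  by rewrite /c; clear; lra.
have cp : 0 < c by clear -c0 h3; lra.
rewrite /q; split; first by clear -c0 eh1 h3; lra.
rewrite mulrA ler_pdivrMr//.
have : e1 * (h ^+ 3 / 768) <= e1 * c by rewrite ler_pM2l.
by clear; lra.
Qed.

End choice_of_constants.

(** * The local law for a random matrix *)
Section fixed_size.
Context (d : measure_display) (T : measurableType d) (R : realType) (P : probability T R).
Variables (p n : nat) (K : R) (M : T -> 'M[R[i]]_(p, n)).
Hypotheses (mM : forall i j, complex_rv (fun t => M t i j))
  (indep : independent_rvs P (fun (ij : 'I_p * 'I_n) t => M t ij.1 ij.2))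
  (bM : forall i j, K_bounded P K (fun t => M t i j))
  (EM : forall i j, cexpectation P (fun t => M t i j) = 0)
  (VM : forall i j, cvariance P (fun t => M t i j) = 1%E).

(** The variance [1] is at most [K ^+ 2]. *)
Lemma entry_bound_ge1 (i : 'I_p) (j : 'I_n) : 1 <= K.
Proof.
have mA : measurable [set t | Normc.normc (M t i j) <= K].
  rewrite (_ : [set t | _] = (fun t => M t i j) @^-1` [set u | Normc.normc u <= K])//.
  rewrite -[X in measurable X]setTI; apply: mM => //.
  have [K0|K0] := leP 0 K.
    rewrite (_ : [set u | _] = (@sqn R : borelC R -> R) @^-1` `]-oo, K ^+ 2]%classic).
      by rewrite -[X in measurable X]setTI; exact: measurable_sqn.
    apply/seteqP; split => u /=; rewrite in_itv /= -cmodE -cmod_sqr => h.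
      by rewrite ler_sqr ?nnegrE ?cmod_ge0.
    by rewrite -ler_sqr ?nnegrE ?cmod_ge0.
  rewrite (_ : [set u | _] = set0)//; apply/seteqP; split => u //=.
  by rewrite -cmodE leNgt (lt_le_trans K0 (cmod_ge0 u)).
have ae : {ae P, forall t, Normc.normc (M t i j) <= K}.
  exists (~` [set t | Normc.normc (M t i j) <= K]); split => //; first exact: measurableC.
  by rewrite [LHS]probability_setC// (bM i j) subee.
have h : (1 <= (K ^+ 2)%:E)%E.
  rewrite -(VM i j) /cvariance EM unlock.
  have -> : (K ^+ 2)%:E = (\int[P]_t (cst (K ^+ 2)%:E) t)%E.
    by rewrite integral_cst//= probability_setT mule1.
  apply: ae_ge0_le_integral => //.
  - by move=> t _; rewrite lee_fin sqr_ge0.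
  - apply/measurable_EFinP.
    rewrite (_ : (fun t => _) = (@sqn R : borelC R -> R) \o (fun t => M t i j)).
      exact: (measurableT_comp (@measurable_sqn R) (mM i j)).
    by apply/funext => t /=; rewrite subr0 -cmodE cmod_sqr.
  - by move=> t _; rewrite lee_fin sqr_ge0.
  - apply: filterS ae => t ht _; rewrite lee_fin subr0.
    have h0 : 0 <= Normc.normc (M t i j) by rewrite -cmodE cmod_ge0.
    by rewrite ler_sqr// nnegrE (le_trans h0 ht).
have K0 : 0 <= K.
  rewrite leNgt; apply/negP => K0.
  have := bM i j; rewrite /K_bounded (_ : [set t | _] = set0) ?measure0.
    by move=> /eqP; rewrite eqe eq_sym oner_eq0.
  by apply/seteqP; split => t //=; rewrite -cmodE leNgt (lt_le_trans K0 (cmod_ge0 _)).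
rewrite lee_fin in h; rewrite -[leLHS](expr1n R 2) in h.
by rewrite -(ler_sqr (ler01 : 1 \in Num.nneg)).
Qed.

(** With [eta0] a large multiple of [K ^+ 2 * ln n / n], every deviation has
    probability at most [n `^ (- (C1 + 8))], which the union bound over the grid
    turns into [n `^ (- C1)]. *)
Lemma fixed_size_local_law (C1 h y e1 tau : R) :
  (100 <= n)%N -> (p <= n)%N -> 1 <= K -> 0 < C1 ->
  0 < h -> h <= 1 -> 0 < y -> y <= 1 -> e1 <= 1 -> e1 <= y * (h / 2) / 2 ->
  0 < tau -> tau <= 1 ->
  let t := tau * (2 * (11 / (h / 2)) + 5) in let c := y * (h / 2) / 384 in
  2 * t <= c -> `|p%:R / n%:R - y| * 11 + 8 * (2 * t / c) <= e1 ->
  10 / n%:R <= y * (h / 2) / 48 -> 2 / n%:R <= h ->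
  let eta0 := 768 * (C1 + 8) / tau ^+ 2 * (36 * K ^+ 2) * ln n%:R / n%:R in
  0 < eta0 /\
  exists2 A : set T, measurable A & ((1 - n%:R `^ (- C1))%:E <= P A)%E /\
    forall t, A t -> forall E s, h <= E -> E <= 4 -> eta0 <= s -> s < 4 ->
    let z := Complex E s in let v := z * stieltjes (sample_covariance (M t)) z in
    cmod v <= 11 /\ cmod (mp_residual y z v) <= e1 + 1000 / n%:R.
Proof.
move=> n100 pn K1 C10 h0 h1 y0 y1 e1_1 e1y tau0 tau1 t c tc te nl nh eta0.
have n0 : (0 < n)%N by apply: leq_trans n100.
have N0 : 0 < n%:R :> R by rewrite ltr0n.
have ln1 : 1 <= ln n%:R :> R.
  have n4 : 4 <= n%:R :> R by rewrite ler_nat; exact: leq_trans n100.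
  have e4 := expR_le_quadratic (lexx (1 : R)).
  rewrite -[leLHS](expRK (1 : R)) ler_ln ?posrE ?expR_gt0//.
  by apply: le_trans e4 _; move: n4; lra.
have K0 : 0 < K by exact: lt_le_trans K1.
have K20 : 0 < K ^+ 2 by rewrite exprn_gt0.
have B0 : 0 < 36 * K ^+ 2 by rewrite pmulr_rgt0 ?ltr0n.
have p768 : 0 < 768 :> R by rewrite ltr0n.
have t20 : 0 < tau ^+ 2 by rewrite exprn_gt0.
have C8 : 0 < C1 + 8 by rewrite addr_gt0.
have ln0 : 0 < ln n%:R :> R by exact: lt_le_trans ln1.
have eta0_gt0 : 0 < eta0.
  apply: divr_gt0 N0; apply: mulr_gt0 ln0; apply: mulr_gt0 B0.
  exact: divr_gt0 (mulr_gt0 p768 C8) t20.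
split=> //.
have nE : n%:R * eta0 = 768 * (C1 + 8) / tau ^+ 2 * (36 * K ^+ 2) * ln n%:R.
  by rewrite /eta0 mulrCA divff ?mulr1// gt_eqF.
have ne : (n%:R * eta0)^-1 <= tau.
  have ne0 : 0 < n%:R * eta0 by exact: mulr_gt0.
  have ti0 : 0 < tau^-1 by rewrite invr_gt0.
  rewrite -[leRHS]invrK lef_pV2 ?posrE// nE.
  apply: (@le_trans _ _ (tau ^+ 2)^-1).
    by rewrite lef_pV2 ?posrE// expr2 ler_piMl// ltW.
  have g1 : 1 <= 768 * (C1 + 8).
    by apply: mulr_ege1; [rewrite ler1n|apply: ler_wpDl; [exact: ltW|rewrite ler1n]].
  have g2 : 1 <= 36 * K ^+ 2 by apply: mulr_ege1; [rewrite ler1n|exact: exprn_ege1].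
  have g3 : (tau ^+ 2)^-1 <= 768 * (C1 + 8) / tau ^+ 2 by rewrite ler_peMl// invr_ge0 ltW.
  apply: le_trans g3 _; set A := 768 * _ / _ in nE *.
  have A0 : 0 <= A by exact: divr_ge0 (ltW (mulr_gt0 p768 C8)) (ltW t20).
  by rewrite -[leRHS]mulrA; apply: ler_peMr A0 (mulr_ege1 g2 ln1).
pose s0 : R := (7 * K * n%:R ^+ 5)^-1.
have s0D : 1 <= 7 * K * n%:R ^+ 5.
  rewrite -[leLHS]mulr1; apply: ler_pM => //; last by rewrite exprn_ege1// ler1n.
  by rewrite -[leLHS]mulr1; apply: ler_pM => //; rewrite ler1n.
have s00 : 0 < s0 by rewrite invr_gt0 (lt_le_trans ltr01).
have s01 : s0 <= 1 by rewrite invf_le1// (lt_le_trans ltr01).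
have [V [w [x [[w_prob xRe xIm xv xb] trans]]]] := discretization mM indep bM EM VM K1 s00 s01.
have tau6 : tau <= 6 by apply: le_trans tau1 _; rewrite ler1n.
have [bad bad_good bad_prob] := grid_good_prob w_prob xRe xIm xv xb n0 B0 eta0_gt0 tau0 tau6.
have hexp : (C1 + 8) * ln n%:R <= tau ^+ 2 * n%:R * eta0 / (768 * (36 * K ^+ 2)).
  rewrite -[tau ^+ 2 * _ * _]mulrA nE le_eqVlt; apply/orP; left; apply/eqP.
  by field; rewrite !gt_eqF.
have [A mA [PA hA]] := trans bad _ (le_trans bad_prob (union_bound_numerics n100 pn hexp)).
exists A => //; split=> // u Au E s hE E4 es s4.
have [hK [om /bad_good good hd]] := hA u Au.
have n26 : (26 <= n)%N by exact: leq_trans n100.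
have hx k i : sqn (sample_matrix x om k i) <= 36 * K ^+ 2 by rewrite mxE.
exact: (@local_law_everywhere R p n (M u) (sample_matrix x om) K h y e1 tau eta0 n26 pn K1
  hK hx hd h0 h1 y0 y1 e1_1 e1y tau1 tc te nl nh eta0_gt0 ne good E s hE E4 es s4).
Qed.

End fixed_size.

(** * Bulk law for covariance matrices *)
Section degenerate_cases.
Variable R : realType.

Lemma empty_interval_close p n (W : 'M[R[i]]_n) (y delta : R) (I : interval R) :
  [set` I] = set0 ->
  `|(eigenvalue_count p W I)%:R - p%:R * MP_mass y I| <= delta * (p%:R * MP_mass y I).
Proof.
move=> I0; rewrite /MP_mass I0 Rintegral_set0 !mulr0 subr0 /eigenvalue_count.
rewrite (@eq_count _ _ pred0) ?count_pred0 ?normr0// => x /=.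
by apply/negP => xI; have : [set` I] x by [] ; rewrite I0.
Qed.

Lemma near_div_nat_le (r c : R) : 0 < c -> \forall n \near \oo, r / n%:R <= c.
Proof.
move=> c0; near=> n; have n0 : 0 < n%:R :> R by rewrite ltr0n; near: n; exact: nbhs_infty_gt.
rewrite ler_pdivrMr// mulrC -ler_pdivrMr//; near: n; exact: nbhs_infty_ger.
Unshelve. all: by end_near. Qed.

End degenerate_cases.

Theorem theoremB2 (R : realType) (eps delta C1 : R)
  (eps_gt0 : 0 < eps) (delta_gt0 : 0 < delta) (C1_gt0 : 0 < C1) :
  exists2 C2 : R, 0 < C2 &
  forall (p : nat -> nat) (y : R),
    (forall n, (p n <= n)%N) -> 0 < y -> y <= 1 ->
    ((p n)%:R / n%:R : R) @[n --> \oo] --> y ->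
  forall (d : nat -> measure_display) (T : forall n, measurableType (d n))
    (P : forall n, probability (T n) R)
    (K : nat -> R)
    (M : forall n, T n -> 'M[R[i]]_(p n, n)),
    (forall n i j, complex_rv (fun t => M n t i j)) ->
    (forall n, independent_rvs (P n)
       (fun (ij : 'I_(p n) * 'I_n) t => M n t ij.1 ij.2)) ->
    (forall n i j, K_bounded (P n) (K n) (fun t => M n t i j)) ->
    (forall n i j, cexpectation (P n) (fun t => M n t i j) = 0) ->
    (forall n i j, cvariance (P n) (fun t => M n t i j) = 1%E) ->
  \forall n \near \oo,
    with_probability_ge (P n) (1 - n%:R `^ (- C1))
      [set t | forall I : interval R,
         [set` I] `<=` `]MP_a y + eps, MP_b y - eps[%classic ->
         ((C2 * K n ^+ 2 * ln n%:R / n%:R)%:E <= lebesgue_measure [set` I])%E ->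
         `| (eigenvalue_count (p n) (sample_covariance (M n t)) I)%:R
            - (p n)%:R * MP_mass y I |
         <= delta * ((p n)%:R * MP_mass y I) ].
Proof.
pose e := Num.min eps 1.
have e0 : 0 < e by rewrite lt_min eps_gt0 ltr01.
have ele1 : e <= 1 by rewrite ge_min lexx orbT.
have ele : e <= eps by rewrite ge_min lexx.
have [e1 [rho [Lam [e1_0 e1h rho0 Lam0 sc]]]] := scale_choice e0 ele1 delta_gt0.
move: e1h sc; set h := e / 2 => e1h sc.
have h0 : 0 < h by exact: divr_gt0.
have h1 : h <= 1 by rewrite /h ler_pdivrMr// (le_trans ele1)// mul1r ler1n.
have h31 : h ^+ 3 <= 1 by apply: exprn_ile1 => //; exact: ltW.
have e1_1 : e1 <= 1 by clear -e1h h31; lra.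
have [tau tau0 [tau1 tauP]] := tau_choice h0 h1 e1_0 e1_1.
have t20 : 0 < tau ^+ 2 by rewrite exprn_gt0.
have C8 : 0 < C1 + 8 by rewrite addr_gt0.
pose Q := 768 * (C1 + 8) / tau ^+ 2.
have Q0 : 0 < Q by exact: divr_gt0 (mulr_gt0 (ltr0n _ 768) C8) t20.
have p36 : 0 < 36 :> R by rewrite ltr0n.
exists (Lam * (Q * 36)); first exact: mulr_gt0 Lam0 (mulr_gt0 Q0 p36).
move=> p y pn y0 y1 py d T P K M mM indep bM EM VM.
have [hy|hy] := leP (h ^+ 2) y; last first.
  (* The bulk is empty, so the only admissible interval is the empty one. *)
  apply: nearW => n; exists setT => //; split; last first.
    by rewrite probability_setT lee_fin gerBl powR_ge0.
  move=> t _ I sub _; apply: empty_interval_close; apply/seteqP; split => // x xI.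
  have := sub x xI; rewrite /= in_itv /= => /andP[ax xb].
  have := @bulk_nonempty_ratio R y e x (ltW e0) (ltW y0) _ _.
  have -> : e ^+ 2 / 4 = h ^+ 2 by rewrite /h; field.
  rewrite (leNgt (h ^+ 2)) hy => bulk; by apply/notF/bulk; clear -ax xb ele; lra.
have e1y : e1 <= y * (h / 2) / 2.
  apply: le_trans e1h _; rewrite exprSr.
  have : h ^+ 2 * h <= y * h by rewrite ler_pM2r.
  by clear; lra.
have hc0 : 0 < y * (h / 2) / 48 by rewrite divr_gt0// mulr_gt0// divr_gt0.
have dy0 : 0 < delta * y / 4 by rewrite divr_gt0// mulr_gt0.
have y20 : 0 < y / 2 by rewrite divr_gt0.
have e22 : 0 < e1 / 22 by rewrite divr_gt0.
move/cvgrPdist_le: py => py.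
near=> n.
have n100 : (100 <= n)%N by near: n; exact: nbhs_infty_ge.
have n1000 : 1000 / n%:R <= e1 by near: n; exact: near_div_nat_le.
have nl : 10 / n%:R <= y * (h / 2) / 48 by near: n; exact: near_div_nat_le.
have nh : 2 / n%:R <= h by near: n; exact: near_div_nat_le.
have pd : `|y - (p n)%:R / n%:R| <= delta * y / 4 by near: n; exact: py.
(* The factor [11] in the residual leaves half of [e1] to [tau]. *)
have pe : `|y - (p n)%:R / n%:R| <= e1 / 22 by near: n; exact: py.
have ph : `|y - (p n)%:R / n%:R| <= y / 2 by near: n; exact: py.
have py2 : y / 2 <= (p n)%:R / n%:R by have := ler_normlW ph; clear; lra.
have n0 : (0 < n)%N by exact: leq_trans n100.
have p0 : (0 < p n)%N.
  by rewrite lt0n; apply/eqP => pz; move: py2; rewrite pz mul0r leNgt y20.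
have K1 : 1 <= K n by exact: (entry_bound_ge1 (mM n) (bM n) (EM n) (VM n) (Ordinal p0) (Ordinal n0)).
have [tc te] := tauP y hy.
rewrite distrC in pd pe ph.
have te' : `|(p n)%:R / n%:R - y| * 11 +
    8 * (2 * (tau * (2 * (11 / (h / 2)) + 5)) / (y * (h / 2) / 384)) <= e1.
  by clear -te pe; lra.
have [eta_gt0 [A mA [PA hA]]] := fixed_size_local_law (mM n) (indep n) (bM n) (EM n) (VM n)
  n100 (pn n) K1 C1_gt0 h0 h1 y0 y1 e1_1 e1y tau0 tau1 tc te' nl nh.
exists A => //; split => // t At I sub; rewrite -/Q in eta_gt0 hA *.
set eta := Q * (36 * K n ^+ 2) * ln n%:R / n%:R in eta_gt0 hA *.
have -> : Lam * (Q * 36) * K n ^+ 2 * ln n%:R / n%:R = Lam * eta.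
  by rewrite /eta !mulrA.
move=> len.
have len0 : (0 < lebesgue_measure [set` I])%E.
  by apply: lt_le_trans len; rewrite lte_fin mulr_gt0.
have [b1 [b2 [al [be [IE ab aal beb mI]]]]] := interval_in_bounded sub len0.
rewrite mI lee_fin in len.
have a0 := MP_a_ge0 y; have b4 := MP_b_le4 y1.
have L4 : be - al <= 4 by clear -a0 b4 aal beb eps_gt0; lra.
have [er rh rL th1 err] := sc eta (be - al) eta_gt0 len L4.
rewrite IE; apply: (@interval_count_close R (p n) n (M n t) y e h (2 * e1) eta (rho * eta)
  delta al be b1 b2) => //.
- by rewrite mulr_ge0// ltW.
- move=> E s hE E4 es s4; have [v11 res] := hA t At E s hE E4 es s4; split=> //.
  by apply: le_trans res _; clear -n1000; lra.
- by apply: le_lt_trans rh _; apply: le_lt_trans h1 _; rewrite ltr1n.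
- by apply: le_trans aal; rewrite lerD2l.
- by apply: le_trans beb _; rewrite lerB.
Unshelve. all: by end_near. Qed.
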